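(* Let $W$ be a Gaussian free field on the unit disk $\mathbb{D}$, and let $W^{\mathbf h}_{\rho}(z)$ denote its hyperbolic average over the hyperbolic circle of centre $z$ and radius $\rho$. Let $z_1,z_2\in\mathbb{D}$ and let $\rho_1,\rho_2>0$ be real numbers. If $d^{\mathbf h}(z_1,z_2)\ge \rho_1+\rho_2$, then $$\operatorname{cov}\left(W^{\mathbf h}_{\rho_1}(z_1),W^{\mathbf h}_{\rho_2}(z_2)\right)=-\ln\left(\tanh\left(d^{\mathbf h}(z_1,z_2)\right)\right)=G_{\mathbb{D}}(z_1,z_2).$$
   Context: $\mathbb{D}=\{z\in\mathbb{C}: |z|<1\}$; all vector spaces and functions are real. The hyperbolic metric on $\mathbb{D}$ is $g^{\mathbf h}_z(u,v)=(1-|z|^2)^{-2}\,g_z(u,v)$, where $g$ is the Euclidean metric. $d^{\mathbf h}$ is the associated distance (infimum of $g^{\mathbf h}$-lengths of smooth paths), so that $|z|=\tanh(d^{\mathbf h}(0,z))$. An isometry of the Poincaré disk is a $C^\infty$-diffeomorphism of $\mathbb{D}$ preserving $g^{\mathbf h}$. For each $z\in\mathbb{D}$, $\Phi_z$ denotes an isometry of the Poincaré disk with $\Phi_z(z)=0$ (the functions below do not depend on the choice). The Green function of $\mathbb{D}$ is $G_{\mathbb{D}}(z_0,z)=-\ln(\tanh(d^{\mathbf h}(z_0,z)))$ for $z\neq z_0$. $H_0^1(\mathbb{D})$ is the closure of $C_c^\infty(\mathbb{D})$ in the Sobolev space $H^1(\mathbb{D})$ (Euclidean Lebesgue measure), regarded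 as a Hilbert space with the inner product $\langle u,v\rangle=\frac{1}{2\pi}\int_{\mathbb{D}}\nabla u\cdot\nabla v\,dx\,dy$. A Gaussian free field on $\mathbb{D}$ is a linear isometry $W:H_0^1(\mathbb{D})\to L^2(\Omega,\mathcal{F},\mathbb{P})$, for some probability space, such that for every $u\in H_0^1(\mathbb{D})$ the random variable $W(u)$, also written $\langle u,W\rangle$, is a centred real Gaussian (necessarily of variance $\|u\|^2=\langle u,u\rangle$). For $r\in(0,1)$ set $G_0^r(z)=-\ln(\max(r,|z|))$, $z\in\mathbb{D}$; one has $G_0^r\circ\Phi_z\in H_0^1(\mathbb{D})$. For $z\in\mathbb{D}$ and $\rho>0$, the hyperbolic average of $W$ over the hyperbolic circle of centre $z$ and radius $\rho$ is defined as $W^{\mathbf h}_\rho(z):=\langle G_0^r\circ\Phi_z,W\rangle$ with $r=\tanh(\rho)$. *)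

(* Defs.v *)
From HB Require Import structures.
From mathcomp Require Import all_boot all_order all_algebra.
From mathcomp Require Import all_classical all_reals all_analysis.

Set Implicit Arguments.
Unset Strict Implicit.
Unset Printing Implicit Defensive.

Import Order.TTheory GRing.Theory Num.Def Num.Theory.
Import numFieldNormedType.Exports.

Local Open Scope classical_set_scope.
Local Open Scope ring_scope.

(* The complex plane is represented by R * R. The norm that the library puts
   on R * R is the maximum norm, so the modulus |z| is [cmod z], never `|z|. *)
Section Plane.
Variable R : realType.
Implicit Types (z u v : R * R).

Definition e1 : R * R := (1, 0).
Definition e2 : R * R := (0, 1).

Definition euclidean_metric u v : R := u.1 * v.1 + u.2 * v.2.

Definition cmod z : R := sqrtr (z.1 ^+ 2 + z.2 ^+ 2).

Definition disk : set (R * R) := [set z | cmod z < 1].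

Definition plane_measure : set (measurableTypeR R * measurableTypeR R) -> \bar R :=
  (@lebesgue_measure R \x @lebesgue_measure R)%E.

End Plane.

Arguments e1 {R}.
Arguments e2 {R}.
Arguments disk {R}.
Arguments plane_measure {R}.

Section Smooth.
Variables (R : realType) (V W : normedModType R).

Fixpoint iter_derive (s : seq V) (f : V -> W) : V -> W :=
  if s is v :: s' then 'D_v (iter_derive s' f) else f.

(* For U open in a finite-dimensional V: f is C^oo on U, i.e. all iterated
   directional derivatives exist and are continuous at every point of U.
   Since U is open, the values of f outside U are irrelevant. *)
Definition smooth_on (U : set V) (f : V -> W) : Prop :=
  forall (s : seq V) (x : V), U x ->
    {for x, continuous (iter_derive s f)} /\
    forall v : V, derivable (iter_derive s f) x v.

End Smooth.

Section Hyperbolic.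
Variable R : realType.
Implicit Types (z w u v : R * R) (Phi : R * R -> R * R).

Definition tanh (x : R) : R :=
  (expR x - expR (- x)) / (expR x + expR (- x)).

Definition hyp_metric z u v : R :=
  (1 - cmod z ^+ 2) ^- 2 * euclidean_metric u v.

(* Smoothness on the closed interval [0, 1] is smoothness on some open
   neighbourhood of it. *)
Definition smooth_path z w (gamma : R -> R * R) : Prop :=
  [/\ exists U : set R,
        [/\ open U, `[0, 1]%classic `<=` U & smooth_on U gamma],
      forall t, 0 <= t <= 1 -> disk (gamma t),
      gamma 0 = z & gamma 1 = w].

Definition hyp_length (gamma : R -> R * R) : R :=
  \int[@lebesgue_measure R]_(t in `[0, 1])
    sqrtr (hyp_metric (gamma t) (derive1 gamma t) (derive1 gamma t)).

Definition hyp_dist z w : R :=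
  inf [set hyp_length gamma | gamma in smooth_path z w].

(* Orientation-reversing isometries are included. *)
Definition poincare_isometry Phi : Prop :=
  [/\ smooth_on disk Phi,
      forall z, disk z -> disk (Phi z),
      exists Psi : R * R -> R * R,
        [/\ smooth_on disk Psi,
            forall z, disk z -> disk (Psi z),
            forall z, disk z -> Psi (Phi z) = z
          & forall z, disk z -> Phi (Psi z) = z]
    & forall z u v, disk z ->
        hyp_metric (Phi z) ('D_u Phi z) ('D_v Phi z) = hyp_metric z u v].

Definition green (z0 z : R * R) : R := - ln (tanh (hyp_dist z0 z)).

Definition green0_trunc (r : R) z : R := - ln (maxr r (cmod z)).

End Hyperbolic.

(* Elements of L^2(D) and of the Sobolev spaces are represented by functions on
   the whole plane, of which only the (almost everywhere) restriction to the
   disk matters. *)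
Section Sobolev.
Variable R : realType.
Implicit Types (u v p phi : R * R -> R).

Definition L2_disk u : Prop :=
  measurable_fun (disk : set (measurableTypeR R * measurableTypeR R)) u /\
  plane_measure.-integrable disk (EFin \o (fun z => u z ^+ 2)).

Definition test_function phi : Prop :=
  smooth_on setT phi /\
  exists K : set (R * R),
    [/\ compact K, K `<=` disk & forall z, ~ K z -> phi z = 0].

(* p is an L^2 representative of the weak derivative of u in direction e *)
Definition is_weak_derive (e : R * R) u p : Prop :=
  L2_disk p /\
  forall phi, test_function phi ->
    \int[plane_measure]_(z in disk) (u z * 'D_e phi z) =
    - \int[plane_measure]_(z in disk) (p z * phi z).

Definition H1 u : Prop :=
  [/\ L2_disk u, exists p, is_weak_derive e1 u p
    & exists q, is_weak_derive e2 u q].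

(* A choice of weak derivative; it is unique up to a null set when it exists. *)
Definition weak_derive (e : R * R) u : R * R -> R :=
  xget (cst 0) [set p | is_weak_derive e u p].

Definition H1_norm u : R :=
  sqrtr (\int[plane_measure]_(z in disk)
    (u z ^+ 2 + (weak_derive e1 u z ^+ 2 + weak_derive e2 u z ^+ 2))).

Definition H01 u : Prop :=
  H1 u /\
  forall eps : R, 0 < eps ->
    exists2 phi, test_function phi & H1_norm (u \- phi) < eps.

Definition dirichlet u v : R :=
  (2 * pi)^-1 * \int[plane_measure]_(z in disk)
    (weak_derive e1 u z * weak_derive e1 v z +
     weak_derive e2 u z * weak_derive e2 v z).

End Sobolev.

Section GaussianFreeField.
Context {R : realType} {d : measure_display} {Omega : measurableType d}.
Variable P : probability Omega R.

(* The library's [normal_prob 0 0] is not the Dirac mass, so the degenerate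
   Gaussian law is treated apart. *)
Definition centred_gaussian (X : {RV P >-> R}) : Prop :=
  exists sigma : R, forall A : set (measurableTypeR R), measurable A ->
    distribution P X A =
      if sigma == 0 then \d_(0 : measurableTypeR R) A
      else normal_prob 0 sigma A.

(* W only matters on H_0^1. That W u depends, up to a null event, only on the
   class of u in H_0^1 follows from linearity and the isometry property. *)
Record gaussian_free_field (W : (R * R -> R) -> {RV P >-> R}) : Prop := {
  gff_linear : forall (a : R) (u v : R * R -> R), H01 u -> H01 v ->
    {ae P, forall x, W (a \*: u \+ v) x = a * W u x + W v x};
  gff_isometry : forall u : R * R -> R, H01 u ->
    ('E_P[W u \* W u] = (dirichlet u u)%:E)%E;
  gff_gaussian : forall u : R * R -> R, H01 u -> centred_gaussian (W u)
}.

(* Phi z is the chosen isometry mapping z to the origin. *)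
Definition hyp_average (Phi : R * R -> R * R -> R * R)
    (W : (R * R -> R) -> {RV P >-> R}) (rho : R) (z : R * R) : {RV P >-> R} :=
  W (green0_trunc (tanh rho) \o Phi z).

End GaussianFreeField.

(* Main.v *)
Require Import Defs.
From HB Require Import structures.
From mathcomp Require Import all_boot all_order all_algebra.
From mathcomp Require Import all_classical all_reals all_analysis.
From mathcomp Require Import measurable_realfun ring lra.
Import Order.TTheory GRing.Theory Num.Def Num.Theory.
Import numFieldNormedType.Exports.
Local Open Scope classical_set_scope.
Local Open Scope ring_scope.

Set Implicit Arguments.
Unset Strict Implicit.
Unset Printing Implicit Defensive.

(* Write S_i(z) = |z - z_i|^2 / |1 - conj(z_i) z|^2, the squared modulus of the Moebius
   map sending z_i to 0; it equals tanh(d(z_i, z))^2. The averaged field is W(f_i) with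
   f_i = - ln(max(tanh(rho_i)^2, S_i)) / 2, so by polarization of the isometry property
   the covariance is the Dirichlet product <f_1, f_2>.
   Let g be - ln(S_2) / 2 with the pole at z_2 smoothed at a small scale. Up to smoothing,
   f_2 - g is a test function supported in S_2 <= tanh(rho_2)^2; there f_1 = - ln(S_1) / 2
   is harmonic, because the two hyperbolic disks do not overlap. Hence
   <f_1, f_2> = <f_1, g> = - (2 pi)^-1 \int f_1 (laplacian g). The Laplacian of g is
   supported in a small square centred at z_2 and has integral - 2 pi, so letting the
   scale tend to 0 gives f_1(z_2) = - ln(S_1(z_2)) / 2 = - ln(tanh(d(z_1, z_2))). *)

(** The obstacles are low regularity and arbitrary choices in the definitions. A truncated function
    is not differentiable across its circle, tends to 0 at the unit circle without vanishing near
    it, and [weak_derive] is an unspecified representative. [test_limit] answers all three: bounded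
    pointwise limits of test functions pass through every integral by dominated convergence, lie in
    [H01] and have an explicit gradient. Hyperbolic distance is an infimum over smooth paths, so its
    formula in terms of Moebius maps has to be proved; since [Phi z] enters only through its
    modulus, the same formula disposes of the choice of isometry without classifying isometries. The
    pole is enclosed in a square, not a circle: Fubini and the one-dimensional fundamental theorem
    then suffice, and 2 pi appears as the flux through four sides, pi / 2 each. The two hyperbolic
    disks may touch, so no gap between them is available: the truncation at level [c] is smoothed
    only below [c], which leaves [f_2] exact on and outside its circle and confines the correction
    to the disk on which [f_1] is not truncated. *)

Section SmoothCalculus.
Context {R : realType}.

Lemma near_eq_differentiable {V W : normedModType R} (f g : V -> W) x :
  {near x, f =1 g} -> differentiable f x -> differentiable g x.
Proof.
move=> fg df; have [dc E] := (diff_locallyP _ _).1 df.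
have gd : g \o shift x = cst (g x) + 'd f x +o_ 0 id.
  apply/eqaddoP => _/posnumP[e].
  have /eqaddoP/(_ e%:num)/(_ [gt0 of e%:num]) := E.
  have fgx := nbhs_singleton fg.
  move: fg; rewrite (near_shift 0) subr0 => fg.
  apply: filterS2 fg => h /= fgh; rewrite !fctE /= -fgh fgx.
  by [].
have dE : 'd g x = 'd f x :> (V -> W) by exact: diff_unique.
by apply/diff_locallyP; rewrite dE.
Qed.

Lemma near_eq_continuous {T W : topologicalType} (f g : T -> W) x :
  {near x, f =1 g} -> {for x, continuous f} -> {for x, continuous g}.
Proof.
move=> fg cf; suff : g y @[y --> x] --> g x by [].
by rewrite -(nbhs_singleton fg); apply: cvg_trans cf; exact: near_eq_cvg.
Qed.

(** * Functions of class C^n on an open set *)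

Section Domain.
Context {V : normedModType R}.
Implicit Types (U : set V) (f g : V -> R).

(** [smooth_on] speaks of directional derivatives only, which do not by themselves give the chain
    rule. Here Frechet differentiability is required at every order below [n], so that the class is
    stable under composition; the finite order gives the inductions something to run on. *)
Fixpoint Cn n U f : Prop :=
  if n is n'.+1 then
    (forall x, U x -> differentiable f x) /\ forall v, Cn n' U ('D_v f)
  else forall x, U x -> {for x, continuous f}.

Definition Cinf U f := forall n, Cn n U f.

Lemma eq_on_near U f g x : open U -> U x -> {in U, f =1 g} -> {near x, f =1 g}.
Proof.
move=> oU Ux fg; apply: (@filterS _ (nbhs x) _ U).
  by move=> y Uy; apply: fg; rewrite inE.
exact: open_nbhs_nbhs.
Qed.

Lemma eq_on_derive {W : normedModType R} U (f g : V -> W) v :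
  open U -> {in U, f =1 g} -> {in U, 'D_v f =1 'D_v g}.
Proof.
move=> oU fg x; rewrite inE => Ux; apply: near_eq_derive.
apply: (@filterS _ (nbhs x) _ U).
  by move=> y Uy; apply: fg; rewrite inE.
exact: open_nbhs_nbhs.
Qed.

Lemma Cn_ext n U f g : open U -> {in U, f =1 g} -> Cn n U f -> Cn n U g.
Proof.
move=> oU; elim: n f g => [|n IH] f g fg /=.
  move=> fc x Ux; have fgx := eq_on_near oU Ux fg.
  exact: near_eq_continuous fgx (fc x Ux).
move=> [df Df]; split=> [x Ux|v].
  exact: near_eq_differentiable (eq_on_near oU Ux fg) (df x Ux).
by apply: IH (Df v) => x xU; exact: (eq_on_derive v oU fg xU).
Qed.

Lemma CnW n U f : Cn n.+1 U f -> Cn n U f.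
Proof.
elim: n f => [|n IH] f /= [df Df].
  by move=> x /df /differentiable_continuous.
by split=> // v; apply: IH (Df v).
Qed.

Lemma CnS n U U' f : U' `<=` U -> Cn n U f -> Cn n U' f.
Proof.
move=> UU; elim: n f => [|n IH] f /=; first by move=> h x /UU /h.
by move=> [df Df]; split=> [x /UU /df//|v]; exact: IH.
Qed.

Lemma Cn_cst n U (c : R) : Cn n U (cst c).
Proof.
elim: n c => [|n IH] c /=; first by move=> x _; exact: cst_continuous.
split=> [x _|v]; first exact: differentiable_cst.
rewrite (_ : 'D_v _ = cst 0) ?IH//; apply/funext => x; exact: derive_cst.
Qed.

Lemma CnD n U f g : open U -> Cn n U f -> Cn n U g -> Cn n U (f \+ g).
Proof.
move=> oU; elim: n f g => [|n IH] f g /=.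
  by move=> cf cg x Ux; apply: continuousD; [exact: cf|exact: cg].
move=> [df Df] [dg Dg]; split=> [x Ux|v].
  by apply: differentiableD; [exact: df|exact: dg].
apply: (Cn_ext (f := 'D_v f \+ 'D_v g)) => //; last exact: IH.
move=> x; rewrite inE => Ux; rewrite [RHS]deriveD//.
  exact/diff_derivable/df.
exact/diff_derivable/dg.
Qed.

Lemma CnM n U f g : open U -> Cn n U f -> Cn n U g -> Cn n U (f \* g).
Proof.
move=> oU; elim: n f g => [|n IH] f g /=.
  by move=> cf cg x Ux; apply: continuousM; [exact: cf|exact: cg].
move=> [df Df] [dg Dg]; split=> [x Ux|v].
  by apply: differentiableM; [exact: df|exact: dg].
apply: (Cn_ext (f := (f \* 'D_v g) \+ (g \* 'D_v f))) => //.
  move=> x; rewrite inE => Ux; rewrite [RHS]deriveM//.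
    exact/diff_derivable/df.
  exact/diff_derivable/dg.
by apply: CnD => //; apply: IH => //; exact: CnW.
Qed.

Lemma differentiable_comp_derive {W : normedModType R} (f : V -> W) (g : W -> R) x v :
  differentiable f x -> differentiable g (f x) ->
  'D_v (g \o f) x = 'D_('D_v f x) g (f x).
Proof.
move=> df dg; rewrite deriveE; last exact: differentiable_comp.
by rewrite diff_comp//= !deriveE.
Qed.

Lemma deriveR_scale (h : R -> R) (a t : R) : differentiable h t ->
  'D_a h t = a * 'D_1 h t.
Proof.
by move=> dh; rewrite !deriveE// -{1}(mulr1 a) -[a * 1]/(a *: (1 : R)) linearZ.
Qed.

Lemma derive_comp1 (u : V -> R) (h : R -> R) x v :
  differentiable u x -> differentiable h (u x) ->
  'D_v (h \o u) x = 'D_v u x * 'D_1 h (u x).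
Proof. by move=> du dh; rewrite differentiable_comp_derive// deriveR_scale. Qed.

Lemma derive_pairE (u1 u2 : V -> R) x v :
  differentiable u1 x -> differentiable u2 x ->
  'D_v (fun y => (u1 y, u2 y)) x = ('D_v u1 x, 'D_v u2 x).
Proof.
move=> d1 d2; rewrite deriveE; last exact: differentiable_pair.
by rewrite diff_pair// !deriveE.
Qed.

Lemma deriveRR_split (f : R * R -> R) (a b : R) z : differentiable f z ->
  'D_(a, b) f z = a * 'D_e1 f z + b * 'D_e2 f z.
Proof.
move=> df; rewrite !deriveE//.
have -> : (a, b) = a *: e1 + b *: e2 :> R * R.
  by rewrite /e1 /e2; congr pair; rewrite /= /GRing.scale /= ?mulr1 ?mulr0 ?addr0 ?add0r.
by rewrite linearD !linearZ.
Qed.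

Lemma derive_comp2 (u1 u2 : V -> R) (f : R * R -> R) x v :
  differentiable u1 x -> differentiable u2 x -> differentiable f (u1 x, u2 x) ->
  'D_v (fun y => f (u1 y, u2 y)) x =
  'D_v u1 x * 'D_e1 f (u1 x, u2 x) + 'D_v u2 x * 'D_e2 f (u1 x, u2 x).
Proof.
move=> d1 d2 df.
rewrite -[LHS]/('D_v (f \o (fun y => (u1 y, u2 y))) x).
rewrite differentiable_comp_derive//; last exact: differentiable_pair.
by rewrite derive_pairE// deriveRR_split.
Qed.

End Domain.

(** * The chain rule in class C^n *)

Section Composition.
Context {V : normedModType R}.
Implicit Types (U : set V) (A : set R).

Lemma Cn_comp1 n U A (u : V -> R) (h : R -> R) : open U ->
  (forall x, U x -> A (u x)) -> Cn n U u -> Cn n A h -> Cn n U (h \o u).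
Proof.
move=> oU UA; elim: n u h UA => [|n IH] u h UA /=.
  by move=> cu ch x Ux; apply: continuous_comp; [exact: cu|apply: ch; exact: UA].
move=> [du Du] [dh Dh]; split=> [x Ux|v].
  by apply: differentiable_comp; [exact: du|apply: dh; exact: UA].
apply: (Cn_ext (f := 'D_v u \* ('D_1 h \o u))) => //.
  move=> x; rewrite inE => Ux; rewrite derive_comp1//; first exact: du.
  by apply: dh; exact: UA.
by apply: CnM => //; apply: IH => //; exact: CnW.
Qed.

(** A plane-valued inner function is given by its two real components, so all derivatives stay
    real-valued and [CnM] and [CnD] close the induction. *)
Lemma Cn_comp2 n U (A : set (R * R)) (u1 u2 : V -> R) (f : R * R -> R) : open U ->
  (forall x, U x -> A (u1 x, u2 x)) -> Cn n U u1 -> Cn n U u2 -> Cn n A f ->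
  Cn n U (fun x => f (u1 x, u2 x)).
Proof.
move=> oU; elim: n u1 u2 f => [|n IH] u1 u2 f UA /=.
  move=> c1 c2 cf x Ux.
  apply: (@continuous_comp _ _ _ (fun x => (u1 x, u2 x)) f).
    by apply: (cvg_pair (c1 x Ux) (c2 x Ux)).
  by apply: cf; exact: UA.
move=> [d1 D1] [d2 D2] [df Df]; split=> [x Ux|v].
  apply: (@differentiable_comp _ _ _ _ (fun x => (u1 x, u2 x)) f).
    by apply: differentiable_pair; [exact: d1|exact: d2].
  by apply: df; exact: UA.
apply: (Cn_ext (f := ('D_v u1 \* (fun x => 'D_e1 f (u1 x, u2 x))) \+
  ('D_v u2 \* (fun x => 'D_e2 f (u1 x, u2 x))))) => //.
  move=> x; rewrite inE => Ux; rewrite derive_comp2//;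
  by [exact: d1|exact: d2|apply: df; exact: UA].
have W1 : Cn n U u1 by exact: CnW.
have W2 : Cn n U u2 by exact: CnW.
have I1 := IH _ _ _ UA W1 W2 (Df e1); have I2 := IH _ _ _ UA W1 W2 (Df e2).
by apply: CnD => //; apply: CnM.
Qed.

End Composition.

(** * Smooth functions and elementary examples *)

Section CinfClosure.
Context {V : normedModType R}.
Implicit Types (U : set V) (f g : V -> R).

Lemma Cinf_differentiable U f x : Cinf U f -> U x -> differentiable f x.
Proof. by move=> /(_ 1%N)[df _] /df. Qed.

Lemma Cinf_derive U f v : Cinf U f -> Cinf U ('D_v f).
Proof. by move=> fU n; have [_ ] := fU n.+1; exact. Qed.

Lemma Cinf_continuous U f x : Cinf U f -> U x -> {for x, continuous f}.
Proof. by move=> /(_ 0%N) fc /fc. Qed.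

Lemma Cinf_ext U f g : open U -> {in U, f =1 g} -> Cinf U f -> Cinf U g.
Proof. by move=> oU fg fU n; exact: (Cn_ext oU fg). Qed.

Lemma CinfS U U' f : U' `<=` U -> Cinf U f -> Cinf U' f.
Proof. by move=> UU fU n; exact: CnS (fU n). Qed.

Lemma Cinf_cst U (c : R) : Cinf U (cst c).
Proof. by move=> n; exact: Cn_cst. Qed.

Lemma CinfD U f g : open U -> Cinf U f -> Cinf U g -> Cinf U (f \+ g).
Proof. by move=> oU fU gU n; exact: CnD. Qed.

Lemma CinfM U f g : open U -> Cinf U f -> Cinf U g -> Cinf U (f \* g).
Proof. by move=> oU fU gU n; exact: CnM. Qed.

Lemma CinfZ U (c : R) f : open U -> Cinf U f -> Cinf U (fun x => c * f x).
Proof. by move=> oU fU; apply: (@CinfM _ (cst c)) => //; exact: Cinf_cst. Qed.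

Lemma CinfN U f : open U -> Cinf U f -> Cinf U (fun x => - f x).
Proof.
move=> oU fU; apply: (Cinf_ext (f := fun x => -1 * f x)) => //.
  by move=> x _; rewrite mulN1r.
exact: CinfZ.
Qed.

Lemma CinfB U f g : open U -> Cinf U f -> Cinf U g -> Cinf U (f \- g).
Proof. by move=> oU fU gU; apply: CinfD => //; exact: CinfN. Qed.

Lemma Cinf_comp1 U A f (h : R -> R) : open U ->
  (forall x, U x -> A (f x)) -> Cinf U f -> Cinf A h -> Cinf U (h \o f).
Proof. by move=> oU UA fU hA n; exact: Cn_comp1 (fU n) (hA n). Qed.

Lemma Cinf_comp2 U (A : set (R * R)) (u1 u2 : V -> R) (f : R * R -> R) : open U ->
  (forall x, U x -> A (u1 x, u2 x)) -> Cinf U u1 -> Cinf U u2 -> Cinf A f ->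
  Cinf U (fun x => f (u1 x, u2 x)).
Proof. by move=> oU UA h1 h2 hf n; exact: Cn_comp2 (h1 n) (h2 n) (hf n). Qed.

Lemma Cinf_smooth U f : Cinf U f -> smooth_on U f.
Proof.
move=> fU s x Ux.
have sU : Cinf U (iter_derive s f).
  by elim: s => //= v s IH; exact: Cinf_derive.
split; first exact: Cinf_continuous Ux.
by move=> v; apply/diff_derivable; exact: Cinf_differentiable Ux.
Qed.

Lemma iter_derive_rcons {W : normedModType R} s v (f : V -> W) :
  iter_derive s ('D_v f) = iter_derive (s ++ [:: v]) f.
Proof. by elim: s => //= w s ->. Qed.

Lemma smooth_on_derive {W : normedModType R} U (f : V -> W) v :
  smooth_on U f -> smooth_on U ('D_v f).
Proof. by move=> fU s x Ux; rewrite iter_derive_rcons; exact: fU. Qed.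

End CinfClosure.

Lemma Cinf_id : Cinf [set: R] id.
Proof.
case=> [|n] /=; first by move=> x _; exact: cvg_id.
split=> [//|v]; rewrite (_ : 'D_v _ = cst v); first exact: Cn_cst.
by apply/funext => x; exact: derive_id.
Qed.

Lemma is_diff_fst (z : R * R) : is_diff z (fst : R * R -> R) fst.
Proof.
have lin : linear (fst : R * R -> R) by move=> a u v.
pose M := GRing.isLinear.Build _ _ _ _ _ lin.
pose L : {linear (R * R)%type -> R} := HB.pack (fst : R * R -> R) M.
have cL : continuous L by move=> x; exact: cvg_fst.
have dL : differentiable L z by exact: linear_differentiable.
by split; [exact: dL|exact: (@diff_lin _ _ _ L)].
Qed.

Lemma is_diff_snd (z : R * R) : is_diff z (snd : R * R -> R) snd.
Proof.
have lin : linear (snd : R * R -> R) by move=> a u v.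
pose M := GRing.isLinear.Build _ _ _ _ _ lin.
pose L : {linear (R * R)%type -> R} := HB.pack (snd : R * R -> R) M.
have cL : continuous L by move=> x; exact: cvg_snd.
have dL : differentiable L z by exact: linear_differentiable.
by split; [exact: dL|exact: (@diff_lin _ _ _ L)].
Qed.

Lemma derive_fst (v z : R * R) : 'D_v (fst : R * R -> R) z = v.1.
Proof. by have [d E] := is_diff_fst z; rewrite deriveE// E. Qed.

Lemma derive_snd (v z : R * R) : 'D_v (snd : R * R -> R) z = v.2.
Proof. by have [d E] := is_diff_snd z; rewrite deriveE// E. Qed.

Lemma Cinf_fst : Cinf [set: R * R] fst.
Proof.
case=> [|n] /=; first by move=> x _; exact: cvg_fst.
split=> [x _|v]; first by have [] := is_diff_fst x.
rewrite (_ : 'D_v _ = cst v.1); first exact: Cn_cst.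
by apply/funext => x; exact: derive_fst.
Qed.

Lemma Cinf_snd : Cinf [set: R * R] snd.
Proof.
case=> [|n] /=; first by move=> x _; exact: cvg_snd.
split=> [x _|v]; first by have [] := is_diff_snd x.
rewrite (_ : 'D_v _ = cst v.2); first exact: Cn_cst.
by apply/funext => x; exact: derive_snd.
Qed.

Lemma open_neq0 : open [set x : R | x != 0].
Proof.
rewrite (_ : [set _ | _] = ~` [set 0]); first exact: closed_openC (@closed_eq _ _).
by apply/seteqP; split=> x /= /eqP.
Qed.

Lemma derive_inv (x : R) : x != 0 -> 'D_1 (@GRing.inv R) x = - (x^-1 * x^-1).
Proof.
move=> x0; rewrite (@deriveV _ _ id)//.
by rewrite derive_id expr2 invfM scaleNr [_ *: _]mulr1.
Qed.

(** The derivative is a polynomial in the function itself, so the induction on the order needs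
    nothing but products. *)
Lemma Cinf_inv : Cinf [set x : R | x != 0] (@GRing.inv R).
Proof.
elim=> [|n IH] /=; first by move=> x /= x0; exact: inv_continuous.
split=> [x x0|v]; first exact: differentiable_Rinv.
have o0 := open_neq0.
apply: (Cn_ext (f := cst (- v) \* (@GRing.inv R \* @GRing.inv R))) => //.
  move=> x; rewrite inE /= => x0.
  by rewrite deriveR_scale ?derive_inv ?mulrN ?mulNr//; exact: differentiable_Rinv.
by do 2?apply: CnM => //; exact: Cn_cst.
Qed.

Lemma Cinf_ln : Cinf [set x : R | 0 < x] (@ln R).
Proof.
have o0 : open [set x : R | 0 < x] by exact: open_gt.
have dl (x : R) : 0 < x -> differentiable (@ln R) x.
  by move=> x0; apply/derivable1_diffP; have [] := is_derive1_ln x0.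
case=> [|n] /=; first by move=> x /= x0; exact: continuous_ln.
split=> [x x0|v]; first exact: dl.
apply: (Cn_ext (f := cst v \* @GRing.inv R)) => //.
  move=> x; rewrite inE /= => x0; rewrite deriveR_scale; last exact: dl.
  by have [_ ->] := is_derive1_ln x0.
apply: CnM => //; first exact: Cn_cst.
by apply: CnS (Cinf_inv n) => x /= /lt0r_neq0.
Qed.

End SmoothCalculus.

(** * From continuous partial derivatives to Frechet differentiability *)

Section SmoothFromPartials.
Context {R : realType}.

(** The mean value theorem gives an error bound that depends only on [d] and [e]. In
    [C1_differentiable] the function [g] itself varies with the increment, so a bare limit of
    difference quotients would not do. *)
Lemma mvt_near (g dg : R -> R) (x c d e : R) :
  (forall t, `|t - x| < d -> is_derive t 1 g (dg t)) ->
  (forall t, `|t - x| < d -> `|dg t - c| <= e) ->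
  forall h, `|h| < d -> `|g (x + h) - g x - c * h| <= e * `|h|.
Proof.
move=> Dg He h hd.
have cg t : `|t - x| < d -> {for t, continuous g}.
  move=> /Dg Dt; apply/differentiable_continuous/derivable1_diffP.
  by have [] := Dt.
have key (a b : R) : a <= b -> (forall t, t \in `[a, b] -> `|t - x| < d) ->
    `|g b - g a - c * (b - a)| <= e * `|b - a|.
  move=> ab tab.
  have [||t tI ->] := @MVT_segment R g dg a b ab.
  - move=> t tI; apply/Dg/tab; exact: subset_itv_oo_cc tI.
  - apply: continuous_in_subspaceT => t; rewrite inE => tI.
    by apply/cg/tab.
  by rewrite -mulrBl normrM ler_wpM2r//; apply/He/tab.
have [h0|h0] := leP 0 h.
  have := key x (x + h); rewrite lerDl (addrC x) addrK; apply=> // t.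
  rewrite in_itv /= => /andP[t1 t2]; rewrite ger0_norm ?subr_ge0//.
  by rewrite ger0_norm// in hd; rewrite ltrBlDr (le_lt_trans t2)// ltrD2r.
have := key (x + h) x; rewrite gerDl => K.
have {}K : `|g x - g (x + h) - c * (x - (x + h))| <= e * `|x - (x + h)|.
  apply: K => [|t]; first exact: ltW.
  rewrite in_itv /= => /andP[t1 t2]; rewrite ler0_norm ?subr_le0// opprB.
  rewrite ltr0_norm// in hd; rewrite ltrBlDr -ltrBlDl.
  by apply: lt_le_trans t1; rewrite ltrD2l ltrNl.
rewrite (_ : x - (x + h) = - h) in K; last by rewrite opprD addrA subrr add0r.
rewrite normrN mulrN opprK in K.
by rewrite -normrN (_ : - (g (x + h) - g x - c * h) = g x - g (x + h) + c * h)//; ring.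
Qed.

Lemma is_derive_e1 (f : R * R -> R) (s y : R) : derivable f (s, y) e1 ->
  is_derive s 1 (fun t => f (t, y)) ('D_e1 f (s, y)).
Proof.
move=> df; have E : (fun h : R => h^-1 *: (((fun t => f (t, y)) \o shift s) (h *: 1) -
     (f (s, y)))) = (fun h : R => h^-1 *: ((f \o shift (s, y)) (h *: e1) - f (s, y))).
  apply/funext => h /=; congr (_ *: (f _ - _)).
  by rewrite /e1; congr pair; rewrite /= [_ *: 0]mulr0 add0r.
by split; rewrite /derivable /derive E.
Qed.

Lemma is_derive_e2 (f : R * R -> R) (s y : R) : derivable f (s, y) e2 ->
  is_derive y 1 (fun t => f (s, t)) ('D_e2 f (s, y)).
Proof.
move=> df; have E : (fun h : R => h^-1 *: (((fun t => f (s, t)) \o shift y) (h *: 1) -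
     (f (s, y)))) = (fun h : R => h^-1 *: ((f \o shift (s, y)) (h *: e2) - f (s, y))).
  apply/funext => h /=; congr (_ *: (f _ - _)).
  by rewrite /e2; congr pair; rewrite /= [_ *: 0]mulr0 add0r.
by split; rewrite /derivable /derive E.
Qed.

Lemma differentiable_linear_approx {V W : normedModType R} (f : V -> W)
    (L : {linear V -> W}) x : continuous L ->
  (forall e : R, 0 < e -> \forall h \near 0, `|f (h + x) - (f x + L h)| <= e * `|h|) ->
  differentiable f x.
Proof.
move=> cL H; have E : f \o shift x = cst (f x) + L +o_ 0 id.
  by apply/eqaddoP => _/posnumP[e]; exact: H.
have dE : 'd f x = L :> (V -> W) by exact: diff_unique.
by apply/diff_locallyP; rewrite dE.
Qed.

(** The increment is taken along the horizontal segment at height [y + h.2], then along the vertical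
    one at abscissa [x], each with half of the tolerance. In the maximum norm neither segment leaves
    the ball. *)
Lemma C1_differentiable (f : R * R -> R) (z : R * R) :
  (\forall w \near z, derivable f w e1) -> (\forall w \near z, derivable f w e2) ->
  {for z, continuous ('D_e1 f)} -> {for z, continuous ('D_e2 f)} ->
  differentiable f z.
Proof.
case: z => x y d1 d2 c1 c2.
have [a aE] : exists a : R, a = 'D_e1 f (x, y) by exists ('D_e1 f (x, y)).
have [b bE] : exists b : R, b = 'D_e2 f (x, y) by exists ('D_e2 f (x, y)).
have lin : linear (fun h : R * R => a * h.1 + b * h.2).
  move=> k [u1 u2] [v1 v2]; rewrite /= -[LHS]/(a * (k * u1 + v1) + b * (k * u2 + v2)).
  by rewrite -[RHS]/(k * (a * u1 + b * u2) + (a * v1 + b * v2)); ring.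
pose M := GRing.isLinear.Build _ _ _ _ _ lin.
pose L : {linear (R * R)%type -> R} := HB.pack (fun h : R * R => a * h.1 + b * h.2) M.
have cL : continuous L.
  move=> u; apply: cvgD; apply: cvgM; do ?exact: cvg_cst.
    exact: cvg_fst.
  exact: cvg_snd.
apply: (differentiable_linear_approx cL) => _/posnumP[e].
have e0 : 0 < e%:num / 2 by rewrite divr_gt0.
have n1 : \forall w \near (x, y), `|'D_e1 f w - a| <= e%:num / 2.
  rewrite aE.
  by move/cvgrPdist_le : c1 => /(_ _ e0); apply: filterS => w; rewrite distrC.
have n2 : \forall w \near (x, y), `|'D_e2 f w - b| <= e%:num / 2.
  rewrite bE.
  by move/cvgrPdist_le : c2 => /(_ _ e0); apply: filterS => w; rewrite distrC.
have : \forall w \near (x, y), [/\ derivable f w e1, derivable f w e2,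
  `|'D_e1 f w - a| <= e%:num / 2 & `|'D_e2 f w - b| <= e%:num / 2].
  by apply: filterS2 (filterI d1 d2) (filterI n1 n2) => w [? ?] [].
move=> /nbhs_ballP[d /= d0 Hd]; apply/nbhs_ballP; exists d => // h [/= h1 h2].
rewrite /ball /= !sub0r !normrN in h1 h2.
have B1 t : `|t - x| < d -> ball (x, y) d (t, y + h.2).
  move=> tx; split=> /=; rewrite /ball /= distrC//.
  by rewrite (addrC y) addrK.
have B2 t : `|t - y| < d -> ball (x, y) d (x, t).
  move=> ty; split=> /=; rewrite /ball /= distrC//.
  by rewrite subrr normr0.
have m1 := @mvt_near (fun t => f (t, y + h.2)) (fun t => 'D_e1 f (t, y + h.2)) x a d
  (e%:num / 2) _ _ h.1 h1.
have {}m1 := m1 (fun t tx => let: And4 p _ _ _ := Hd _ (B1 t tx) in is_derive_e1 p)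
   (fun t tx => let: And4 _ _ p _ := Hd _ (B1 t tx) in p).
have m2 := @mvt_near (fun t => f (x, t)) (fun t => 'D_e2 f (x, t)) y b d
  (e%:num / 2) _ _ h.2 h2.
have {}m2 := m2 (fun t tx => let: And4 _ p _ _ := Hd _ (B2 t tx) in is_derive_e2 p)
   (fun t tx => let: And4 _ _ _ p := Hd _ (B2 t tx) in p).
have -> : f (h + (x, y)) - (f (x, y) + (a * h.1 + b * h.2)) =
   (f (x + h.1, y + h.2) - f (x, y + h.2) - a * h.1) +
   (f (x, y + h.2) - f (x, y) - b * h.2).
  by rewrite (_ : h + (x, y) = (x + h.1, y + h.2));
     [ring|congr pair; rewrite /= addrC].
apply: (le_trans (ler_normD _ _)).
have H1 : `|h.1| <= `|h| by rewrite /Num.norm /= le_max lexx.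
have H2 : `|h.2| <= `|h| by rewrite /Num.norm /= le_max lexx orbT.
apply: (le_trans (lerD m1 m2)).
rewrite -mulrDr [e%:num in leRHS]splitr mulrDl mulrDr.
by rewrite lerD// ler_pM2l.
Qed.

(** All iterated partial derivatives are continuous, so [C1_differentiable] applies at each order.
    This brings the given test functions and isometries into the calculus of [Cinf]. *)
Lemma smooth_Cinf (U : set (R * R)) (f : R * R -> R) : open U -> smooth_on U f -> Cinf U f.
Proof.
move=> oU sf n; elim: n f sf => [|n IH] f sf /=.
  by move=> x Ux; have [] := sf [::] x Ux.
have nU x : U x -> \forall w \near x, U w by move=> Ux; exact: open_nbhs_nbhs.
split=> [x Ux|v]; last by apply: IH; exact: smooth_on_derive.
apply: C1_differentiable.
- by apply: filterS (nU _ Ux) => w Uw; have [] := sf [::] w Uw.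
- by apply: filterS (nU _ Ux) => w Uw; have [] := sf [::] w Uw.
- by have [] := sf [:: e1] x Ux.
- by have [] := sf [:: e2] x Ux.
Qed.

Lemma smooth_Cinf1 (U : set R) (f : R -> R) : smooth_on U f -> Cinf U f.
Proof.
move=> sf n; elim: n f sf => [|n IH] f sf /=.
  by move=> x Ux; have [] := sf [::] x Ux.
split=> [x Ux|v]; last by apply: IH; exact: smooth_on_derive.
by apply/derivable1_diffP; have [] := sf [::] x Ux.
Qed.

Section Components.
Context {V : normedModType R}.
Implicit Types (f : V -> R * R) (U : set V).

Lemma derivable_pairP f x v : derivable f x v <->
  derivable (fst \o f) x v /\ derivable (snd \o f) x v.
Proof.
split=> [df|[d1 d2]].
  split; apply/cvg_ex.
    by exists ('D_v f x).1; apply: (cvg_comp _ fst df); exact: cvg_fst.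
  by exists ('D_v f x).2; apply: (cvg_comp _ snd df); exact: cvg_snd.
apply/cvg_ex; exists ('D_v (fst \o f) x, 'D_v (snd \o f) x).
exact: (cvg_pair d1 d2).
Qed.

Lemma derive_pair f x v : derivable f x v ->
  'D_v f x = ('D_v (fst \o f) x, 'D_v (snd \o f) x).
Proof.
move=> /derivable_pairP[d1 d2]; apply: cvg_lim => //.
exact: (cvg_pair d1 d2).
Qed.

Lemma continuous_pairP f x : {for x, continuous f} <->
  {for x, continuous (fst \o f)} /\ {for x, continuous (snd \o f)}.
Proof.
split=> [cf|[c1 c2]].
  by split; [apply: (cvg_comp f fst cf); exact: cvg_fst|
    apply: (cvg_comp f snd cf); exact: cvg_snd].
suff : f y @[y --> x] --> f x by [].
have C : (((fst \o f) y, (snd \o f) y) @[y --> x] --> ((fst \o f) x, (snd \o f) x)).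
  exact: (cvg_pair c1 c2).
have E : (fun y => ((fst \o f) y, (snd \o f) y)) = f.
  by apply/funext => y /=; case: (f y).
by move: C; rewrite E /=; case: (f x).
Qed.

Lemma smooth_on_comp_proj f U : open U -> smooth_on U f ->
  smooth_on U (fst \o f) /\ smooth_on U (snd \o f).
Proof.
move=> oU sf.
have E s : {in U, iter_derive s (fst \o f) =1 fst \o iter_derive s f} /\
           {in U, iter_derive s (snd \o f) =1 snd \o iter_derive s f}.
  elim: s => [//|v s [IH1 IH2]]; split=> x xU /=.
    rewrite (eq_on_derive v oU IH1)// derive_pair//.
    by move: xU; rewrite inE => xU; have [_] := sf s x xU; exact.
  rewrite (eq_on_derive v oU IH2)// derive_pair//.
  by move: xU; rewrite inE => xU; have [_] := sf s x xU; exact.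
have N x (g h : V -> R) : U x -> {in U, g =1 h} -> {near x, g =1 h}.
  by move=> Ux; exact: eq_on_near.
split=> s x Ux; have [/continuous_pairP[c1 c2] df] := sf s x Ux; split.
- apply: near_eq_continuous c1; have := N _ _ _ Ux (E s).1.
  by apply: filterS => y ->.
- move=> v; have [d1 d2] := (derivable_pairP _ _ _).1 (df v).
  apply: near_eq_derivable d1; have := N _ _ _ Ux (E s).1.
  by apply: filterS => y ->.
- apply: near_eq_continuous c2; have := N _ _ _ Ux (E s).2.
  by apply: filterS => y ->.
- move=> v; have [d1 d2] := (derivable_pairP _ _ _).1 (df v).
  apply: near_eq_derivable d2; have := N _ _ _ Ux (E s).2.
  by apply: filterS => y ->.
Qed.

Lemma smooth_on_pair U (f1 f2 : V -> R) : open U -> Cinf U f1 -> Cinf U f2 ->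
  smooth_on U (fun x => (f1 x, f2 x)).
Proof.
move=> oU s1 s2.
have C (f : V -> R) s : Cinf U f -> Cinf U (iter_derive s f).
  by move=> sf; elim: s => //= v s IH; exact: Cinf_derive.
have E s : {in U, iter_derive s (fun x => (f1 x, f2 x)) =1
    fun x => (iter_derive s f1 x, iter_derive s f2 x)}.
  elim: s => [//|v s IH] x xU /=; rewrite (eq_on_derive v oU IH)//.
  move: xU; rewrite inE => xU.
  by rewrite derive_pairE//; apply: Cinf_differentiable xU; exact: C.
move=> s x Ux.
have Es : {near x, (fun y => (iter_derive s f1 y, iter_derive s f2 y)) =1
    iter_derive s (fun y => (f1 y, f2 y))}.
  apply: filterS (open_nbhs_nbhs (conj oU Ux)) => y Uy.
  by rewrite E// inE.
have D1 : differentiable (iter_derive s f1) x.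
  by apply: Cinf_differentiable Ux; exact: C.
have D2 : differentiable (iter_derive s f2) x.
  by apply: Cinf_differentiable Ux; exact: C.
have D : differentiable (iter_derive s (fun y => (f1 y, f2 y))) x.
  exact: (near_eq_differentiable Es (differentiable_pair D1 D2)).
by split=> [|v]; [exact: differentiable_continuous|exact: diff_derivable].
Qed.

End Components.
End SmoothFromPartials.

(** * A smooth step and a smooth positive part *)

Section SmoothStep.
Context {R : realType}.
Implicit Types (x u v k : R).

(** The powers of [1 / x] are included because the derivative of [hexp n] is a combination of
    [hexp n.+1] and [hexp n.+2]: the whole family is shown smooth by one induction. *)
Definition hexp (n : nat) x : R := if 0 < x then x ^- n * expR (- x^-1) else 0.

Lemma hexp_ge0 n x : 0 <= hexp n x.
Proof.
rewrite /hexp; case: ifP => // x0.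
by rewrite mulr_ge0 ?expR_ge0// invr_ge0 exprn_ge0// ltW.
Qed.

(** From [exp (y / m) >= y / m] with [y = 1 / x] and [m = n + 2] one gets
    [exp (- 1 / x) <= (m x)^m]. Two powers of [x] survive the division by [x^n], which makes the
    difference quotient at 0 tend to 0. *)
Lemma hexp_le_sqr n : exists2 C : R, 0 < C & forall x, hexp n x <= C * x ^+ 2.
Proof.
pose m := n.+2; exists (m%:R ^+ m); first by rewrite exprn_gt0.
move=> x; rewrite /hexp; case: ifP => x0; last first.
  by rewrite mulr_ge0 ?sqr_ge0// exprn_ge0.
have m0 : 0 < m%:R :> R by [].
have E : expR (- x^-1) <= (m%:R * x) ^+ m.
  rewrite expRN -[leRHS]invrK lef_pV2 ?posrE ?expR_gt0 ?invr_gt0 ?exprn_gt0 ?mulr_gt0//.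
  rewrite -exprVn invfM.
  have -> : x^-1 = m%:R * (m%:R^-1 / x) by rewrite mulrA mulfV ?mul1r// gt_eqF.
  rewrite expRM_natl; apply: lerXn2r.
  - by rewrite nnegrE mulrA mulfV ?mul1r ?gt_eqF// mulr_ge0 ?invr_ge0 ?ltW.
  - by rewrite nnegrE expR_ge0.
  - rewrite [X in _ * X]mulrA mulfV ?gt_eqF// mul1r.
    by apply: le_trans (expR_ge1Dx _); rewrite lerDr.
apply: (le_trans (ler_wpM2l _ E)).
  by rewrite invr_ge0 exprn_ge0// ltW.
rewrite exprMn mulrCA ler_wpM2l ?exprn_ge0//.
rewrite /m -addn2 exprD mulrA mulVf ?mul1r//.
by rewrite expf_neq0// gt_eqF.
Qed.

Lemma is_derive_hexp n x :
  is_derive x 1 (hexp n) (- n%:R * hexp n.+1 x + hexp n.+2 x).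
Proof.
have [x0|x0|x0] := ltgtP x 0.
- rewrite [in X in is_derive _ _ _ X]/hexp (lt_gtF x0) mulr0 addr0.
  apply: near_eq_is_derive _ (is_derive_cst (0:R) x 1).
  have : \forall y \near x, y < 0 by exact: lt_nbhsl.
  by apply: filterS => y y0; rewrite /hexp /= (lt_gtF y0).
- have xn0 : x != 0 by rewrite gt_eqF.
  have di : is_derive x 1 (@GRing.inv R) (- (x^-1 * x^-1)).
    by rewrite -derive_inv//; apply/derivableP/diff_derivable/differentiable_Rinv.
  have dN : is_derive x 1 (fun y : R => - y^-1) (x^-1 * x^-1).
    by rewrite -[x^-1 * _]opprK; exact: is_deriveN.
  have dE : is_derive x 1 (fun y : R => expR (- y^-1)) (x^-1 * x^-1 * expR (- x^-1)).
    have -> : x^-1 * x^-1 * expR (- x^-1) = expR (- x^-1) * (x^-1 * x^-1) by rewrite mulrC.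
    exact: (@is_derive1_comp _ (@expR R) (fun y : R => - y^-1) x _ _ (is_derive_expR (- x^-1)) dN).
  have dX := is_deriveX n di.
  apply: is_derive_eq (near_eq_is_derive _ (is_deriveM dX dE)) _.
    have : \forall y \near x, 0 < y by exact: lt_nbhsr.
    apply: filterS => y y0; rewrite /hexp y0 -exprVn exprfctE.
    by [].
  rewrite /hexp x0 /GRing.scale /= -!exprVn exprfctE !exprS.
  case: n {dX} => [|n]; first by rewrite !expr0; ring.
  by rewrite /= !exprS; ring.
- rewrite x0 [in X in is_derive _ _ _ X]/hexp ltxx mulr0 addr0.
  have [C C0 HC] := hexp_le_sqr n.
  suff cv : (h^-1 *: ((hexp n \o shift 0) (h *: 1) - hexp n 0)) @[h --> 0^'] --> (0 : R).
    by split; [exact: cvgP cv|exact: cvg_lim cv].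
  apply/cvgrPdist_le => e e0; near=> h.
  have hn0 : h != 0 by near: h; exact: nbhs_dnbhs_neq.
  rewrite sub0r normrN /= [h *: 1]mulr1 addr0 {2}/hexp ltxx subr0.
  rewrite /GRing.scale /= normrM normfV ger0_norm ?hexp_ge0//.
  rewrite ler_pdivrMl ?normr_gt0// (le_trans (HC h))//.
  rewrite -real_normK ?num_real// expr2 mulrA mulrC ler_wpM2l//.
  rewrite -ler_pdivlMl// mulrC.
  near: h; apply: dnbhs0_le; exact: divr_gt0.
Unshelve. all: by end_near. Qed.

Lemma Cinf_hexp n : Cinf [set: R] (hexp n).
Proof.
have dh m x : differentiable (hexp m) x.
  by apply/derivable1_diffP; have [] := is_derive_hexp m x.
move=> k; elim: k n => [|k IH] n /=; first by move=> x _; exact: differentiable_continuous.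
split=> // v.
rewrite (_ : 'D_v (hexp n) = cst v \* ((cst (- n%:R) \* hexp n.+1) \+ hexp n.+2)).
  by apply: CnM openT _ _; [exact: Cn_cst|apply: CnD openT _ _ => //;
    apply: CnM openT _ _ => //; exact: Cn_cst].
apply/funext => x; rewrite deriveR_scale//.
by have [_ ->] := is_derive_hexp n x.
Qed.

Definition smooth_step u : R := hexp 0 (u - 1) / (hexp 0 (u - 1) + hexp 0 (2 - u)).

Lemma hexp_gt0 n x : 0 < x -> 0 < hexp n x.
Proof. by move=> x0; rewrite /hexp x0 mulr_gt0 ?expR_gt0// invr_gt0 exprn_gt0. Qed.

Lemma hexp_eq0 n x : x <= 0 -> hexp n x = 0.
Proof. by rewrite /hexp leNgt => /negPf ->. Qed.

Lemma smooth_step_denom u : 0 < hexp 0 (u - 1) + hexp 0 (2 - u).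
Proof.
have [u1|u1] := ltP 1 u.
  by rewrite ltr_pwDl ?hexp_ge0// hexp_gt0// subr_gt0.
by rewrite ltr_wpDl ?hexp_ge0// hexp_gt0// subr_gt0 (le_lt_trans u1)// ltr1n.
Qed.

Lemma smooth_step_eq0 u : u <= 1 -> smooth_step u = 0.
Proof. by move=> u1; rewrite /smooth_step hexp_eq0 ?mul0r// subr_le0. Qed.

Lemma smooth_step_eq1 u : 2 <= u -> smooth_step u = 1.
Proof.
move=> u2; rewrite /smooth_step (@hexp_eq0 _ (2 - u)) ?subr_le0// addr0 mulfV//.
by rewrite gt_eqF// hexp_gt0// subr_gt0 (lt_le_trans _ u2)// ltr1n.
Qed.

Lemma smooth_step_ge0 u : 0 <= smooth_step u.
Proof. by rewrite /smooth_step mulr_ge0 ?hexp_ge0// invr_ge0 ltW ?smooth_step_denom. Qed.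

Lemma smooth_step_le1 u : smooth_step u <= 1.
Proof.
by rewrite /smooth_step ler_pdivrMr ?smooth_step_denom// mul1r lerDl hexp_ge0.
Qed.

Lemma Cinf_affine (a b : R) : Cinf [set: R] (fun x => a * x + b).
Proof.
apply: (@CinfD _ _ _ (fun x => a * x) (cst b)) => //; first exact: openT.
  by apply: CinfZ; [exact: openT|exact: Cinf_id].
exact: Cinf_cst.
Qed.

Lemma Cinf_smooth_step : Cinf [set: R] smooth_step.
Proof.
have h1 : Cinf [set: R] (fun u => hexp 0 (u - 1)).
  apply: (@Cinf_comp1 _ _ _ setT (fun u => u - 1)) => //; first exact: openT.
    rewrite (_ : (fun u => _) = (fun x => 1 * x + (-1))); first exact: Cinf_affine.
    by apply/funext => x; rewrite mul1r.
  exact: Cinf_hexp.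
have h2 : Cinf [set: R] (fun u => hexp 0 (2 - u)).
  apply: (@Cinf_comp1 _ _ _ setT (fun u => 2 - u)) => //; first exact: openT.
    rewrite (_ : (fun u => _) = (fun x => (-1) * x + 2)); first exact: Cinf_affine.
    by apply/funext => x; rewrite mulN1r addrC.
  exact: Cinf_hexp.
apply: (@CinfM _ _ _ (fun u => hexp 0 (u - 1))) => //; first exact: openT.
apply: (@Cinf_comp1 _ _ _ [set x | x != 0] (fun u => hexp 0 (u - 1) + hexp 0 (2 - u))).
- exact: openT.
- by move=> u _ /=; rewrite gt_eqF ?smooth_step_denom.
- by apply: CinfD => //; exact: openT.
- exact: Cinf_inv.
Qed.

(* [ramp] is a smooth version of the positive part; [k^-1 * ramp (k * v)] tends to it. *)
Definition ramp u : R := u * smooth_step u.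

Lemma Cinf_ramp : Cinf [set: R] ramp.
Proof. by apply: CinfM; [exact: openT|exact: Cinf_id|exact: Cinf_smooth_step]. Qed.

Lemma ramp_eq0 u : u <= 1 -> ramp u = 0.
Proof. by move=> u1; rewrite /ramp smooth_step_eq0// mulr0. Qed.

Lemma ramp_id u : 2 <= u -> ramp u = u.
Proof. by move=> u1; rewrite /ramp smooth_step_eq1// mulr1. Qed.

Lemma ramp_ge0 u : 0 <= ramp u.
Proof.
have [u1|u1] := leP u 1; first by rewrite ramp_eq0.
by rewrite mulr_ge0 ?smooth_step_ge0// ltW// (lt_trans _ u1).
Qed.

Lemma ramp_le u : 0 <= u -> ramp u <= u.
Proof. by move=> u0; rewrite /ramp ler_piMr// smooth_step_le1. Qed.

Lemma dramp_eq0 u : u < 1 -> 'D_1 ramp u = 0.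
Proof.
move=> u1; rewrite (@near_eq_derive _ _ _ _ (cst 0)) ?derive_cst//.
have : \forall y \near u, y < 1 by exact: lt_nbhsl.
by apply: filterS => y y1; rewrite ramp_eq0// ltW.
Qed.

Lemma dramp_eq1 u : 2 < u -> 'D_1 ramp u = 1.
Proof.
move=> u1; rewrite (@near_eq_derive _ _ _ _ id) ?derive_id//.
have : \forall y \near u, 2 < y by exact: lt_nbhsr.
by apply: filterS => y y1; rewrite ramp_id// ltW.
Qed.

Lemma dramp_bounded : exists2 C : R, 0 < C & forall u, `|'D_1 ramp u| <= C.
Proof.
have cd u : {for u, continuous (fun x => `|'D_1 ramp x|)}.
  have D : Cinf [set: R] ('D_1 ramp) by exact: (Cinf_derive (1 : R) Cinf_ramp).
  have c : {for u, continuous ('D_1 ramp)} by exact: (Cinf_continuous D).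
  exact: (continuous_comp c (@norm_continuous _ _ _)).
have [||c _ Hc] := @EVT_max _ (fun x => `|'D_1 ramp x|) 1 2.
- by rewrite ler1n.
- by apply: continuous_subspaceT => x; exact: cd.
exists (`|'D_1 ramp c| + 1); first by rewrite ltr_wpDl.
move=> u; have [u1|u1] := ltP u 1.
  by rewrite dramp_eq0// normr0 addr_ge0.
have [u2|u2] := ltP 2 u; first by rewrite dramp_eq1// normr1 lerDr.
by rewrite (le_trans (Hc u _)) ?lerDl// in_itv /= u1 u2.
Qed.

Definition rampk k v : R := k^-1 * ramp (k * v).

Lemma Cinf_rampk k : Cinf [set: R] (rampk k).
Proof.
apply: CinfZ; first exact: openT.
apply: (@Cinf_comp1 _ _ _ setT (fun v => k * v)) => //; first exact: openT.
  by apply: CinfZ; [exact: openT|exact: Cinf_id].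
exact: Cinf_ramp.
Qed.

(** The two scalings cancel in the slope, so the derivatives of [rampk k] are bounded uniformly in
    [k], as dominated convergence will require. *)
Lemma derive_rampk k v : k != 0 -> 'D_1 (rampk k) v = 'D_1 ramp (k * v).
Proof.
move=> k0; have dr u : differentiable ramp u by exact: Cinf_differentiable Cinf_ramp _.
have dk : is_derive v 1 (fun v => k * v) k.
  have h : is_derive v 1 (k \*: (id : R -> R)) (k *: 1) by exact: is_deriveZ.
  apply: (is_derive_eq h).
  by rewrite /GRing.scale /= mulr1.
have dc : is_derive v 1 (ramp \o (fun v => k * v)) ('D_1 ramp (k * v) * k).
  apply: is_derive1_comp; apply/derivableP/diff_derivable; exact: dr.
have dz := is_deriveZ k^-1 dc.
rewrite (_ : rampk k = k^-1 \*: (ramp \o (fun v => k * v)))//.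
have [_ ->] := dz.
by rewrite /GRing.scale /= mulrCA mulVf// mulr1.
Qed.

Lemma rampk_eq0 k v : k * v <= 1 -> rampk k v = 0.
Proof. by move=> h; rewrite /rampk ramp_eq0// mulr0. Qed.

Lemma rampk_id k v : k != 0 -> 2 <= k * v -> rampk k v = v.
Proof. by move=> k0 h; rewrite /rampk ramp_id// mulKf. Qed.

Lemma rampk_ge0 k v : 0 < k -> 0 <= rampk k v.
Proof. by move=> k0; rewrite mulr_ge0 ?ramp_ge0// invr_ge0 ltW. Qed.

Lemma rampk_le k v : 0 < k -> 0 <= v -> rampk k v <= v.
Proof.
move=> k0 v0; rewrite /rampk -ler_pdivlMl ?invr_gt0// invrK ramp_le//.
by rewrite mulr_ge0// ltW.
Qed.

End SmoothStep.

(** * Borel structure and Lebesgue measure of the plane *)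

Section PlaneMeasure.
Context {R : realType}.
Local Notation plane := (measurableTypeR R * measurableTypeR R)%type.
Local Notation mu := (@plane_measure R).

Lemma ball_squareE (c : R * R) (r : R) :
  ball c r = (`]c.1 - r, c.1 + r[ `*` `]c.2 - r, c.2 + r[)%classic.
Proof.
by apply/seteqP; split=> x [h1 h2]; split; move: h1 h2;
  rewrite /ball /= !in_itv /= !ltr_distlC.
Qed.

Lemma measurable_ball (c : R * R) (r : R) : measurable (ball c r : set plane).
Proof. by rewrite ball_squareE; apply: measurableX; exact: measurable_itv. Qed.

Definition rat_ball (q : rat * rat * rat) : set (R * R) :=
  ball (ratr q.1.1 : R, ratr q.1.2 : R) (ratr q.2).

Lemma rat_ball_nbhs (x : R * R) (e : R) : 0 < e -> exists q : rat * rat * rat,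
  [/\ rat_ball q x, 0 < ratr q.2 :> R &
   ball (ratr q.1.1 : R, ratr q.1.2 : R) (ratr q.2 *+ 2) `<=` ball x e].
Proof.
move=> e0.
(* A third of [e], because the point is within [r] of the rational centre and the doubled ball adds
   [2 r]. *)
have [r] := @rat_in_itvoo R 0 (e / 3) (divr_gt0 e0 (ltr0n _ 3)).
rewrite in_itv /= => /andP[r0 re].
have nb (a : R) : exists q : rat, ball (ratr q : R) (ratr r : R) a.
  have [|q] := @rat_in_itvoo R (a - ratr r) (a + ratr r).
    by rewrite ltrBlDr -addrA ltrDl addr_gt0.
  rewrite in_itv /= => q1; exists q; apply: ball_sym.
  by rewrite /ball /= ltr_distlC.
have [q1 h1] := nb x.1; have [q2 h2] := nb x.2.
exists (q1, q2, r); split=> // y [/= y1 y2].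
have rr : ratr r + ratr r *+ 2 < e.
  by rewrite -mulrS -mulr_natr -ltr_pdivlMr.
by split; apply: (le_ball (ltW rr)); [apply: ball_triangle (ball_sym h1) y1|
   apply: ball_triangle (ball_sym h2) y2].
Qed.

(** Requiring the doubled ball to lie in [U] leaves around each square the margin that
    [ae_eq0_square] uses. *)
Lemma open_rat_ballsE (U : set (R * R)) : open U ->
  U = \bigcup_(q in [set q | 0 < ratr q.2 :> R /\
        ball (ratr q.1.1 : R, ratr q.1.2 : R) (ratr q.2 *+ 2) `<=` U]) rat_ball q.
Proof.
move=> oU; apply/seteqP; split=> [x Ux|x [q [q0 qU] qx]].
  have /nbhs_ballP[e /= e0 eU] := open_nbhs_nbhs (conj oU Ux).
  have [q [qx q0 qe]] := rat_ball_nbhs x e0.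
  by exists q => //; split=> //; exact: subset_trans qe eU.
by apply: qU; apply: (le_ball _ qx); rewrite mulr2n lerDl ltW.
Qed.

Lemma open_measurable_plane (U : set (R * R)) : open U -> measurable (U : set plane).
Proof.
move=> /open_rat_ballsE ->; rewrite bigcup_mkcond.
apply: countable_bigcupT_measurable => // q.
by case: ifP => _ //; exact: measurable_ball.
Qed.

Lemma continuous_measurable_plane (U : set (R * R)) (f : R * R -> R) : open U ->
  (forall x, U x -> {for x, continuous f}) -> measurable_fun (U : set plane) f.
Proof.
move=> oU cf; apply: (measurability _ (RGenOpens.measurableE R)).
move=> _ [_ [a [b ->] <-]]; apply: open_measurable_plane.
rewrite openE => x [Ux fx]; apply: filterI; first exact: open_nbhs_nbhs.
by apply: (cf x Ux); apply: open_nbhs_nbhs; split=> //; exact: interval_open.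
Qed.

Lemma disk_sqr (z : R * R) : disk z <-> z.1 ^+ 2 + z.2 ^+ 2 < 1.
Proof. by rewrite /disk /= /cmod -{1}[X in _ < X]sqrtr1 ltr_sqrt. Qed.

Lemma open_disk : open (@disk R).
Proof.
rewrite (_ : disk = [set z : R * R | z.1 ^+ 2 + z.2 ^+ 2 < 1]).
  apply: (@open_comp _ _ (fun z : R * R => z.1 ^+ 2 + z.2 ^+ 2) [set x | x < 1]).
    move=> z _; apply: cvgD; apply: cvgM; by [exact: cvg_fst|exact: cvg_snd].
  exact: open_lt.
by apply/seteqP; split=> z /disk_sqr.
Qed.

Lemma disk_sub_square : (@disk R) `<=` (`[-1, 1] `*` `[-1, 1])%classic.
Proof.
move=> z /disk_sqr h; split; rewrite /= in_itv /= -ler_norml.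
  rewrite -(@expr_le1 _ 2)// real_normK ?num_real//.
  by rewrite (le_trans _ (ltW h))// lerDl sqr_ge0.
rewrite -(@expr_le1 _ 2)// real_normK ?num_real//.
by rewrite (le_trans _ (ltW h))// lerDr sqr_ge0.
Qed.

Lemma measurable_disk : measurable (disk : set plane).
Proof. exact: open_measurable_plane open_disk. Qed.

Lemma mu_rect (a b c d : R) : a <= b -> c <= d ->
  mu (`[a, b] `*` `[c, d])%classic = ((b - a) * (d - c))%:E.
Proof.
have itvE (x y : R) : x <= y -> lebesgue_measure `[x, y]%classic = (y - x)%:E.
  move=> xy; rewrite lebesgue_measure_itv /= lte_fin.
  by case: ltgtP xy => // ->; rewrite subrr.
move=> ab cd; rewrite /plane_measure product_measure1E//.
by rewrite EFinM; congr (_ * _)%E; exact: itvE.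
Qed.

Lemma measurable_rect (a b c d : R) : measurable (`[a, b] `*` `[c, d] : set plane)%classic.
Proof. by apply: measurableX; exact: measurable_itv. Qed.

Lemma mu_disk_lty : (mu disk < +oo)%E.
Proof.
apply: (@le_lt_trans _ _ (mu (`[(-1)%R, 1%R] `*` `[(-1)%R, 1%R])%classic)).
  rewrite /plane_measure; apply: le_measure; rewrite ?inE.
  - exact: measurable_disk.
  - exact: measurable_rect.
  - exact: disk_sub_square.
by rewrite mu_rect// ?ltry// lerN10.
Qed.

End PlaneMeasure.

(** * Dominated convergence for real-valued integrals *)

Section BoundedIntegrals.
Context d (T : measurableType d) (R : realType) (mu : {measure set T -> \bar R}).
Variables (D : set T) (mD : measurable D).

Lemma Rintegral_dominated_cvg (f_ : nat -> T -> R) (f g : T -> R) :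
  (forall n, measurable_fun D (f_ n)) ->
  (forall x, D x -> f_ n x @[n --> \oo] --> f x) ->
  mu.-integrable D (EFin \o g) -> (forall n x, D x -> `|f_ n x| <= g x) ->
  mu.-integrable D (EFin \o f) /\
  \int[mu]_(x in D) f_ n x @[n --> \oo] --> \int[mu]_(x in D) f x.
Proof.
move=> mf cf ig fg.
have mf' : measurable_fun D f by exact: measurable_fun_cvg cf.
have [] := @dominated_convergence _ _ _ mu D mD (fun n => EFin \o f_ n) (EFin \o f) (EFin \o g).
- by move=> n; exact/measurable_EFinP.
- exact/measurable_EFinP.
- by apply: aeW => x Dx; apply: cvg_EFin; [exact: nearW|exact: cf].
- by [].
- by apply: aeW => x n Dx; rewrite /= lee_fin fg.
move=> ifl _ cv; split=> //.
apply: fine_cvg; rewrite fineK//; exact: integrable_fin_num.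
Qed.

Hypothesis muD : (mu D < +oo)%E.

Lemma bounded_integrable (f : T -> R) (C : R) : measurable_fun D f ->
  (forall x, D x -> `|f x| <= C) -> mu.-integrable D (EFin \o f).
Proof.
move=> mf fC; apply: measurable_bounded_integrable => //.
by exists C; split; rewrite ?num_real// => y Cy x /= Dx; exact: le_trans (fC x Dx) (ltW Cy).
Qed.

Lemma Rintegral_bounded_cvg (f_ : nat -> T -> R) (f : T -> R) (C : R) :
  (forall n, measurable_fun D (f_ n)) ->
  (forall x, D x -> f_ n x @[n --> \oo] --> f x) ->
  (forall n x, D x -> `|f_ n x| <= C) ->
  \int[mu]_(x in D) f_ n x @[n --> \oo] --> \int[mu]_(x in D) f x.
Proof.
move=> mf cf fC; have := @Rintegral_dominated_cvg f_ f (cst C) mf cf.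
move=> /(_ _ fC) []//.
apply: (@bounded_integrable _ `|C|) => // x _; exact: lexx.
Qed.

End BoundedIntegrals.

(** * The fundamental theorem of calculus on rectangles *)

Section RectangleFTC.
Context {R : realType}.
Local Notation plane := (measurableTypeR R * measurableTypeR R)%type.
Local Notation mu := (@plane_measure R).
Local Notation leb := (@lebesgue_measure R).

Lemma FTC_everywhere (F f : R -> R) (a b : R) : a < b ->
  (forall x, a <= x <= b -> is_derive x 1 F (f x)) ->
  (forall x, a <= x <= b -> {for x, continuous f}) ->
  (\int[leb]_(x in `[a, b]) (f x)%:E = (F b - F a)%:E)%E.
Proof.
move=> ab dF cf.
have cF x : a <= x <= b -> {for x, continuous F}.
  by move=> /dF dFx; apply/differentiable_continuous/derivable1_diffP; have [] := dFx.
rewrite (@continuous_FTC2 _ f F)//.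
- apply: continuous_in_subspaceT => x; rewrite inE /= in_itv /=; exact: cf.
- split.
  + move=> x; rewrite in_itv /= => /andP[x1 x2].
    by have [] := dF x _ => //; rewrite !ltW.
  + by apply: cvg_at_right_filter; apply: cF; rewrite lexx ltW.
  + by apply: cvg_at_left_filter; apply: cF; rewrite lexx ltW.
- move=> x; rewrite in_itv /= => /andP[x1 x2]; rewrite derive1E.
  by have [] := dF x _ => //; rewrite !ltW.
Qed.

Lemma compact_rect (a b c d : R) : compact (`[a, b] `*` `[c, d])%classic.
Proof. by apply: compact_setX; exact: segment_compact. Qed.

Lemma continuous_compact_bounded {T : topologicalType} (K : set T) (f : T -> R) :
  compact K -> (forall x, K x -> {for x, continuous f}) ->
  exists2 C : R, 0 <= C & forall x, K x -> `|f x| <= C.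
Proof.
move=> cK cf; have [->|/set0P K0] := eqVneq K set0; first by exists 0.
have [|c _ Hc] := @compact_EVT_max _ _ (fun x => `|f x|) K K0 cK.
  apply: continuous_in_subspaceT => x; rewrite inE => Kx.
  exact: (continuous_comp (cf x Kx) (@norm_continuous _ _ _)).
by exists `|f c| => // x Kx; apply: Hc; rewrite inE.
Qed.

Section Rect.
Variables (F : R * R -> R) (a b c d : R).
Hypotheses (ab : a < b) (cd : c < d) (sF : Cinf [set: R * R] F).
Let Q := (`[a, b] `*` `[c, d])%classic : set plane.

Let dF (v z : R * R) : derivable F z v.
Proof. by apply/diff_derivable; exact: Cinf_differentiable sF _. Qed.

Let cD (v z : R * R) : {for z, continuous ('D_v F)}.
Proof. exact: (Cinf_continuous (x := z) (Cinf_derive v sF) I). Qed.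

(** Fubini is applied over the whole plane, so the integrand is extended by zero off the
    rectangle. *)
Let restrict_integrable (v : R * R) :
  mu.-integrable [set: plane] (EFin \o ('D_v F) \_ Q).
Proof.
have mQ : measurable Q by exact: measurable_rect.
have [C C0 HC] := continuous_compact_bounded (@compact_rect a b c d) (fun z _ => @cD v z).
rewrite -restrict_EFin; apply/(integrable_mkcond _ mQ).
apply: (@bounded_integrable _ _ _ _ Q mQ _ _ C) => //.
  by rewrite [X in (X < _)%E](mu_rect (ltW ab) (ltW cd)) ltry.
apply: measurable_funTS.
exact: (continuous_measurable_plane openT (fun z _ => @cD v z)).
Qed.

Lemma integral_rect_derive_e1 :
  (\int[mu]_(z in Q) ('D_e1 F z)%:E = \int[leb]_(y in `[c, d]) (F (b, y) - F (a, y))%:E)%E.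
Proof.
rewrite integral_mkcond restrict_EFin [LHS](esym (integral21_prod_meas1 (restrict_integrable e1))).
rewrite [RHS]integral_mkcond; apply: eq_integral => y _.
rewrite /fubini_G !patchE; case: ifPn => [|yN].
  rewrite inE => yI.
  have <- : (\int[leb]_(x in `[a, b]) ('D_e1 F (x, y))%:E = (F (b, y) - F (a, y))%:E)%E.
    apply: (@FTC_everywhere (fun x => F (x, y)) (fun x => 'D_e1 F (x, y)) a b ab).
  - by move=> x _; exact: is_derive_e1.
  - move=> x _; apply: (@continuous_comp _ _ _ (fun x => (x, y)) ('D_e1 F)).
      exact: (cvg_pair cvg_id (cvg_cst y)).
    exact: cD.
  rewrite [RHS]integral_mkcond; apply: eq_integral => x _ /=.
    rewrite !patchE; case: ifPn; case: ifPn => //.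
      by move=> /negP xI; rewrite inE => -[/=]; rewrite inE in xI.
    by rewrite inE => xI /negP; rewrite inE => -[].
apply: integral0_eq => x _ /=; rewrite patchE; case: ifPn => //.
by rewrite inE => -[_ /= yI]; move/negP: yN; rewrite inE.
Qed.

Lemma integral_rect_derive_e2 :
  (\int[mu]_(z in Q) ('D_e2 F z)%:E = \int[leb]_(x in `[a, b]) (F (x, d) - F (x, c))%:E)%E.
Proof.
rewrite integral_mkcond restrict_EFin [LHS](esym (integral12_prod_meas1 (restrict_integrable e2))).
rewrite [RHS]integral_mkcond; apply: eq_integral => x _.
rewrite /fubini_F !patchE; case: ifPn => [|xN].
  rewrite inE => xI.
  have <- : (\int[leb]_(y in `[c, d]) ('D_e2 F (x, y))%:E = (F (x, d) - F (x, c))%:E)%E.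
    apply: (@FTC_everywhere (fun y => F (x, y)) (fun y => 'D_e2 F (x, y)) c d cd).
  - by move=> y _; exact: is_derive_e2.
  - move=> y _; apply: (@continuous_comp _ _ _ (fun y => (x, y)) ('D_e2 F)).
      exact: (cvg_pair (cvg_cst x) cvg_id).
    exact: cD.
  rewrite [RHS]integral_mkcond; apply: eq_integral => y _ /=.
    rewrite !patchE; case: ifPn; case: ifPn => //.
      by move=> /negP yI; rewrite inE => -[/=]; rewrite inE in yI.
    by rewrite inE => yI /negP; rewrite inE => -[].
apply: integral0_eq => y _ /=; rewrite patchE; case: ifPn => //.
by rewrite inE => -[/= xI _]; move/negP: xN; rewrite inE.
Qed.

End Rect.
End RectangleFTC.

(** * Test functions and integration by parts on the disk *)

Section TestFunctions.
Context {R : realType}.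
Local Notation plane := (measurableTypeR R * measurableTypeR R)%type.
Local Notation mu := (@plane_measure R).
Implicit Types (u phi psi : R * R -> R) (K : set (R * R)).

Lemma Cinf_setU {V : normedModType R} (A B : set V) (f : V -> R) :
  Cinf A f -> Cinf B f -> Cinf (A `|` B) f.
Proof.
move=> fA fB n; elim: n f fA fB => [|n IH] f fA fB /=.
  by move=> x [Ax|Bx]; [exact: Cinf_continuous fA Ax|exact: Cinf_continuous fB Bx].
split=> [x [Ax|Bx]|v].
- exact: Cinf_differentiable fA Ax.
- exact: Cinf_differentiable fB Bx.
- by apply: IH; exact: Cinf_derive.
Qed.

Lemma compact_plane_closed K : compact K -> closed K.
Proof. by apply: compact_closed; exact: norm_hausdorff. Qed.

(** The disk and the complement of [K] are open and cover the plane, and [u] is zero on the latter.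
    Smoothness therefore has to be checked inside the disk only. *)
Lemma Cinf_test u K : compact K -> K `<=` disk -> Cinf disk u ->
  (forall z, ~ K z -> u z = 0) -> test_function u.
Proof.
move=> cK KD su u0; split; last by exists K.
apply: Cinf_smooth; have oK : open (~` K) by apply: closed_openC; exact: compact_plane_closed.
have -> : [set: R * R] = disk `|` ~` K.
  apply/seteqP; split=> z // _; have [Kz|] := pselect (K z); [left; exact: KD|by right].
apply: Cinf_setU => //; apply: (Cinf_ext (f := cst 0)) => //; last exact: Cinf_cst.
by move=> z; rewrite inE => /u0 ->.
Qed.

Lemma test_Cinf phi : test_function phi -> Cinf [set: R * R] phi.
Proof. by case=> sphi _; apply: smooth_Cinf => //; exact: openT. Qed.

Lemma test_derivable phi (v z : R * R) : test_function phi -> derivable phi z v.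
Proof. by move=> /test_Cinf h; apply/diff_derivable; exact: Cinf_differentiable h _. Qed.

Lemma test_continuous phi : test_function phi -> continuous phi.
Proof. by move=> /test_Cinf h z; exact: Cinf_continuous h _. Qed.

Lemma test_derive phi (v : R * R) : test_function phi -> test_function ('D_v phi).
Proof.
move=> tphi; have sphi := test_Cinf tphi; case: tphi => _ [K [cK KD K0]].
apply: (Cinf_test cK KD); first by apply: CinfS (Cinf_derive v sphi).
move=> z Kz; rewrite (@near_eq_derive _ _ _ _ (cst 0)) ?derive_cst//.
have oK : open (~` K) by apply: closed_openC; exact: compact_plane_closed.
by apply: filterS (open_nbhs_nbhs (conj oK Kz)) => w /K0.
Qed.

Lemma test_mul u phi : Cinf disk u -> test_function phi ->
  test_function (fun z => u z * phi z).
Proof.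
move=> su tphi; have sphi := test_Cinf tphi; case: tphi => _ [K [cK KD K0]].
apply: (Cinf_test cK KD); last by move=> z /K0 ->; rewrite mulr0.
by apply: CinfM => //; [exact: open_disk|exact: CinfS sphi].
Qed.

Lemma test_add phi psi : test_function phi -> test_function psi ->
  test_function (fun z => phi z + psi z).
Proof.
move=> t1 t2; have s1 := test_Cinf t1; have s2 := test_Cinf t2.
case: t1 t2 => _ [K [cK KD K0]] [_ [L [cL LD L0]]].
apply: (@Cinf_test _ (K `|` L)).
- exact: compactU.
- by move=> z [/KD|/LD].
- by apply: CinfD; [exact: open_disk|exact: CinfS s1|exact: CinfS s2].
- by move=> z KL; rewrite K0 ?L0 ?addr0// => h; apply: KL; [right|left].
Qed.

Lemma test_scale (k : R) phi : test_function phi -> test_function (fun z => k * phi z).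
Proof. by apply: test_mul; exact: Cinf_cst. Qed.

Lemma test_bounded phi : test_function phi ->
  exists2 C : R, 0 <= C & forall z, `|phi z| <= C.
Proof.
move=> tphi; have c := test_continuous tphi; case: tphi => _ [K [cK KD K0]].
have [C C0 HC] := continuous_compact_bounded cK (fun z _ => c z).
exists C => // z; have [/HC//|/K0 ->] := pselect (K z).
by rewrite normr0.
Qed.

Lemma Cinf_measurable u : Cinf disk u -> measurable_fun (disk : set plane) u.
Proof.
move=> su; apply: continuous_measurable_plane; first exact: open_disk.
by move=> z Dz; exact: Cinf_continuous su Dz.
Qed.

Lemma test_measurable phi : test_function phi -> measurable_fun (disk : set plane) phi.
Proof. by move=> /test_Cinf sphi; apply: Cinf_measurable; exact: CinfS sphi. Qed.

Lemma test_integrable phi : test_function phi -> mu.-integrable disk (EFin \o phi).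
Proof.
move=> tphi; have [C _ HC] := test_bounded tphi.
apply: (bounded_integrable measurable_disk mu_disk_lty (test_measurable tphi)) => z _.
exact: HC.
Qed.

Lemma integral_disk_square phi : test_function phi ->
  (\int[mu]_(z in disk) (phi z)%:E = \int[mu]_(z in `[(-1)%R, 1%R] `*` `[(-1)%R, 1%R]) (phi z)%:E)%E.
Proof.
move=> [_ [K [_ KD K0]]]; rewrite integral_mkcond [RHS]integral_mkcond.
apply: eq_integral => z _; rewrite !patchE.
have [Kz|Kz] := pselect (K z); last by rewrite K0//; do 2?case: ifP.
by rewrite !mem_set//; [exact/disk_sub_square/KD|exact: KD].
Qed.

Lemma edge_notin_disk (x y : R) : (x ^+ 2 = 1) \/ (y ^+ 2 = 1) -> ~ disk (x, y).
Proof.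
move=> h /disk_sqr /= lt1; move: lt1; rewrite ltNge => /negP; apply.
by case: h => ->; rewrite ?lerDl ?lerDr sqr_ge0.
Qed.

(** The integral is moved to the square of side 2 around the disk. Its edges miss the open disk, so
    the boundary values left by Fubini vanish. *)
Lemma integral_test_derive_e1 phi : test_function phi ->
  \int[mu]_(z in disk) 'D_e1 phi z = 0.
Proof.
move=> tphi; have [_ [K [_ KD K0]]] := tphi.
rewrite /Rintegral integral_disk_square; last exact: test_derive.
rewrite integral_rect_derive_e1; last 3 first.
- by lra.
- by lra.
- exact: test_Cinf.
rewrite integral0_eq// => y _.
by rewrite !K0 ?subrr// => /KD; apply: edge_notin_disk; left; rewrite ?sqrrN expr1n.
Qed.

Lemma integral_test_derive_e2 phi : test_function phi ->
  \int[mu]_(z in disk) 'D_e2 phi z = 0.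
Proof.
move=> tphi; have [_ [K [_ KD K0]]] := tphi.
rewrite /Rintegral integral_disk_square; last exact: test_derive.
rewrite integral_rect_derive_e2; last 3 first.
- by lra.
- by lra.
- exact: test_Cinf.
rewrite integral0_eq// => y _.
by rewrite !K0 ?subrr// => /KD; apply: edge_notin_disk; right; rewrite ?sqrrN expr1n.
Qed.

(** The product [u * phi] is a test function even when [u] is smooth only inside the disk. The
    vanishing integral is a hypothesis so that both axes share the argument. *)
Lemma integral_test_by_parts u phi (e : R * R) :
  (forall psi, test_function psi -> \int[mu]_(z in disk) 'D_e psi z = 0) ->
  Cinf disk u -> test_function phi ->
  \int[mu]_(z in disk) (u z * 'D_e phi z) = - \int[mu]_(z in disk) ('D_e u z * phi z).
Proof.
move=> int0 su tphi.
have t1 : test_function (fun z => u z * 'D_e phi z).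
  by apply: test_mul => //; exact: test_derive.
have t2 : test_function (fun z => 'D_e u z * phi z).
  by apply: test_mul => //; exact: Cinf_derive.
apply/eqP; rewrite -subr_eq0 opprK -RintegralD//; last 3 first.
- exact: measurable_disk.
- exact: test_integrable.
- exact: test_integrable.
rewrite -(int0 _ (test_mul su tphi)); apply/eqP; apply: eq_Rintegral => z.
rewrite inE => Dz; rewrite [RHS]deriveM.
- by rewrite /GRing.scale /= [phi z * _]mulrC.
- by apply/diff_derivable; exact: Cinf_differentiable su Dz.
- exact: test_derivable.
Qed.

End TestFunctions.

#[global] Instance plane_ae_filter (R : realType) :
  Filter (nbhs (almost_everywhere (@plane_measure R))).
Proof. by rewrite /plane_measure; exact: ae_filter_ringOfSetsType. Qed.

(** * Smooth approximations of indicators of rectangles *)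

Section RectangleBumps.
Context {R : realType}.
Local Notation plane := (measurableTypeR R * measurableTypeR R)%type.
Local Notation mu := (@plane_measure R).

Definition bump (k a b x : R) : R :=
  smooth_step (k * (x - a)) * (1 - smooth_step (k * (x - b))).

Lemma Cinf_bump (k a b : R) : Cinf [set: R] (bump k a b).
Proof.
have S c : Cinf [set: R] (fun x => smooth_step (k * (x - c))).
  apply: (@Cinf_comp1 _ _ _ setT (fun x => k * (x - c))) => //; first exact: openT.
    rewrite (_ : (fun x => _) = (fun x => k * x + (- (k * c)))); first exact: Cinf_affine.
    by apply/funext => x; rewrite mulrBr.
  exact: Cinf_smooth_step.
apply: CinfM; [exact: openT|exact: S|].
by apply: (@CinfB _ _ _ (cst 1)); [exact: openT|exact: Cinf_cst|exact: S].
Qed.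

Lemma bump_ge0 (k a b x : R) : 0 <= bump k a b x.
Proof. by rewrite mulr_ge0 ?smooth_step_ge0// subr_ge0 smooth_step_le1. Qed.

Lemma bump_le1 (k a b x : R) : bump k a b x <= 1.
Proof.
rewrite -[leRHS]mulr1 ler_pM ?smooth_step_ge0 ?smooth_step_le1//.
  by rewrite subr_ge0 smooth_step_le1.
by rewrite gerBl smooth_step_ge0.
Qed.

Lemma bump_eq0l (k a b x : R) : 0 < k -> x <= a -> bump k a b x = 0.
Proof.
move=> k0 xa; rewrite /bump smooth_step_eq0 ?mul0r//.
by rewrite (@le_trans _ _ 0)// pmulr_rle0// subr_le0.
Qed.

Lemma bump_eq0r (k a b r x : R) : 2 <= k * r -> 0 < k -> b + r <= x -> bump k a b x = 0.
Proof.
move=> kr k0 xb; rewrite /bump (@smooth_step_eq1 _ (k * (x - b))) ?subrr ?mulr0//.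
by rewrite (le_trans kr)// ler_pM2l// lerBrDl.
Qed.

(** [smooth_step (k * v)] tends to 1 for [v > 0] and to 0 for [v <= 0], the point [v = 0] included;
    hence a half-open interval. The shift [N] lets the sequence start at a scale that is already
    large enough. *)
Lemma bump_cvg (a b x : R) (N : nat) :
  bump (n + N).+1%:R a b x @[n --> \oo] --> (\1_(`]a, b]%classic) x : R).
Proof.
have S (v : R) : smooth_step ((n + N).+1%:R * v) @[n --> \oo] --> ((0 < v)%R%:R : R).
  have [v0|v0] := ltP 0 v; last first.
    apply: cvg_near_cst; apply: nearW => n; apply: smooth_step_eq0.
    by rewrite (@le_trans _ _ 0)// pmulr_rle0.
  apply: cvg_near_cst; near=> n; apply: smooth_step_eq1.
  rewrite -ler_pdivrMr// (@le_trans _ _ n%:R) ?ler_nat ?leqW ?leq_addr//.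
  by near: n; exact: nbhs_infty_ger.
rewrite (_ : \1__ _ = (0 < x - a)%R%:R * (1 - (0 < x - b)%R%:R)).
  by apply: cvgM; [exact: S|apply: cvgB; [exact: cvg_cst|exact: S]].
rewrite indicE !subr_gt0.
have [xb|bx] := leP x b.
  rewrite subr0 mulr1; congr (_%:R); congr nat_of_bool.
  apply/idP/idP; first by rewrite inE /= in_itv /= => /andP[].
  by move=> ax; rewrite inE /= in_itv /= ax xb.
rewrite subrr mulr0; apply/eqP; rewrite pnatr_eq0 eqb0; apply/negP.
by rewrite inE /= in_itv /= => /andP[_]; rewrite leNgt bx.
Unshelve. all: by end_near. Qed.

Definition bump2 (k a b c d : R) (z : R * R) : R := bump k a b z.1 * bump k c d z.2.

Lemma test_bump2 (k a b c d r : R) : 0 < k -> 2 <= k * r ->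
  (`[a, b + r] `*` `[c, d + r])%classic `<=` disk -> test_function (bump2 k a b c d).
Proof.
move=> k0 kr KD; apply: (Cinf_test (compact_rect (a := a) (b := b + r) (c := c) (d := d + r)) KD).
  have oD := @open_disk R.
  apply: CinfM => //; (apply: (@Cinf_comp1 _ _ _ setT); [exact: oD|by []| |exact: Cinf_bump]).
    exact: CinfS (@Cinf_fst R).
  exact: CinfS (@Cinf_snd R).
move=> [x y]; rewrite /bump2 /=.
have [xa|xa] := leP x a; first by rewrite bump_eq0l// mul0r.
have [xb|xb] := leP (b + r) x; first by rewrite (bump_eq0r a kr)// mul0r.
have [yc|yc] := leP y c; first by rewrite (bump_eq0l d k0 yc)// mulr0.
have [yd|yd] := leP (d + r) y; first by rewrite (bump_eq0r c kr)// mulr0.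
by case; split; rewrite /= in_itv /= !ltW.
Qed.

(** The bumps lie between 0 and 1, so [|p|] dominates, and the integral over the rectangle is a
    limit of zeros. *)
Lemma integral_rect_eq0 (p : R * R -> R) (a b c d r : R) :
  mu.-integrable disk (EFin \o p) ->
  (forall phi, test_function phi -> \int[mu]_(z in disk) (p z * phi z) = 0) ->
  0 < r -> (`[a, b + r] `*` `[c, d + r])%classic `<=` disk ->
  (\int[mu]_(z in (`]a, b] `*` `]c, d])%classic) (p z)%:E = 0)%E.
Proof.
move=> ip p0 r0 KD; set A := (`]a, b] `*` `]c, d])%classic.
have mD := @measurable_disk R.
have mp : measurable_fun (disk : set plane) p.
  by apply/measurable_EFinP; exact: measurable_int ip.
(* From the scale [2 / r] on, a bump has died out at distance [r] beyond its right end, hence inside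
   the enlarged rectangle. *)
have [N Nr] : exists N : nat, 2 / r <= N%:R.
  by exists (Num.bound (2 / r)); rewrite ltW// archi_boundP// divr_ge0// ltW.
have tB n : test_function (bump2 (n + N).+1%:R a b c d).
  apply: (@test_bump2 _ a b c d r) => //; rewrite -ler_pdivrMr//.
  by rewrite (le_trans Nr)// ler_nat leqW// leq_addl.
have AD : A `<=` disk.
  apply: subset_trans KD => -[x y] [/=]; rewrite !in_itv /= => /andP[x1 x2] /andP[y1 y2].
  by split; rewrite /= ?in_itv /=; apply/andP; split; lra.
have mA : measurable (A : set plane) by apply: measurableX; exact: measurable_itv.
have [iA cv] : mu.-integrable disk (EFin \o (fun z => p z * \1_A z)) /\
   \int[mu]_(z in disk) (p z * bump2 (n + N).+1%:R a b c d z) @[n --> \oo] -->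
   \int[mu]_(z in disk) (p z * \1_A z).
  apply: (@Rintegral_dominated_cvg _ _ _ mu disk mD _ _ (fun z => `|p z|)).
  - by move=> n; apply: measurable_funM => //; exact: test_measurable.
  - move=> [x y] _; apply: cvgM; first exact: cvg_cst.
    rewrite (_ : \1_A (x, y) = \1_(`]a, b]%classic) x * \1_(`]c, d]%classic) y).
      by apply: cvgM; exact: bump_cvg.
    by rewrite !indicE in_setX -natrM mulnb.
  - rewrite (_ : EFin \o _ = abse \o (EFin \o p)); last by apply/funext.
    exact: integrable_abse.
  - move=> n z _; rewrite normrM ler_piMr//.
    rewrite ger0_norm; last by rewrite mulr_ge0 ?bump_ge0.
    by rewrite -[leRHS]mulr1 ler_pM ?bump_ge0 ?bump_le1.
have I0 : \int[mu]_(z in disk) (p z * \1_A z) = 0.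
  have E : (fun n => \int[mu]_(z in disk) (p z * bump2 (n + N).+1%:R a b c d z)) = cst 0.
    by apply/funext => n; apply: p0.
  rewrite E in cv; exact: (cvg_unique (@norm_hausdorff _ _) cv (cvg_cst _)).
have fin := integrable_fin_num mD iA.
rewrite -(setIidr AD) integral_mkcondr.
transitivity (\int[mu]_(z in disk) (p z * \1_A z)%:E)%E.
  apply: eq_integral => z _; rewrite patchE indicE.
  by case: ifPn; rewrite ?mulr1 ?mulr0.
by rewrite -(fineK fin); congr (_%:E).
Qed.

End RectangleBumps.

(** * Functions orthogonal to all test functions vanish almost everywhere *)

Section WeakUniqueness.
Context {R : realType}.
Local Notation plane := (measurableTypeR R * measurableTypeR R)%type.
Local Notation mu := (@plane_measure R).

(** Half-open, to match the limits of the bumps; closed under intersection and generating, as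
    Dynkin's theorem demands. *)
Definition ocrect : set (set plane) := [set A `*` B | A in @ocitv R & B in @ocitv R].

Lemma ocrectI : setI_closed ocrect.
Proof.
move=> _ _ [A oA [B oB <-]] [A' oA' [B' oB' <-]].
by exists (A `&` A'); [exact: ocitvI|exists (B `&` B'); [exact: ocitvI|rewrite setXI]].
Qed.

Lemma bigcup_ocitv : \bigcup_n (`](- n%:R), n%:R]%classic : set R) = setT.
Proof.
apply/seteqP; split=> // x _; exists (Num.bound x).+1 => //=.
have xb : `|x| < (Num.bound x).+1%:R.
  by rewrite (lt_le_trans (archi_boundP (normr_ge0 _)))// ?normr_id ler_nat /Num.bound ?normr_id.
by rewrite in_itv /= (ltW (le_lt_trans (ler_norm x) xb)) andbT ltrNl (le_lt_trans _ xb)// -normrN ler_norm.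
Qed.

(** For the inclusion from left to right, the sets whose preimage under a projection is in
    [<<s ocrect >>] form a sigma-algebra, and a strip over a half-open interval is a countable union
    of rectangles. *)
Lemma plane_measurable_ocrect : @measurable _ plane = <<s ocrect >>.
Proof.
have oc n : ocitv (`](- n%:R), n%:R]%classic : set R) by exact: is_ocitv.
apply/seteqP; split; last first.
  apply: smallest_sub; first exact: sigma_algebra_measurable.
  by move=> _ [A oA [B oB <-]]; apply: measurableX; exact: sub_sigma_algebra.
apply: smallest_sub; first exact: smallest_sigma_algebra.
rewrite subUset; split=> _ [A mA <-]; rewrite setTI.
- suff : @measurable _ (measurableTypeR R) `<=` [set A | <<s ocrect >> (fst @^-1` A : set plane)] by exact.
  apply: smallest_sub.
    split=> [|B|F] /=.
    + by rewrite preimage_set0; exact: sigma_algebra0.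
    + by move=> /sigma_algebraC; rewrite !setTD preimage_setC.
    + by move=> FG; rewrite preimage_bigcup; exact: sigma_algebra_bigcup.
  move=> B oB /=; rewrite (_ : _ @^-1` _ = \bigcup_n (B `*` `](- n%:R), n%:R]%classic)).
    apply: sigma_algebra_bigcup => n; apply: sub_sigma_algebra.
    by exists B => //; exists (`](- n%:R), n%:R]%classic).
  apply/seteqP; split=> [[x y] /= Bx|[x y] [n _ [/= ]]//].
  have : [set: R] y by []. rewrite -bigcup_ocitv => -[n _ yn]; by exists n.
- suff : @measurable _ (measurableTypeR R) `<=` [set A | <<s ocrect >> (snd @^-1` A : set plane)] by exact.
  apply: smallest_sub.
    split=> [|B|F] /=.
    + by rewrite preimage_set0; exact: sigma_algebra0.
    + by move=> /sigma_algebraC; rewrite !setTD preimage_setC.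
    + by move=> FG; rewrite preimage_bigcup; exact: sigma_algebra_bigcup.
  move=> B oB /=; rewrite (_ : _ @^-1` _ = \bigcup_n (`](- n%:R), n%:R]%classic `*` B)).
    apply: sigma_algebra_bigcup => n; apply: sub_sigma_algebra.
    by exists (`](- n%:R), n%:R]%classic) => //; exists B.
  apply/seteqP; split=> [[x y] /= Bx|[x y] [n _ [/= ]]//].
  have : [set: R] x by []. rewrite -bigcup_ocitv => -[n _ yn]; by exists n.
Qed.

Section TestZero.
Variable p : R * R -> R.
Hypothesis ip : mu.-integrable disk (EFin \o p).
Hypothesis p0 : forall phi, test_function phi -> \int[mu]_(z in disk) (p z * phi z) = 0.

(** By Dynkin's theorem the integral of [p] over [Q] intersected with any measurable set is 0, as it
    is for rectangles; an integrable function with this property is zero almost everywhere on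
    [Q]. *)
Lemma ae_eq0_square (c : R * R) (r : R) : 0 < r -> ball c (r *+ 2) `<=` disk ->
  {ae mu, forall z, ball c r z -> p z = 0}.
Proof.
move=> r0 BD; pose Q := (`]c.1 - r, c.1 + r] `*` `]c.2 - r, c.2 + r])%classic : set plane.
have mQ : measurable Q by apply: measurableX; exact: measurable_itv.
have QD : Q `<=` disk.
  apply: subset_trans BD => z [/=]; rewrite !in_itv /= => /andP[a1 a2] /andP[a3 a4].
  by rewrite ball_squareE; split; rewrite /= in_itv /= mulr2n; apply/andP; split; lra.
have iQ : mu.-integrable Q (EFin \o p) by apply: integrableS ip => //; exact: measurable_disk.
have key : forall S, <<s ocrect >> S -> (\int[mu]_(z in Q `&` S) (p z)%:E = 0)%E.
  have rect S : ocrect S -> (\int[mu]_(z in Q `&` S) (p z)%:E = 0)%E.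
    have itvI (a b a' b' : R) : (`]a, b] `&` `]a', b'])%classic = `]maxr a a', minr b b']%classic.
      apply/seteqP; split=> x /=; rewrite !in_itv /= gt_max le_min.
        by move=> [/andP[-> ->] /andP[-> ->]].
      by move=> /andP[/andP[-> ->] /andP[-> ->]].
    move=> [_ [[a b] _ <-] [_ [[a' b'] _ <-] <-]] /=; rewrite -setXI !itvI.
    (* A rectangle inside [Q], extended by [r / 2] on two sides, still lies in the doubled ball. *)
    apply: (@integral_rect_eq0 _ _ _ _ _ _ (r / 2)) => //; first exact: divr_gt0.
    apply: subset_trans BD => z [/=]; rewrite !in_itv /= !ge_max.
    move=> /andP[/andP[a1 _] a2] /andP[/andP[a3 _] a4].
    rewrite ball_squareE mulr2n.
    have b1 : minr (c.1 + r) b <= c.1 + r by rewrite ge_min lexx.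
    have b2 : minr (c.2 + r) b' <= c.2 + r by rewrite ge_min lexx.
    by split; rewrite /= in_itv /=; apply/andP; split; lra.
  have Q0 : (\int[mu]_(z in Q) (p z)%:E = 0)%E.
    rewrite -(setIid Q); apply: rect.
    exists (`]c.1 - r, c.1 + r]%classic); first exact: is_ocitv.
    by exists (`]c.2 - r, c.2 + r]%classic); first exact: is_ocitv.
  apply: (dynkin_induction plane_measurable_ocrect ocrectI); rewrite ?setIT//.
    move=> S mS S0.
    have mQS : measurable (Q `&` S) by exact: measurableI.
    have mQCS : measurable (Q `&` ~` S) by apply: measurableI => //; exact: measurableC.
    move: Q0; rewrite -{1}(setIT Q) -(setUv S) setIUr integral_setU//.
    - by rewrite S0 add0e.
    - by rewrite -setIUr setUv setIT; exact: measurable_int iQ.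
    - by apply/disj_setPS => z [[_ ?] [_ ?]].
  move=> F mF tF F0; rewrite setI_bigcupr integral_bigcup.
  - by rewrite eseries0// => n _ _; exact: F0.
  - exact: trivIset_setIl.
  - by move=> n; exact: measurableI.
  - apply: integrableS iQ => //; last by move=> z [n _ []].
    by rewrite -setI_bigcupr; apply: measurableI => //; exact: bigcupT_measurable.
have : {ae mu, forall z, Q z -> (p z)%:E = 0%E}.
  suff : ae_eq mu Q (EFin \o p) (cst 0%E) by [].
  apply: integral_ae_eq => // E EQ mE.
  rewrite integral0; have := key E; rewrite setIidr//; apply.
  by rewrite -plane_measurable_ocrect.
apply: filterS => z h Bz; suff /h[] : Q z by [].
move: Bz; rewrite ball_squareE => -[]; rewrite /= !in_itv /= => /andP[a1 a2] /andP[a3 a4].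
by split; rewrite /= in_itv /= ?a1 ?a3 /= ltW.
Qed.

Lemma ae_eq0_test : {ae mu, forall z, disk z -> p z = 0}.
Proof.
pose good (q : rat * rat * rat) := 0 < ratr q.2 :> R /\
        ball (ratr q.1.1 : R, ratr q.1.2 : R) (ratr q.2 *+ 2) `<=` disk.
(* Countably many null sets are collected by [ae_foralln]; the rational squares are therefore
   indexed by their codes in [nat]. *)
have : {ae mu, forall z, forall (n : nat) (q : rat * rat * rat),
    unpickle n = Some q -> good q -> rat_ball q z -> p z = 0}.
  apply: ae_foralln => n; case: (unpickle n) => [q|]; last by apply: aeW.
  have [[q0 qD]|ng] := pselect (good q); last by apply: aeW => z _ [<-].
  by apply: (@filterS _ _ (plane_ae_filter R) _ _ _ (ae_eq0_square q0 qD)) => z h _ [<-] _.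
apply: filterS => z h; rewrite (open_rat_ballsE (@open_disk R)) => -[q gq qz].
by apply: (h (pickle q) q) => //; rewrite pickleK.
Qed.

End TestZero.
End WeakUniqueness.

(** * Sobolev functions as bounded limits of test functions *)

Section SobolevApproximation.
Context {R : realType}.
Local Notation plane := (measurableTypeR R * measurableTypeR R)%type.
Local Notation mu := (@plane_measure R).
Implicit Types (u v p q phi psi : R * R -> R).

(* Bounded pointwise convergence of [phi_ n] and of its gradient to [u] and
   [(p, q)]: stronger than convergence in the Sobolev norm. *)
Definition test_limit u p q : Prop := exists (phi_ : nat -> R * R -> R) (C : R),
  [/\ forall n, test_function (phi_ n),
      forall n z, disk z -> [/\ `|phi_ n z| <= C, `|'D_e1 (phi_ n) z| <= C
        & `|'D_e2 (phi_ n) z| <= C]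
    & forall z, disk z -> [/\ phi_ n z @[n --> \oo] --> u z,
        'D_e1 (phi_ n) z @[n --> \oo] --> p z & 'D_e2 (phi_ n) z @[n --> \oo] --> q z]].

Lemma test_limit_test phi : test_function phi ->
  test_limit phi ('D_e1 phi) ('D_e2 phi).
Proof.
move=> t; have [C0 p0 h0] := test_bounded t.
have [C1 p1 h1] := test_bounded (test_derive e1 t).
have [C2 p2 h2] := test_bounded (test_derive e2 t).
exists (fun=> phi), (C0 + C1 + C2); split=> // [n z _|z _].
  by split; [apply: le_trans (h0 z) _|apply: le_trans (h1 z) _|apply: le_trans (h2 z) _]; lra.
by split; exact: cvg_cst.
Qed.

Lemma test_limitD (k : R) u p q u' p' q' : test_limit u p q -> test_limit u' p' q' ->
  test_limit (fun z => u z + k * u' z) (fun z => p z + k * p' z) (fun z => q z + k * q' z).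
Proof.
move=> [f [C [tf bf cf]]] [g [C' [tg bg cg]]].
have dE n (e z : R * R) : 'D_e (fun z => f n z + k * g n z) z = 'D_e (f n) z + k * 'D_e (g n) z.
  rewrite [LHS](@deriveD _ _ _ (f n) (fun z => k * g n z)).
  - by congr (_ + _); rewrite [LHS](@deriveZ _ _ _ (g n) k)//; exact: test_derivable.
  - exact: test_derivable.
  - by apply: test_derivable; exact: test_scale.
exists (fun n z => f n z + k * g n z), (C + `|k| * C'); split=> [n|n z Dz|z Dz].
- by apply: test_add => //; exact: test_scale.
- have [a1 a2 a3] := bf n z Dz; have [b1 b2 b3] := bg n z Dz.
  by split; rewrite ?dE; apply: (le_trans (ler_normD _ _)); rewrite normrM lerD// ler_wpM2l.
- have [a1 a2 a3] := cf z Dz; have [b1 b2 b3] := cg z Dz.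
  split.
  + by apply: cvgD => //; apply: cvgM => //; exact: cvg_cst.
  + under eq_fun do rewrite dE.
    by apply: cvgD => //; apply: cvgM => //; exact: cvg_cst.
  + under eq_fun do rewrite dE.
    by apply: cvgD => //; apply: cvgM => //; exact: cvg_cst.
Qed.

Definition mbounded u : Prop := measurable_fun (disk : set plane) u /\
  exists C : R, forall z, disk z -> `|u z| <= C.

Lemma mbounded_integrable u : mbounded u -> mu.-integrable disk (EFin \o u).
Proof.
move=> [mu_ [C uC]].
exact: (bounded_integrable measurable_disk mu_disk_lty mu_ uC).
Qed.

Lemma mboundedM u v : mbounded u -> mbounded v -> mbounded (fun z => u z * v z).
Proof.
move=> [mu_ [C uC]] [mv [C' vC]]; split; first exact: measurable_funM.
by exists (C * C') => z Dz; rewrite normrM ler_pM// ?uC ?vC.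
Qed.

Lemma mboundedD u v : mbounded u -> mbounded v -> mbounded (fun z => u z + v z).
Proof.
move=> [mu_ [C uC]] [mv [C' vC]]; split; first exact: measurable_funD.
by exists (C + C') => z Dz; rewrite (le_trans (ler_normD _ _))// lerD// ?uC ?vC.
Qed.

Lemma mbounded_test phi : test_function phi -> mbounded phi.
Proof.
move=> t; split; first exact: test_measurable.
by have [C _ h] := test_bounded t; exists C.
Qed.

Lemma mbounded_L2 u : mbounded u -> L2_disk u.
Proof.
move=> bu; split; first by case: bu.
exact: (mbounded_integrable (mboundedM bu bu)).
Qed.

Lemma test_limit_mbounded u p q : test_limit u p q ->
  [/\ mbounded u, mbounded p & mbounded q].
Proof.
move=> [f [C [tf bf cf]]].
have key (g : nat -> R * R -> R) (l : R * R -> R) : (forall n, test_function (g n)) ->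
    (forall n z, disk z -> `|g n z| <= C) ->
    (forall z, disk z -> g n z @[n --> \oo] --> l z) -> mbounded l.
  move=> tg gC gl; split.
    by apply: (measurable_fun_cvg _ gl) => n; exact: test_measurable.
  exists C => z Dz.
  have cn : `|g n z| @[n --> \oo] --> `|l z| by apply: cvg_norm; exact: gl.
  rewrite -(cvg_lim _ cn)//; apply: limr_le; first exact: cvgP cn.
  by apply: nearW => n; exact: gC.
split.
- by apply: (key f) => // [n z /(bf n)[]|z /cf[]].
- by apply: (key (fun n => 'D_e1 (f n))) => [n|n z /(bf n)[]|z /cf[]] //; exact: test_derive.
- by apply: (key (fun n => 'D_e2 (f n))) => [n|n z /(bf n)[]|z /cf[]] //; exact: test_derive.
Qed.

Lemma Rintegral_disk_cvg (f_ : nat -> R * R -> R) (f : R * R -> R) (C : R) :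
  (forall n, mbounded (f_ n)) ->
  (forall z, disk z -> f_ n z @[n --> \oo] --> f z) ->
  (forall n z, disk z -> `|f_ n z| <= C) ->
  \int[mu]_(z in disk) f_ n z @[n --> \oo] --> \int[mu]_(z in disk) f z.
Proof.
move=> mf; apply: (Rintegral_bounded_cvg measurable_disk mu_disk_lty).
by move=> n; case: (mf n).
Qed.

Lemma weak_derive_limit (e : R * R) (f_ : nat -> R * R -> R) (C : R) u p :
  (forall psi, test_function psi -> \int[mu]_(z in disk) 'D_e psi z = 0) ->
  (forall n, test_function (f_ n)) ->
  (forall n z, disk z -> `|f_ n z| <= C) ->
  (forall n z, disk z -> `|'D_e (f_ n) z| <= C) ->
  (forall z, disk z -> f_ n z @[n --> \oo] --> u z) ->
  (forall z, disk z -> 'D_e (f_ n) z @[n --> \oo] --> p z) ->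
  mbounded p -> is_weak_derive e u p.
Proof.
move=> int0 tf fC dC fu fp bp; split; first exact: mbounded_L2.
move=> psi tpsi; have tdpsi := test_derive e tpsi.
have [C1 _ h1] := test_bounded tpsi; have [C2 _ h2] := test_bounded tdpsi.
have c1 : \int[mu]_(z in disk) (f_ n z * 'D_e psi z) @[n --> \oo] -->
    \int[mu]_(z in disk) (u z * 'D_e psi z).
  apply: (@Rintegral_disk_cvg _ _ (C * C2)) => [n|z Dz|n z Dz].
  - by apply: mboundedM; exact: mbounded_test.
  - by apply: cvgM; [exact: fu|exact: cvg_cst].
  - by rewrite normrM ler_pM// fC.
have c2 : (- \int[mu]_(z in disk) ('D_e (f_ n) z * psi z)) @[n --> \oo] -->
    (- \int[mu]_(z in disk) (p z * psi z)).
  apply: cvgN; apply: (@Rintegral_disk_cvg _ _ (C * C1)) => [n|z Dz|n z Dz].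
  - by apply: mboundedM; apply: mbounded_test => //; exact: test_derive.
  - by apply: cvgM; [exact: fp|exact: cvg_cst].
  - by rewrite normrM ler_pM// dC.
have E : (fun n => \int[mu]_(z in disk) (f_ n z * 'D_e psi z)) =
    (fun n => - \int[mu]_(z in disk) ('D_e (f_ n) z * psi z)).
  apply/funext => n; apply: integral_test_by_parts => //.
  by apply: CinfS (test_Cinf (tf n)).
rewrite E in c1; exact: (cvg_unique (@norm_hausdorff _ _) c1 c2).
Qed.

Lemma test_limit_weak u p q : test_limit u p q ->
  is_weak_derive e1 u p /\ is_weak_derive e2 u q.
Proof.
move=> tl; have [_ bp bq] := test_limit_mbounded tl; move: tl => [f [C [tf bf cf]]].
split.
  apply: (@weak_derive_limit e1 f C) => //;
    by [exact: integral_test_derive_e1|move=> n z /(bf n)[]|move=> z /cf[]].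
apply: (@weak_derive_limit e2 f C) => //;
  by [exact: integral_test_derive_e2|move=> n z /(bf n)[]|move=> z /cf[]].
Qed.

Lemma L2_integrable u : L2_disk u -> mu.-integrable disk (EFin \o u).
Proof.
move=> [mu_ iu]; have mD := @measurable_disk R.
have i1 : mu.-integrable disk (EFin \o (cst 1 : plane -> R)).
  by apply: mbounded_integrable; split=> //; exists 1 => z _; rewrite normr1.
apply: (le_integrable mD _ _ (integrableD mD i1 iu)).
  exact/measurable_EFinP.
move=> z _ /=; rewrite lee_fin [leRHS]ger0_norm ?addr_ge0 ?sqr_ge0//.
have [h|h] := leP `|u z| 1; first by rewrite (le_trans h)// lerDl sqr_ge0.
rewrite -[u z ^+ 2]real_normK ?num_real// expr2 ler_wpDl// ler_peMr// ltW//.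
Qed.

Lemma L2_mul_integrable u v : L2_disk u -> mbounded v ->
  mu.-integrable disk (EFin \o (fun z => u z * v z)).
Proof.
move=> Lu [mv [C vC]]; have mD := @measurable_disk R.
have iu := L2_integrable Lu; case: Lu => mu_ _.
apply: (le_integrable mD _ _ (integrableZl mD C iu)).
  by apply/measurable_EFinP; exact: measurable_funM.
move=> z Dz /=; rewrite lee_fin !normrM mulrC ler_wpM2r//.
by rewrite (le_trans (vC z Dz))// ler_norm.
Qed.

(** [weak_derive] is some representative, so agreement almost everywhere is all that can hold. The
    difference of two weak derivatives annihilates every test function, and [ae_eq0_test]
    applies. *)
Lemma weak_derive_ae (e : R * R) u p : is_weak_derive e u p ->
  {ae mu, forall z, disk z -> weak_derive e u z = p z}.
Proof.
move=> wp; have mD := @measurable_disk R.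
have wq : is_weak_derive e u (weak_derive e u).
  by rewrite /weak_derive; apply: (@xgetPex _ (cst 0) [set p | is_weak_derive e u p]); exists p.
have Lp := wp.1; have Lq := wq.1.
have ih : mu.-integrable disk (EFin \o (fun z => weak_derive e u z - p z)).
  by apply: (integrableB mD (L2_integrable Lq) (L2_integrable Lp)).
have : {ae mu, forall z, disk z -> weak_derive e u z - p z = 0}.
  apply: ae_eq0_test => // phi tphi.
  have bphi := mbounded_test tphi.
  under eq_Rintegral do rewrite mulrBl.
  rewrite RintegralB//; last 2 first.
  - exact: L2_mul_integrable.
  - exact: L2_mul_integrable.
  apply/eqP; rewrite subr_eq0; apply/eqP/oppr_inj.
  by rewrite -(wp.2 _ tphi) -(wq.2 _ tphi).
by apply: filterS => z h Dz; apply/eqP; rewrite -subr_eq0; apply/eqP/h.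
Qed.

Lemma Rintegral_disk_ae (f g : R * R -> R) :
  measurable_fun (disk : set plane) f -> measurable_fun (disk : set plane) g ->
  {ae mu, forall z, disk z -> f z = g z} ->
  \int[mu]_(z in disk) f z = \int[mu]_(z in disk) g z.
Proof.
move=> mf mg fg; rewrite /Rintegral; congr fine.
apply: ae_eq_integral; first exact: measurable_disk.
- exact/measurable_EFinP.
- exact/measurable_EFinP.
- by apply: filterS fg => z h Dz; rewrite /= h.
Qed.

Lemma weak_derive_measurable (e : R * R) u p : is_weak_derive e u p ->
  measurable_fun (disk : set plane) (weak_derive e u).
Proof.
move=> wp; have [[m _] _] : is_weak_derive e u (weak_derive e u).
  by rewrite /weak_derive; apply: (@xgetPex _ (cst 0) [set p | is_weak_derive e u p]); exists p.
exact: m.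
Qed.

(** Replaces the unspecified representatives inside [dirichlet] by explicit gradients. *)
Lemma test_limit_dirichlet u p q v p' q' : test_limit u p q -> test_limit v p' q' ->
  dirichlet u v = (2 * pi)^-1 * \int[mu]_(z in disk) (p z * p' z + q z * q' z).
Proof.
move=> lu lv; congr (_ * _).
have [w1 w2] := test_limit_weak lu; have [w1' w2'] := test_limit_weak lv.
have [_ [mp _] [mq _]] := test_limit_mbounded lu.
have [_ [mp' _] [mq' _]] := test_limit_mbounded lv.
apply: Rintegral_disk_ae.
- apply: measurable_funD; apply: measurable_funM.
  + exact: weak_derive_measurable w1.
  + exact: weak_derive_measurable w1'.
  + exact: weak_derive_measurable w2.
  + exact: weak_derive_measurable w2'.
- by apply: measurable_funD; apply: measurable_funM.
- apply: filterS2 (filterI (weak_derive_ae w1) (weak_derive_ae w2))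
    (filterI (weak_derive_ae w1') (weak_derive_ae w2')) => z [h1 h2] [h1' h2'] Dz.
  by rewrite h1// h2// h1'// h2'.
Qed.

Lemma test_limit_H1_norm u p q : test_limit u p q ->
  H1_norm u = sqrtr (\int[mu]_(z in disk) (u z ^+ 2 + (p z ^+ 2 + q z ^+ 2))).
Proof.
move=> lu; congr sqrtr.
have [w1 w2] := test_limit_weak lu.
have [[mu_ _] [mp _] [mq _]] := test_limit_mbounded lu.
apply: Rintegral_disk_ae.
- apply: measurable_funD; first exact: measurable_funX.
  apply: measurable_funD; apply: measurable_funX.
  + exact: weak_derive_measurable w1.
  + exact: weak_derive_measurable w2.
- by apply: measurable_funD; [|apply: measurable_funD]; exact: measurable_funX.
- apply: filterS2 (weak_derive_ae w1) (weak_derive_ae w2) => z h1 h2 Dz.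
  by rewrite h1// h2.
Qed.

(** The disk has finite measure, so bounded pointwise convergence of the functions and of their
    gradients makes the squared Sobolev distance tend to 0. *)
Lemma test_limit_H01 u p q : test_limit u p q -> H01 u.
Proof.
move=> lu; have [w1 w2] := test_limit_weak lu.
have [bu bp bq] := test_limit_mbounded lu.
split; first by split; [exact: mbounded_L2|exists p|exists q].
move=> eps eps0; have [f [C [tf bf cf]]] := lu.
have nE n : H1_norm (u \- f n) = sqrtr (\int[mu]_(z in disk)
    ((u z - f n z) ^+ 2 + ((p z - 'D_e1 (f n) z) ^+ 2 + (q z - 'D_e2 (f n) z) ^+ 2))).
  have := test_limit_H1_norm (test_limitD (-1) lu (test_limit_test (tf n))).
  under [u in H1_norm u = _ -> _]eq_fun do rewrite mulN1r.
  move=> ->; congr sqrtr; apply: eq_Rintegral => z _.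
  by rewrite !mulN1r.
have cv : \int[mu]_(z in disk)
    ((u z - f n z) ^+ 2 + ((p z - 'D_e1 (f n) z) ^+ 2 + (q z - 'D_e2 (f n) z) ^+ 2))
    @[n --> \oo] --> (0 : R).
  have [_ [Cu hu]] := bu; have [_ [Cp hp]] := bp; have [_ [Cq hq]] := bq.
  have bB (g : R * R -> R) h : mbounded g -> test_function h ->
      mbounded (fun z => (g z - h z) ^+ 2).
    move=> bg th; have bgh : mbounded (fun z => g z - h z).
      under eq_fun do rewrite -mulN1r.
      by apply: mboundedD => //; apply: mbounded_test; exact: test_scale.
    exact: (mboundedM bgh bgh).
  have dB (x y Cx : R) : `|x| <= Cx -> `|y| <= C -> `|(x - y) ^+ 2| <= (Cx + C) ^+ 2.
    move=> hx hy; rewrite normrX ler_pXn2r// ?nnegrE//.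
      by rewrite (le_trans (ler_normB _ _))// lerD.
    by rewrite (le_trans _ (lerD hx hy))// addr_ge0.
  rewrite -(_ : \int[mu]_(z in disk) (0 : R) = 0); last first.
    by rewrite /Rintegral integral0.
  apply: (@Rintegral_disk_cvg _ _ ((Cu + C) ^+ 2 + ((Cp + C) ^+ 2 + (Cq + C) ^+ 2))).
  - move=> n; apply: mboundedD; first exact: bB.
    by apply: mboundedD; apply: bB => //; exact: test_derive.
  - move=> z Dz; have [c1 c2 c3] := cf z Dz.
    have sq (g : nat -> R) (l : R) : g n @[n --> \oo] --> l ->
        (l - g n) ^+ 2 @[n --> \oo] --> (0 : R).
      move=> gl; have gl0 : l - g n @[n --> \oo] --> l - l by apply: cvgB => //; exact: cvg_cst.
      rewrite subrr in gl0; rewrite -(mulr0 (0:R)); under eq_fun do rewrite expr2.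
      exact: cvgM.
    rewrite -(addr0 (0:R)) -{2}(addr0 (0:R)).
    by apply: cvgD; [exact: sq|apply: cvgD; exact: sq].
  - move=> n z Dz; have [c1 c2 c3] := bf n z Dz.
    apply: (le_trans (ler_normD _ _)); apply: lerD; first by apply: dB => //; exact: hu.
    apply: (le_trans (ler_normD _ _)).
    by apply: lerD; apply: dB => //; [exact: hp|exact: hq].
have := cv => /cvgrPdist_lt /(_ (eps ^+ 2)); rewrite exprn_gt0// => /(_ isT) [N _ HN].
exists (f N) => //; rewrite nE -[ltRHS](ger0_norm (ltW eps0)) -sqrtr_sqr ltr_sqrt ?exprn_gt0//.
apply: le_lt_trans (HN N (leqnn N)); rewrite sub0r normrN; exact: ler_norm.
Qed.

End SobolevApproximation.

(** * The inverse hyperbolic tangent *)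

Section Artanh.
Context {R : realType}.
Implicit Types (x u : R).

Definition artanh u : R := (ln (1 + u) - ln (1 - u)) / 2.

Lemma tanhE x : tanh x = (expR (x *+ 2) - 1) / (expR (x *+ 2) + 1).
Proof.
rewrite /tanh mulr2n expRD expRN.
have e0 : expR x != 0 by rewrite gt_eqF ?expR_gt0.
have e1 : expR x * expR x + 1 != 0.
  by rewrite gt_eqF// ltr_wpDl// mulr_ge0 ?expR_ge0.
by field; rewrite e1 e0.
Qed.

Lemma artanhK u : -1 < u < 1 -> tanh (artanh u) = u.
Proof.
move=> /andP[u1 u2]; rewrite tanhE.
have p1 : 0 < 1 + u by lra.
have p2 : 0 < 1 - u by lra.
have -> : artanh u *+ 2 = ln ((1 + u) / (1 - u)).
  by rewrite /artanh ln_div ?posrE// mulr2n; field.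
rewrite lnK ?posrE ?divr_gt0//; have n2 : 1 - u != 0 by rewrite gt_eqF.
by field; rewrite n2 /=; apply/eqP; lra.
Qed.

Lemma tanh_itv x : -1 < tanh x < 1.
Proof.
rewrite tanhE; have e0 : 0 < expR (x *+ 2) by exact: expR_gt0.
have e1 : 0 < expR (x *+ 2) + 1 by lra.
by rewrite ltr_pdivlMr// ltr_pdivrMr//; apply/andP; split; lra.
Qed.

Lemma tanhK x : artanh (tanh x) = x.
Proof.
have /andP[h1 h2] := tanh_itv x.
have p1 : 0 < 1 + tanh x by lra.
have p2 : 0 < 1 - tanh x by lra.
rewrite /artanh -ln_div ?posrE//.
have -> : (1 + tanh x) / (1 - tanh x) = expR (x *+ 2).
  have e0 : 0 < expR (x *+ 2) by exact: expR_gt0.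
  have e1 : expR (x *+ 2) + 1 != 0 by rewrite gt_eqF//; lra.
  move: p2; rewrite tanhE => p2; have n2 := lt0r_neq0 p2.
  by field; rewrite e1 /=; apply/eqP; lra.
by rewrite expRK mulr2n; field.
Qed.

Lemma ler_artanh u v : -1 < u -> u <= v -> v < 1 -> artanh u <= artanh v.
Proof.
move=> u1 uv v1; rewrite /artanh ler_pM2r ?invr_gt0// lerB// ler_ln ?posrE; lra.
Qed.

Lemma ltr_artanh u v : -1 < u -> u < v -> v < 1 -> artanh u < artanh v.
Proof.
by move=> u1 uv v1; rewrite /artanh ltr_pM2r ?invr_gt0// ltrB// ltr_ln ?posrE; lra.
Qed.

Lemma artanh0 : artanh 0 = 0.
Proof. by rewrite /artanh addr0 subr0 subrr mul0r. Qed.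

Lemma artanhD u v : 0 <= u < 1 -> 0 <= v < 1 ->
  artanh ((u + v) / (1 + u * v)) = artanh u + artanh v.
Proof.
move=> /andP[u0 u1] /andP[v0 v1].
have uv0 : 0 <= u * v by rewrite mulr_ge0.
have n0 : 0 < 1 + u * v by lra.
have n0' := lt0r_neq0 n0.
rewrite /artanh.
have -> : 1 + (u + v) / (1 + u * v) = (1 + u) * (1 + v) / (1 + u * v).
  by field; rewrite n0'.
have -> : 1 - (u + v) / (1 + u * v) = (1 - u) * (1 - v) / (1 + u * v).
  by field; rewrite n0'.
have a1 : 0 < 1 + u by lra.
have a2 : 0 < 1 + v by lra.
have a3 : 0 < 1 - u by lra.
have a4 : 0 < 1 - v by lra.
by rewrite !ln_div ?posrE ?mulr_gt0// !lnM ?posrE//; field.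
Qed.

Lemma is_derive_artanh u : -1 < u < 1 -> is_derive u 1 artanh (1 - u ^+ 2)^-1.
Proof.
move=> /andP[u1 u2].
have p1 : 0 < 1 + u by lra.
have p2 : 0 < 1 - u by lra.
have dp : is_derive u 1 (fun x : R => 1 + x) 1.
  by apply: (is_derive_eq (is_deriveD (is_derive_cst (1 : R) u 1) (is_derive_id u 1))); rewrite add0r.
have dm : is_derive u 1 (fun x : R => 1 - x) (-1).
  by apply: (is_derive_eq (is_deriveB (is_derive_cst (1 : R) u 1) (is_derive_id u 1))); rewrite sub0r.
have d1 := @is_derive1_comp _ (@ln R) (fun x : R => 1 + x) u _ _ (is_derive1_ln p1) dp.
have d2 := @is_derive1_comp _ (@ln R) (fun x : R => 1 - x) u _ _ (is_derive1_ln p2) dm.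
have d3 := is_deriveZ 2^-1 (is_deriveB d1 d2).
rewrite (_ : artanh = 2^-1 \*: ((@ln R \o (fun x : R => 1 + x)) - (@ln R \o (fun x : R => 1 - x)))); last first.
  by apply/funext => x; rewrite /artanh mulrC.
apply: (is_derive_eq d3); rewrite /GRing.scale /=.
have n1 := lt0r_neq0 p1; have n2 := lt0r_neq0 p2.
have n3 : 1 - u ^+ 2 != 0.
  by rewrite (_ : 1 - u ^+ 2 = (1 + u) * (1 - u)); [rewrite mulf_neq0|ring].
by field; rewrite n1 n2 n3.
Qed.

End Artanh.

(** * Moebius maps of the disk in real coordinates *)

Section Moebius.
Context {R : realType}.
Implicit Types (a z w : R * R).

Definition sqn z : R := z.1 ^+ 2 + z.2 ^+ 2.

Lemma sqn_ge0 z : 0 <= sqn z.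
Proof. by rewrite addr_ge0 ?sqr_ge0. Qed.

Lemma cmod_sqr z : cmod z ^+ 2 = sqn z.
Proof. by rewrite sqr_sqrtr ?sqn_ge0. Qed.

Lemma cmod_ge0 z : 0 <= cmod z.
Proof. exact: sqrtr_ge0. Qed.

Lemma disk_sqn z : disk z <-> sqn z < 1.
Proof. exact: disk_sqr. Qed.

Definition mdist2 a z : R := (z.1 - a.1) ^+ 2 + (z.2 - a.2) ^+ 2.
Definition mden1 a z : R := 1 - (a.1 * z.1 + a.2 * z.2).
Definition mden2 a z : R := a.2 * z.1 - a.1 * z.2.
(* [mden a z] is the squared modulus of [1 - conj a * z], whose real and
   imaginary parts are [mden1 a z] and [mden2 a z]. *)
Definition mden a z : R := mden1 a z ^+ 2 + mden2 a z ^+ 2.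

(** This is [(z - a) / (1 - conj a * z)], with numerator and denominator multiplied by the conjugate
    of the denominator. *)
Definition moebius a z : R * R :=
  (((z.1 - a.1) * mden1 a z + (z.2 - a.2) * mden2 a z) / mden a z,
   ((z.2 - a.2) * mden1 a z - (z.1 - a.1) * mden2 a z) / mden a z).

(** The source of most estimates on Moebius maps: positivity of [mden], invariance of the disk, and
    the approach of [mratio] to 1 at the unit circle. *)
Lemma mden_mdist2 a z : mden a z = mdist2 a z + (1 - sqn a) * (1 - sqn z).
Proof. by rewrite /mden /mden1 /mden2 /mdist2 /sqn; ring. Qed.

Lemma mdist2_ge0 a z : 0 <= mdist2 a z.
Proof. by rewrite addr_ge0 ?sqr_ge0. Qed.

Lemma mden_gt0 a z : disk a -> disk z -> 0 < mden a z.
Proof.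
move=> /disk_sqn a1 /disk_sqn z1; rewrite mden_mdist2 ltr_wpDl ?mdist2_ge0//.
by rewrite mulr_gt0 ?subr_gt0.
Qed.

Lemma sqn_moebius a z : disk a -> disk z -> sqn (moebius a z) = mdist2 a z / mden a z.
Proof.
move=> Da Dz; have n0 := lt0r_neq0 (mden_gt0 Da Dz).
rewrite /moebius /sqn /= !expr_div_n -mulrDl.
rewrite [X in X / _](_ : _ = mdist2 a z * mden a z); last first.
  by rewrite /mden /mdist2; ring.
by rewrite expr2 invfM mulrA mulfK.
Qed.

Lemma moebius_disk a z : disk a -> disk z -> disk (moebius a z).
Proof.
move=> Da Dz; have m0 := mden_gt0 Da Dz; apply/disk_sqn; rewrite sqn_moebius//.
rewrite ltr_pdivrMr// mul1r mden_mdist2 ltrDl.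
by move: Da Dz => /disk_sqn a1 /disk_sqn z1; rewrite mulr_gt0 ?subr_gt0.
Qed.

Lemma moebius_self a : moebius a a = 0.
Proof. by rewrite /moebius !subrr !mul0r addr0 subr0 !mul0r. Qed.

Lemma disk_opp a : disk a -> disk (- a).
Proof. by move=> /disk_sqn h; apply/disk_sqn; rewrite /sqn /= !sqrrN. Qed.

Lemma sqn_moebius_sym a z : disk a -> disk z -> sqn (moebius a z) = sqn (moebius z a).
Proof.
move=> Da Dz; rewrite !sqn_moebius//; congr (_ / _).
  by rewrite /mdist2; ring.
by rewrite /mden /mden1 /mden2; ring.
Qed.

Lemma moebiusK a z : disk a -> disk z -> moebius (- a) (moebius a z) = z.
Proof.
move=> Da Dz; have m0 := mden_gt0 Da Dz; have n0 := lt0r_neq0 m0.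
have m0' := mden_gt0 (disk_opp Da) (moebius_disk Da Dz); have n0' := lt0r_neq0 m0'.
have a0 : 1 - sqn a != 0 by move: Da => /disk_sqn h; rewrite gt_eqF// subr_gt0.
have nn : (1 - (a.1 * z.1 + a.2 * z.2)) ^+ 2 + (a.2 * z.1 - a.1 * z.2) ^+ 2 != 0 by exact: n0.
(* Real and imaginary parts of the identity [1 + conj a * w = (1 - |a|^2) / (1 - conj a * z)] for
   [w = moebius a z]. *)
have E1 : mden1 (- a) (moebius a z) = (1 - sqn a) * mden1 a z / mden a z.
  by rewrite /moebius /mden /mden1 /mden2 /sqn /=; field.
have E2 : mden2 (- a) (moebius a z) = - (1 - sqn a) * mden2 a z / mden a z.
  by rewrite /moebius /mden /mden1 /mden2 /sqn /=; field.
have E : mden (- a) (moebius a z) = (1 - sqn a) ^+ 2 / mden a z.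
  rewrite {1}/mden E1 E2 !expr_div_n -mulrDl.
  rewrite [X in X / _](_ : _ = (1 - sqn a) ^+ 2 * mden a z); last by rewrite /mden; ring.
  by rewrite [mden a z ^+ 2]expr2 invfM mulrA mulfK.
rewrite {1}/moebius E E1 E2 [RHS]surjective_pairing /=; congr pair.
  rewrite (_ : (moebius a z).1 - (- a).1 = (moebius a z).1 + a.1); last by rewrite /= opprK.
  rewrite (_ : (moebius a z).2 - (- a).2 = (moebius a z).2 + a.2); last by rewrite /= opprK.
  rewrite /moebius /= /mden /mden1 /mden2 /sqn in a0 *; field.
  by rewrite nn a0.
rewrite (_ : (moebius a z).1 - (- a).1 = (moebius a z).1 + a.1); last by rewrite /= opprK.
rewrite (_ : (moebius a z).2 - (- a).2 = (moebius a z).2 + a.2); last by rewrite /= opprK.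
rewrite /moebius /= /mden /mden1 /mden2 /sqn in a0 *; field.
by rewrite nn a0.
Qed.

(** For fixed moduli, [mdist2 / mden] decreases in the scalar product of [u] and [v]. Cauchy-Schwarz
    bounds that product below by [- |u| |v|], where the quotient is the square of the right-hand
    side. Through [artanhD] this becomes the triangle inequality. *)
Lemma moebius_triangle u v : disk u -> disk v ->
  cmod (moebius u v) <= (cmod u + cmod v) / (1 + cmod u * cmod v).
Proof.
move=> Du Dv; have uv0 : 0 <= cmod u * cmod v by rewrite mulr_ge0 ?cmod_ge0.
have n0 : 0 < 1 + cmod u * cmod v by rewrite ltr_wpDr.
rewrite -(@ler_pXn2r _ 2)// ?nnegrE ?cmod_ge0 ?divr_ge0 ?addr_ge0 ?cmod_ge0//.
rewrite cmod_sqr sqn_moebius// expr_div_n.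
rewrite ler_pdivrMr ?mden_gt0// mulrAC ler_pdivlMr ?exprn_gt0//.
have hu : cmod u < 1 by [].
have hv : cmod v < 1 by [].
have eu := cmod_sqr u; have ev := cmod_sqr v.
have u0 := cmod_ge0 u; have v0 := cmod_ge0 v.
set A := cmod u in hu eu u0 uv0 n0 *; set B := cmod v in hv ev v0 uv0 n0 *.
have CS : - (u.1 * v.1 + u.2 * v.2) <= A * B.
  have h : (u.1 * v.1 + u.2 * v.2) ^+ 2 <= (A * B) ^+ 2.
    rewrite exprMn eu ev /sqn -subr_ge0.
    rewrite (_ : _ - _ = (u.1 * v.2 - u.2 * v.1) ^+ 2) ?sqr_ge0//; ring.
  rewrite -(ger0_norm uv0) (le_trans (ler_norm _))// normrN.
  by rewrite -ler_sqr ?nnegrE// !real_normK ?num_real.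
have -> : mdist2 u v = A ^+ 2 + B ^+ 2 - (u.1 * v.1 + u.2 * v.2) *+ 2.
  by rewrite eu ev /mdist2 /sqn; ring.
have -> : mden u v = 1 + A ^+ 2 * B ^+ 2 - (u.1 * v.1 + u.2 * v.2) *+ 2.
  by rewrite eu ev /mden /mden1 /mden2 /sqn; ring.
set x := u.1 * v.1 + u.2 * v.2 in CS *.
rewrite -subr_ge0.
have -> : (A + B) ^+ 2 * (1 + A ^+ 2 * B ^+ 2 - x *+ 2) -
   (A ^+ 2 + B ^+ 2 - x *+ 2) * (1 + A * B) ^+ 2 =
   (x + A * B) * ((1 - A ^+ 2) * (1 - B ^+ 2)) *+ 2 by ring.
rewrite mulrn_wge0// mulr_ge0 ?mulr_ge0//; first by lra.
  by rewrite subr_ge0 expr_le1// ltW.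
by rewrite subr_ge0 expr_le1// ltW.
Qed.

End Moebius.

(** * Derivatives of pointwise expressions *)

Section PointwiseDerivatives.
Context {R : realType} {V : normedModType R}.
Implicit Types (f g : V -> R) (x v : V).

Lemma is_derive_add f g x v (df dg : R) : is_derive x v f df -> is_derive x v g dg ->
  is_derive x v (fun y => f y + g y) (df + dg).
Proof. by move=> hf hg; exact: (is_deriveD hf hg). Qed.

Lemma is_derive_sub f g x v (df dg : R) : is_derive x v f df -> is_derive x v g dg ->
  is_derive x v (fun y => f y - g y) (df - dg).
Proof. by move=> hf hg; exact: (is_deriveB hf hg). Qed.

Lemma is_derive_mul f g x v (df dg : R) : is_derive x v f df -> is_derive x v g dg ->
  is_derive x v (fun y => f y * g y) (f x * dg + g x * df).
Proof. by move=> hf hg; exact: (is_deriveM hf hg). Qed.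

Lemma is_derive_const (c : R) x v : is_derive x v (fun=> c) (0 : R).
Proof. exact: is_derive_cst. Qed.

Lemma is_derive_div f g x v (df dg : R) : g x != 0 ->
  is_derive x v f df -> is_derive x v g dg ->
  is_derive x v (fun y => f y / g y) ((df * g x - f x * dg) / g x ^+ 2).
Proof.
move=> g0 hf [hg <-].
have hi : is_derive x v (fun y => (g y)^-1) (- (g x) ^- 2 *: 'D_v g x).
  by split; [exact: derivableV|rewrite deriveV].
have := is_derive_mul hf hi; move=> h; apply: (is_derive_eq h).
by rewrite /GRing.scale /=; field.
Qed.

End PointwiseDerivatives.

(** * Derivatives of Moebius maps and contractions of the metric *)

Section MoebiusIsometry.
Context {R : realType}.
Implicit Types (a z w v : R * R).

Lemma is_derive_fst z v : is_derive z v (fun y : R * R => y.1) v.1.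
Proof.
split; last exact: derive_fst.
by apply/diff_derivable; exact: Cinf_differentiable (@Cinf_fst R) _.
Qed.

Lemma is_derive_snd z v : is_derive z v (fun y : R * R => y.2) v.2.
Proof.
split; last exact: derive_snd.
by apply/diff_derivable; exact: Cinf_differentiable (@Cinf_snd R) _.
Qed.

Lemma is_derive_mden1 a z v : is_derive z v (mden1 a) (- (a.1 * v.1 + a.2 * v.2)).
Proof.
have h := is_derive_sub (is_derive_const 1 z v) (is_derive_add
  (is_derive_mul (is_derive_const a.1 z v) (is_derive_fst z v))
  (is_derive_mul (is_derive_const a.2 z v) (is_derive_snd z v))).
by apply: (is_derive_eq h); rewrite !mulr0 !addr0 sub0r.
Qed.

Lemma is_derive_mden2 a z v : is_derive z v (mden2 a) (a.2 * v.1 - a.1 * v.2).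
Proof.
have h := is_derive_sub
  (is_derive_mul (is_derive_const a.2 z v) (is_derive_fst z v))
  (is_derive_mul (is_derive_const a.1 z v) (is_derive_snd z v)).
by apply: (is_derive_eq h); rewrite !mulr0 !addr0.
Qed.

Lemma mdenE a : mden a = fun z => mden1 a z * mden1 a z + mden2 a z * mden2 a z.
Proof. by apply/funext => z; rewrite /mden !expr2. Qed.

Lemma is_derive_mden a z v : is_derive z v (mden a)
  ((- (a.1 * v.1 + a.2 * v.2) * mden1 a z + (a.2 * v.1 - a.1 * v.2) * mden2 a z) * 2).
Proof.
have d1 := is_derive_mden1 a z v; have d2 := is_derive_mden2 a z v.
have h := is_derive_add (is_derive_mul d1 d1) (is_derive_mul d2 d2).
by rewrite mdenE; apply: (is_derive_eq h); ring.
Qed.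

(** In complex notation the value is [(1 - |a|^2) v / (1 - conj a * z)^2], made real by the squared
    conjugate of the denominator. *)
Lemma derive_moebius a z v : disk a -> disk z ->
  'D_v (moebius a) z =
  ((1 - sqn a) * (v.1 * (mden1 a z ^+ 2 - mden2 a z ^+ 2)
     + v.2 * (mden1 a z * mden2 a z) * 2) / mden a z ^+ 2,
   (1 - sqn a) * (v.2 * (mden1 a z ^+ 2 - mden2 a z ^+ 2)
     - v.1 * (mden1 a z * mden2 a z) * 2) / mden a z ^+ 2).
Proof.
move=> Da Dz; have n0 := lt0r_neq0 (mden_gt0 Da Dz).
have d1 := is_derive_mden1 a z v; have d2 := is_derive_mden2 a z v.
have x1 := is_derive_sub (is_derive_fst z v) (is_derive_const a.1 z v).
have x2 := is_derive_sub (is_derive_snd z v) (is_derive_const a.2 z v).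
have h1 := is_derive_div n0 (is_derive_add (is_derive_mul x1 d1) (is_derive_mul x2 d2))
  (is_derive_mden a z v).
have h2 := is_derive_div n0 (is_derive_sub (is_derive_mul x2 d1) (is_derive_mul x1 d2))
  (is_derive_mden a z v).
rewrite derive_pair; last first.
  by apply/derivable_pairP; split; [case: h1|case: h2].
congr pair.
  transitivity ('D_v (fun y => ((y.1 - a.1) * mden1 a y + (y.2 - a.2) * mden2 a y) / mden a y) z).
    by [].
  have [_ ->] := h1; congr (_ / _).
  by rewrite /mden /mden1 /mden2 /sqn; ring.
transitivity ('D_v (fun y => ((y.2 - a.2) * mden1 a y - (y.1 - a.1) * mden2 a y) / mden a y) z).
  by [].
have [_ ->] := h2; congr (_ / _).
by rewrite /mden /mden1 /mden2 /sqn; ring.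
Qed.

(** An inequality is enough: an isometry and its inverse are both contractions, and the two
    resulting inequalities give equality of distances. *)
Definition hyp_contraction (F : R * R -> R * R) : Prop :=
  [/\ Cinf disk (fst \o F), Cinf disk (snd \o F),
      forall z, disk z -> disk (F z)
    & forall z v, disk z -> hyp_metric (F z) ('D_v F z) ('D_v F z) <= hyp_metric z v v].

Lemma Cinf_fst_disk : Cinf disk (fun z : R * R => z.1).
Proof. exact: CinfS (@Cinf_fst R). Qed.

Lemma Cinf_snd_disk : Cinf disk (fun z : R * R => z.2).
Proof. exact: CinfS (@Cinf_snd R). Qed.

Lemma Cinf_mden1 a : Cinf [set: R * R] (mden1 a).
Proof.
have oT := @openT (R * R)%type.
apply: (@CinfB _ _ _ (cst 1)) => //; first exact: Cinf_cst.
by apply: CinfD => //; apply: CinfZ => //; [exact: Cinf_fst|exact: Cinf_snd].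
Qed.

Lemma Cinf_mden2 a : Cinf [set: R * R] (mden2 a).
Proof.
have oT := @openT (R * R)%type.
by apply: CinfB => //; apply: CinfZ => //; [exact: Cinf_fst|exact: Cinf_snd].
Qed.

Lemma Cinf_mden a : Cinf [set: R * R] (mden a).
Proof.
have oT := @openT (R * R)%type.
by rewrite mdenE; apply: CinfD => //; apply: CinfM => //;
  do ?[exact: Cinf_mden1|exact: Cinf_mden2].
Qed.

Lemma Cinf_div {V : normedModType R} (U : set V) (f g : V -> R) : open U ->
  (forall y, U y -> g y != 0) -> Cinf U f -> Cinf U g -> Cinf U (fun y => f y / g y).
Proof.
move=> oU g0 sf sg; apply: CinfM => //.
by apply: (@Cinf_comp1 _ _ _ [set x | x != 0]) => //; exact: Cinf_inv.
Qed.

Lemma moebius_contraction a : disk a -> hyp_contraction (moebius a).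
Proof.
move=> Da; have oD := @open_disk R.
have m0 z : disk z -> mden a z != 0 by move=> Dz; exact/lt0r_neq0/mden_gt0.
have x1 : Cinf disk (fun z : R * R => z.1 - a.1).
  by apply: (@CinfB _ _ _ _ (cst a.1)) => //; [exact: Cinf_fst_disk|exact: Cinf_cst].
have x2 : Cinf disk (fun z : R * R => z.2 - a.2).
  by apply: (@CinfB _ _ _ _ (cst a.2)) => //; [exact: Cinf_snd_disk|exact: Cinf_cst].
have y1 : Cinf disk (mden1 a) by apply: CinfS (Cinf_mden1 a).
have y2 : Cinf disk (mden2 a) by apply: CinfS (Cinf_mden2 a).
have y : Cinf disk (mden a) by apply: CinfS (Cinf_mden a).
split.
- apply: (Cinf_div oD m0 _ y).
  by apply: CinfD => //; apply: CinfM.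
- apply: (Cinf_div oD m0 _ y).
  by apply: CinfB => //; apply: CinfM.
- by move=> z Dz; exact: moebius_disk.
- move=> z v Dz; rewrite /hyp_metric !cmod_sqr sqn_moebius// derive_moebius//.
  have n0 := m0 z Dz.
  have a0 : 1 - sqn a != 0 by move: Da => /disk_sqn h; rewrite gt_eqF// subr_gt0.
  have z0 : 1 - sqn z != 0 by move: Dz => /disk_sqn h; rewrite gt_eqF// subr_gt0.
  (* Equality holds: the modulus of the derivative is [(1 - |a|^2) / mden a z], and
     [1 - |moebius a z|^2] is the same quantity times [1 - |z|^2]. *)
  rewrite le_eqVlt; apply/orP; left; apply/eqP.
  have -> : 1 - mdist2 a z / mden a z = (1 - sqn a) * (1 - sqn z) / mden a z.
    by apply: (mulIf n0); rewrite mulrBl mul1r !divfK// mden_mdist2; ring.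
  rewrite /euclidean_metric /=.
  set k := 1 - sqn a in a0 *; set s := mden1 a z; set t := mden2 a z.
  have E : mden a z = s ^+ 2 + t ^+ 2 by [].
  have n1 : s ^+ 2 + t ^+ 2 != 0 by rewrite -E.
  by rewrite E; field; rewrite n1 a0 z0.
Qed.

End MoebiusIsometry.

(** * Hyperbolic length and distance *)

Section HyperbolicDistance.
Context {R : realType}.
Local Notation leb := (@lebesgue_measure R).
Implicit Types (z w v : R * R) (gamma : R -> R * R).

Definition hyp_speed gamma t : R :=
  sqrtr (hyp_metric (gamma t) (derive1 gamma t) (derive1 gamma t)).

Lemma hyp_speed_ge0 gamma t : 0 <= hyp_speed gamma t.
Proof. exact: sqrtr_ge0. Qed.

Lemma smooth_path_proj z w gamma : smooth_path z w gamma ->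
  exists U : set R, [/\ open U, `[0, 1]%classic `<=` U,
    Cinf U (fst \o gamma) & Cinf U (snd \o gamma)].
Proof.
move=> [[U [oU IU sU]] _ _ _]; exists U.
by have [s1 s2] := smooth_on_comp_proj oU sU; split=> //; exact: smooth_Cinf1.
Qed.

Lemma derive1_proj (U : set R) gamma t : Cinf U (fst \o gamma) -> Cinf U (snd \o gamma) ->
  U t -> derive1 gamma t = ('D_1 (fst \o gamma) t, 'D_1 (snd \o gamma) t).
Proof.
move=> s1 s2 Ut; rewrite derive1E derive_pair//; apply/derivable_pairP; split.
  by apply/diff_derivable; exact: Cinf_differentiable s1 Ut.
by apply/diff_derivable; exact: Cinf_differentiable s2 Ut.
Qed.

Lemma hyp_speed_continuous z w gamma t : smooth_path z w gamma -> 0 <= t <= 1 ->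
  {for t, continuous (hyp_speed gamma)}.
Proof.
move=> sp t01; have [U [oU IU s1 s2]] := smooth_path_proj sp.
have [_ gD _ _] := sp.
have Ut : U t by apply: IU; rewrite /= in_itv.
pose g1 := fst \o gamma; pose g2 := snd \o gamma.
pose h s := sqrtr ((1 - (g1 s ^+ 2 + g2 s ^+ 2)) ^- 2 *
  ('D_1 g1 s * 'D_1 g1 s + 'D_1 g2 s * 'D_1 g2 s)).
apply: (@near_eq_continuous _ _ h).
  apply: filterS (open_nbhs_nbhs (conj oU Ut)) => s Us.
  by rewrite /hyp_speed (derive1_proj s1 s2 Us) /hyp_metric cmod_sqr.
have c1 : {for t, continuous g1} by exact: Cinf_continuous s1 Ut.
have c2 : {for t, continuous g2} by exact: Cinf_continuous s2 Ut.
have d1 : {for t, continuous ('D_1 g1)} by exact: Cinf_continuous (Cinf_derive (1 : R) s1) Ut.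
have d2 : {for t, continuous ('D_1 g2)} by exact: Cinf_continuous (Cinf_derive (1 : R) s2) Ut.
have cn : {for t, continuous (fun s => 1 - (g1 s ^+ 2 + g2 s ^+ 2))}.
  apply: continuousB; first exact: cvg_cst.
  by apply: continuousD; apply: continuousM.
have n0 : 1 - (g1 t ^+ 2 + g2 t ^+ 2) != 0.
  by have /disk_sqn h0 := gD t t01; rewrite gt_eqF// subr_gt0.
apply: (@continuous_comp _ _ _ (fun s => (1 - (g1 s ^+ 2 + g2 s ^+ 2)) ^- 2 *
  ('D_1 g1 s * 'D_1 g1 s + 'D_1 g2 s * 'D_1 g2 s)) (@sqrtr R)); last exact: sqrt_continuous.
apply: continuousM.
  apply: continuousV; first by rewrite expf_neq0.
  exact: continuousM.
by apply: continuousD; apply: continuousM.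
Qed.

Lemma continuous_itv_integrable (f : R -> R) :
  (forall t, 0 <= t <= 1 -> {for t, continuous f}) ->
  leb.-integrable `[0, 1] (EFin \o f).
Proof.
move=> cf; apply: continuous_compact_integrable; first exact: segment_compact.
by apply: continuous_in_subspaceT => t; rewrite inE /= in_itv /=; exact: cf.
Qed.

Lemma hyp_lengthE gamma :
  hyp_length gamma = \int[leb]_(t in `[0, 1]) hyp_speed gamma t.
Proof. by []. Qed.

Lemma hyp_length_ge0 gamma : 0 <= hyp_length gamma.
Proof. by apply: Rintegral_ge0 => t _; exact: hyp_speed_ge0. Qed.

Lemma hyp_dist_le_length z w gamma : smooth_path z w gamma ->
  hyp_dist z w <= hyp_length gamma.
Proof.
move=> sp; apply: ge_inf; last by exists gamma.
by exists 0 => _ [g _ <-]; exact: hyp_length_ge0.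
Qed.

Definition segment_path z w : R -> R * R :=
  fun t => (z.1 + t * (w.1 - z.1), z.2 + t * (w.2 - z.2)).

Lemma Cinf_segment (a b : R) : Cinf [set: R] (fun t => a + t * b).
Proof.
rewrite (_ : (fun t => _) = (fun t => b * t + a)); first exact: Cinf_affine.
by apply/funext => t; rewrite addrC mulrC.
Qed.

(** Shows that the set of lengths in [hyp_dist] is nonempty. A segment issued from the origin is
    moreover a shortest path, which [hyp_dist0] uses. *)
Lemma segment_smooth z w : disk z -> disk w -> smooth_path z w (segment_path z w).
Proof.
move=> Dz Dw; split.
- exists setT; split=> //; first exact: openT.
  by apply: smooth_on_pair; [exact: openT|exact: Cinf_segment|exact: Cinf_segment].
- move=> t /andP[t0 t1]; apply/disk_sqn; rewrite /sqn /=.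
  move: Dz Dw => /disk_sqn; rewrite /sqn => hz /disk_sqn; rewrite /sqn => hw.
  have -> : (z.1 + t * (w.1 - z.1)) ^+ 2 + (z.2 + t * (w.2 - z.2)) ^+ 2 =
    (1 - t) * (z.1 ^+ 2 + z.2 ^+ 2) + t * (w.1 ^+ 2 + w.2 ^+ 2)
    - t * (1 - t) * ((z.1 - w.1) ^+ 2 + (z.2 - w.2) ^+ 2) by ring.
  have p : 0 <= t * (1 - t) * ((z.1 - w.1) ^+ 2 + (z.2 - w.2) ^+ 2).
    by apply: mulr_ge0; [apply: mulr_ge0; rewrite ?subr_ge0|rewrite addr_ge0 ?sqr_ge0].
  have q : (1 - t) * (1 - (z.1 ^+ 2 + z.2 ^+ 2)) + t * (1 - (w.1 ^+ 2 + w.2 ^+ 2)) > 0.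
    have [->|t00] := eqVneq t 0; first by rewrite subr0 mul1r mul0r addr0 subr_gt0.
    rewrite ltr_wpDl// ?mulr_ge0 ?subr_ge0// ?(ltW hz)//.
    by rewrite mulr_gt0 ?subr_gt0// lt_def t00.
  rewrite -subr_gt0; set d := t * (1 - t) * _ in p *.
  rewrite (_ : _ - _ = (1 - t) * (1 - (z.1 ^+ 2 + z.2 ^+ 2)) +
    t * (1 - (w.1 ^+ 2 + w.2 ^+ 2)) + d); first by rewrite ltr_wpDr.
  by ring.
- by rewrite /segment_path !mul0r !addr0 -surjective_pairing.
- by rewrite /segment_path !mul1r !subrKC -surjective_pairing.
Qed.

Lemma contraction_derive1 (F : R * R -> R * R) (U : set R) gamma t : hyp_contraction F ->
  Cinf U (fst \o gamma) -> Cinf U (snd \o gamma) -> U t -> disk (gamma t) ->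
  derive1 (F \o gamma) t = 'D_(derive1 gamma t) F (gamma t).
Proof.
move=> [F1 F2 _ _] s1 s2 Ut Dt.
have dg : differentiable gamma t.
  rewrite (_ : gamma = (fun s => ((fst \o gamma) s, (snd \o gamma) s))).
    apply: differentiable_pair; first exact: Cinf_differentiable s1 Ut.
    exact: Cinf_differentiable s2 Ut.
  by apply/funext => s /=; rewrite -surjective_pairing.
have dF : differentiable F (gamma t).
  rewrite (_ : F = (fun s => ((fst \o F) s, (snd \o F) s))).
    apply: differentiable_pair; first exact: Cinf_differentiable F1 Dt.
    exact: Cinf_differentiable F2 Dt.
  by apply/funext => s /=; rewrite -surjective_pairing.
rewrite !derive1E deriveE; last exact: differentiable_comp.
by rewrite diff_comp//= [in RHS]deriveE// [in RHS]deriveE.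
Qed.

Lemma contraction_path (F : R * R -> R * R) z w gamma : hyp_contraction F ->
  smooth_path z w gamma -> smooth_path (F z) (F w) (F \o gamma).
Proof.
move=> cF sp; have [U [oU IU s1 s2]] := smooth_path_proj sp.
have [F1 F2 FD _] := cF; have [_ gD g0 g1] := sp.
(* [F] is smooth on the disk only, so the neighbourhood of the unit interval is cut down to the
   times at which [gamma] is in the disk. *)
pose U' := U `&` gamma @^-1` disk.
have oU' : open U'.
  rewrite openE => t [Ut Dt]; apply: filterI; first exact: open_nbhs_nbhs.
  have cg : {for t, continuous gamma}.
    by apply/continuous_pairP; split; [exact: Cinf_continuous s1 Ut|exact: Cinf_continuous s2 Ut].
  by apply: cg; apply: open_nbhs_nbhs; split=> //; exact: open_disk.
have gE : gamma = (fun s => ((fst \o gamma) s, (snd \o gamma) s)).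
  by apply/funext => s /=; rewrite -surjective_pairing.
have s1' : Cinf U' (fst \o gamma) by apply: CinfS s1 => t [].
have s2' : Cinf U' (snd \o gamma) by apply: CinfS s2 => t [].
split.
- exists U'; split=> //.
    by move=> t tI; split; [exact: IU|apply: gD; rewrite /= in_itv in tI].
  have UD t : U' t -> disk ((fst \o gamma) t, (snd \o gamma) t).
    by move=> [_]; rewrite /= -surjective_pairing.
  have C1 := Cinf_comp2 oU' UD s1' s2' F1.
  have C2 := Cinf_comp2 oU' UD s1' s2' F2.
  have -> : F \o gamma = (fun t => ((fst \o F) ((fst \o gamma) t, (snd \o gamma) t),
      (snd \o F) ((fst \o gamma) t, (snd \o gamma) t))).
    by apply/funext => t /=; rewrite -!surjective_pairing.
  exact: smooth_on_pair.
- by move=> t t01; apply: FD; exact: gD.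
- by rewrite /= g0.
- by rewrite /= g1.
Qed.

Lemma hyp_dist_contraction (F : R * R -> R * R) z w : hyp_contraction F ->
  disk z -> disk w -> hyp_dist (F z) (F w) <= hyp_dist z w.
Proof.
move=> cF Dz Dw; apply: lb_le_inf.
  by exists (hyp_length (segment_path z w)); exists (segment_path z w) => //; exact: segment_smooth.
move=> _ [gamma sp <-]; have spF := contraction_path cF sp.
apply: (le_trans (hyp_dist_le_length spF)); rewrite !hyp_lengthE.
apply: le_Rintegral; first exact: measurable_itv.
- by apply: continuous_itv_integrable => t; exact: hyp_speed_continuous spF.
- by apply: continuous_itv_integrable => t; exact: hyp_speed_continuous sp.
move=> t; rewrite /= in_itv /= => t01.
have [_ gD _ _] := sp; have Dt := gD t t01.
have [U [oU IU s1 s2]] := smooth_path_proj sp.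
have Ut : U t by apply: IU; rewrite /= in_itv.
apply: ler_wsqrtr; rewrite (contraction_derive1 cF s1 s2 Ut Dt).
by have [_ _ _] := cF; apply.
Qed.

Lemma unit_direction w : exists e : R * R,
  [/\ e.1 ^+ 2 + e.2 ^+ 2 = 1 & w.1 * e.1 + w.2 * e.2 = cmod w].
Proof.
have [w0|w0] := eqVneq (cmod w) 0.
  exists e1; split; first by rewrite /e1 /= expr1n expr0n addr0.
  have : sqn w = 0 by rewrite -cmod_sqr w0 expr0n.
  move=> /eqP; rewrite paddr_eq0 ?sqr_ge0// !sqrf_eq0 => /andP[/eqP -> /eqP ->].
  by rewrite w0 !mul0r addr0.
exists (w.1 / cmod w, w.2 / cmod w); split => /=.
  by rewrite !expr_div_n -mulrDl -[X in X / _]/(sqn w) -cmod_sqr mulfV// expf_neq0.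
rewrite !mulrA -mulrDl -!expr2 -[X in X / _](cmod_sqr w) expr2.
by rewrite mulfK.
Qed.

(** The path is projected on the direction [e] of its end point. The projection [p] is smooth,
    unlike [|gamma|] at the origin, and by Cauchy-Schwarz both [p^2 <= |gamma|^2] and
    [p' <= |gamma'|]; hence the derivative of [artanh (p t)] is at most the hyperbolic speed. *)
Lemma artanh_le_length w gamma : smooth_path 0 w gamma -> artanh (cmod w) <= hyp_length gamma.
Proof.
move=> sp; have [U [oU IU s1 s2]] := smooth_path_proj sp.
have [_ gD g0 g1] := sp.
have [e [ee we]] := unit_direction w.
pose p t := (gamma t).1 * e.1 + (gamma t).2 * e.2.
have sp' : Cinf U p.
  have -> : p = (fun t => e.1 * (fst \o gamma) t + e.2 * (snd \o gamma) t).
    by apply/funext => t; rewrite /p /= mulrC [X in _ + X]mulrC.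
  by apply: CinfD => //; exact: CinfZ.
pose f t := 'D_1 p t * (1 - p t ^+ 2)^-1.
have UI (t : R) : 0 <= t <= 1 -> U t by move=> t01; apply: IU; rewrite /= in_itv.
have pD (t : R) : 0 <= t <= 1 -> p t ^+ 2 <= sqn (gamma t).
  move=> t01; rewrite /p /sqn -[leRHS]mulr1 -ee -subr_ge0.
  rewrite (_ : _ - _ = ((gamma t).1 * e.2 - (gamma t).2 * e.1) ^+ 2) ?sqr_ge0//; ring.
have p1 (t : R) : 0 <= t <= 1 -> p t ^+ 2 < 1.
  by move=> t01; apply: le_lt_trans (pD t t01) _; apply/disk_sqn/gD.
have pI (t : R) : 0 <= t <= 1 -> -1 < p t < 1.
  move=> t01; rewrite -ltr_norml -(@expr_lt1 _ 2)// real_normK ?num_real//.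
  exact: p1.
have df (t : R) : 0 <= t <= 1 -> is_derive t 1 (artanh \o p) (f t).
  move=> t01; have dp : is_derive t 1 p ('D_1 p t).
    by apply/derivableP/diff_derivable; exact: Cinf_differentiable sp' (UI t t01).
  rewrite /f mulrC; exact: (is_derive1_comp (is_derive_artanh (pI t t01)) dp).
have cf (t : R) : 0 <= t <= 1 -> {for t, continuous f}.
  move=> t01; have Ut := UI t t01.
  apply: continuousM; first exact: Cinf_continuous (Cinf_derive (1:R) sp') Ut.
  apply: continuousV; first by rewrite gt_eqF// subr_gt0 p1.
  apply: continuousB; first exact: cvg_cst.
  by apply: continuousM; exact: Cinf_continuous sp' Ut.
have -> : artanh (cmod w) = \int[leb]_(t in `[0, 1]) f t.
  rewrite /Rintegral (FTC_everywhere ltr01 df cf) /=.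
  by rewrite /p g0 g1 we /= !mul0r addr0 artanh0 subr0.
rewrite hyp_lengthE; apply: le_Rintegral; first exact: measurable_itv.
- exact: continuous_itv_integrable.
- by apply: continuous_itv_integrable => t; exact: hyp_speed_continuous sp.
move=> t; rewrite /= in_itv /= => t01; have Ut := UI t t01.
have Dt := gD t t01; have /disk_sqn Dt' := Dt.
rewrite /hyp_speed (derive1_proj s1 s2 Ut) /hyp_metric cmod_sqr /euclidean_metric /=.
set a := 'D_1 (fst \o gamma) t; set b := 'D_1 (snd \o gamma) t.
have dpE : 'D_1 p t = a * e.1 + b * e.2.
  have da : is_derive t 1 (fst \o gamma) a.
    by apply/derivableP/diff_derivable; exact: Cinf_differentiable s1 Ut.
  have db : is_derive t 1 (snd \o gamma) b.
    by apply/derivableP/diff_derivable; exact: Cinf_differentiable s2 Ut.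
  have [_ ->] := is_derive_add (is_derive_mul da (is_derive_const e.1 t 1))
     (is_derive_mul db (is_derive_const e.2 t 1)).
  by rewrite !mulr0 !add0r mulrC [X in _ + X]mulrC.
rewrite sqrtrM ?invr_ge0 ?sqr_ge0// sqrtrV ?sqr_ge0// sqrtr_sqr ger0_norm; last by rewrite subr_ge0 ltW.
rewrite /f dpE mulrC.
have ab0 : 0 <= sqrtr (a * a + b * b) by exact: sqrtr_ge0.
have le1 : a * e.1 + b * e.2 <= sqrtr (a * a + b * b).
  apply: (le_trans (ler_norm _)).
  rewrite -sqrtr_sqr ler_wsqrtr// -[leRHS]mulr1 -ee -subr_ge0.
  rewrite (_ : _ - _ = (a * e.2 - b * e.1) ^+ 2) ?sqr_ge0//; ring.
have q1 : 0 < 1 - p t ^+ 2 by rewrite subr_gt0 p1.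
apply: (@le_trans _ _ ((1 - p t ^+ 2)^-1 * sqrtr (a * a + b * b))).
  by rewrite ler_wpM2l// invr_ge0 ltW.
apply: ler_wpM2r => //; have q2 : 0 < 1 - sqn (gamma t) by rewrite subr_gt0.
have q3 : 1 - sqn (gamma t) <= 1 - p t ^+ 2 by apply: lerB => //; exact: pD.
by rewrite lef_pV2 ?posrE.
Qed.

Lemma hyp_dist0 w : disk w -> hyp_dist 0 w = artanh (cmod w).
Proof.
move=> Dw; have D0 : disk (0 : R * R).
  by apply/disk_sqn; rewrite /sqn /= expr0n addr0.
have sp := segment_smooth D0 Dw.
apply/eqP; rewrite eq_le; apply/andP; split; last first.
  apply: lb_le_inf; first by exists (hyp_length (segment_path 0 w)); exists (segment_path 0 w).
  by move=> _ [gamma spg <-]; exact: artanh_le_length.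
apply: (le_trans (hyp_dist_le_length sp)).
pose r := cmod w; have r0 : 0 <= r by exact: cmod_ge0.
have r1 : r < 1 by [].
pose f t := (1 - (t * r) ^+ 2)^-1 * r.
have tr (t : R) : 0 <= t <= 1 -> -1 < t * r < 1.
  move=> /andP[t0 t1]; have h : t * r <= r by rewrite ler_piMl.
  have h' : 0 <= t * r by rewrite mulr_ge0.
  by apply/andP; split; lra.
have n0 (t : R) : 0 <= t <= 1 -> 0 < 1 - (t * r) ^+ 2.
  move=> /tr; rewrite -ltr_norml => h; rewrite subr_gt0 -real_normK ?num_real//.
  by rewrite expr_lt1.
have df (t : R) : 0 <= t <= 1 -> is_derive t 1 (artanh \o (fun t => t * r)) (f t).
  move=> t01; have dp : is_derive t 1 (fun t => t * r) r.
    have h := is_derive_mul (is_derive_id t 1) (is_derive_const r t 1).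
    by apply: (is_derive_eq h); rewrite mulr0 add0r mulr1.
  exact: (@is_derive1_comp _ (@artanh R) (fun t => t * r) t _ _ (is_derive_artanh (tr t t01)) dp).
have cf (t : R) : 0 <= t <= 1 -> {for t, continuous f}.
  move=> t01; apply: continuousM; last exact: cvg_cst.
  apply: continuousV; first by rewrite gt_eqF// n0.
  apply: continuousB; first exact: cvg_cst.
  by apply: continuousM; apply: continuousM; do ?[exact: cvg_id|exact: cvg_cst].
have E (t : R) : 0 <= t <= 1 -> hyp_speed (segment_path 0 w) t = f t.
  move=> t01; have oT := @openT R.
  have C1 : Cinf [set: R] (fst \o segment_path 0 w) by exact: Cinf_segment.
  have C2 : Cinf [set: R] (snd \o segment_path 0 w) by exact: Cinf_segment.
  have d1 (a b : R) : 'D_1 (fun t : R => a + t * (b - a)) t = b - a.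
    have h := is_derive_add (is_derive_const a t 1)
      (is_derive_mul (is_derive_id t 1) (is_derive_const (b - a) t 1)).
    by have [_ ->] := h; rewrite mulr0 !add0r mulr1.
  rewrite /hyp_speed (derive1_proj C1 C2 I) /hyp_metric /euclidean_metric cmod_sqr.
  rewrite [X in (X, _)]d1 [X in (_, X)]d1 /= !subr0.
  have -> : sqn (segment_path 0 w t) = (t * r) ^+ 2.
    by rewrite exprMn cmod_sqr /sqn /segment_path /= !add0r !subr0; ring.
  rewrite sqrtrM ?invr_ge0 ?sqr_ge0// sqrtrV ?sqr_ge0// sqrtr_sqr ger0_norm; last exact/ltW/n0.
  by rewrite -!expr2.
have -> : hyp_length (segment_path 0 w) = \int[leb]_(t in `[0, 1]) f t.
  by apply: eq_Rintegral => t; rewrite inE /= in_itv /=; exact: E.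
rewrite /Rintegral (FTC_everywhere ltr01 df cf) /=.
by rewrite mul1r mul0r artanh0 subr0.
Qed.

(** For the inverse [G] the chain rule applied to [F (G z) = z] sends ['D_v G z] back to [v], so the
    metric identity of [F] at [G z] is the one wanted for [G] at [z]. *)
Lemma poincare_contraction (F : R * R -> R * R) : poincare_isometry F ->
  hyp_contraction F /\ exists G : R * R -> R * R,
   [/\ hyp_contraction G & forall z, disk z -> G (F z) = z].
Proof.
move=> [sF FD [G [sG GD GF FG]] metF].
have oD := @open_disk R.
have [F1 F2] := smooth_on_comp_proj oD sF; have [G1 G2] := smooth_on_comp_proj oD sG.
have cF : hyp_contraction F.
  split; [exact: (smooth_Cinf oD F1)|exact: (smooth_Cinf oD F2)|exact: FD|].
  by move=> z v Dz; rewrite metF.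
split; first exact: cF.
exists G; split; last exact: GF.
split; [exact: (smooth_Cinf oD G1)|exact: (smooth_Cinf oD G2)|exact: GD|].
move=> z v Dz; have DGz := GD z Dz.
have dpair (H : R * R -> R * R) y : disk y -> smooth_on disk (fst \o H) ->
    smooth_on disk (snd \o H) -> differentiable H y.
  move=> Dy H1 H2; rewrite (_ : H = (fun s => ((fst \o H) s, (snd \o H) s))).
    apply: differentiable_pair.
      exact: Cinf_differentiable (smooth_Cinf oD H1) Dy.
    exact: Cinf_differentiable (smooth_Cinf oD H2) Dy.
  by apply/funext => s /=; rewrite -surjective_pairing.
have dG := dpair G z Dz G1 G2; have dF := dpair F (G z) DGz F1 F2.
have chain : 'D_('D_v G z) F (G z) = v.
  have : 'D_v (F \o G) z = v.
    rewrite (@near_eq_derive _ _ _ _ id) ?derive_id//.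
    by apply: filterS (open_nbhs_nbhs (conj oD Dz)) => y Dy /=; exact: FG.
  rewrite deriveE; last exact: differentiable_comp.
  by rewrite (diff_comp dG dF) /= => E; rewrite deriveE// deriveE.
rewrite -(metF (G z) ('D_v G z) ('D_v G z) DGz).
by rewrite chain FG.
Qed.

Lemma hyp_dist_isometry (F G : R * R -> R * R) z w : hyp_contraction F -> hyp_contraction G ->
  (forall z, disk z -> G (F z) = z) -> disk z -> disk w ->
  hyp_dist (F z) (F w) = hyp_dist z w.
Proof.
move=> cF cG GF Dz Dw; apply/eqP; rewrite eq_le hyp_dist_contraction//=.
rewrite -{1}(GF z Dz) -{1}(GF w Dw); have [_ _ FD _] := cF.
by apply: hyp_dist_contraction => //; exact: FD.
Qed.

Lemma hyp_distE z w : disk z -> disk w -> hyp_dist z w = artanh (cmod (moebius z w)).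
Proof.
move=> Dz Dw.
rewrite -(hyp_dist_isometry (moebius_contraction Dz) (moebius_contraction (disk_opp Dz)))//.
  by rewrite moebius_self hyp_dist0//; exact: moebius_disk.
by move=> y Dy; exact: moebiusK.
Qed.

(** Both moduli are [tanh] of the distance from [a] to [z], which each of the two maps preserves. *)
Lemma cmod_isometry (F : R * R -> R * R) a z : poincare_isometry F -> F a = 0 ->
  disk a -> disk z -> cmod (F z) = cmod (moebius a z).
Proof.
move=> iF Fa Da Dz; have [cF [G [cG GF]]] := poincare_contraction iF.
have [_ FD _ _] := iF.
have ci y : disk y -> -1 < cmod y < 1.
  by move=> Dy; rewrite (lt_le_trans (ltrN10 _) (cmod_ge0 _)).
rewrite -[LHS]artanhK ?ci//; last exact: FD.
rewrite -hyp_dist0; last exact: FD.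
rewrite -Fa (hyp_dist_isometry cF cG GF)// hyp_distE// artanhK// ci//.
exact: moebius_disk.
Qed.

Lemma hyp_dist_sym z w : disk z -> disk w -> hyp_dist z w = hyp_dist w z.
Proof.
move=> Dz Dw; rewrite !hyp_distE//; congr artanh; congr sqrtr.
exact: sqn_moebius_sym.
Qed.

(** A Moebius map moves [y] to the origin, and [moebius_triangle] finishes. Concatenating paths
    would leave the class of smooth paths. *)
Lemma hyp_dist_triangle z w y : disk z -> disk w -> disk y ->
  hyp_dist z w <= hyp_dist z y + hyp_dist w y.
Proof.
move=> Dz Dw Dy.
have iso := hyp_dist_isometry (moebius_contraction Dy) (moebius_contraction (disk_opp Dy))
   (fun x Dx => moebiusK Dy Dx).
rewrite -(iso z w)// -(iso z y)// -(iso w y)// moebius_self.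
have Du := moebius_disk Dy Dz; have Dv := moebius_disk Dy Dw.
set u := moebius y z in Du *; set v := moebius y w in Dv *.
have D0 : disk (0 : R * R) by apply/disk_sqn; rewrite /sqn /= expr0n addr0.
rewrite (hyp_dist_sym Du D0) (hyp_dist_sym Dv D0) !hyp_dist0// hyp_distE//.
have u0 := cmod_ge0 u; have v0 := cmod_ge0 v.
have hu : cmod u < 1 by []. have hv : cmod v < 1 by [].
rewrite -artanhD ?u0 ?v0//; apply: ler_artanh.
- by rewrite (lt_le_trans (ltrN10 _) (cmod_ge0 _)).
- exact: moebius_triangle.
- have uv0 : 0 <= cmod u * cmod v by rewrite mulr_ge0.
  rewrite ltr_pdivrMr ?ltr_wpDr// mul1r -subr_gt0.
  rewrite (_ : _ - _ = (1 - cmod u) * (1 - cmod v)); last by ring.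
  by rewrite mulr_gt0 ?subr_gt0.
Qed.

End HyperbolicDistance.

(** * A smooth maximum *)

Section SmoothMax.
Context {R : realType}.
Implicit Types (k c t : R).

(** The maximum is [t] plus the positive part of [c - t]. Since [ramp] vanishes up to 1, nothing
    changes for [t >= c]: the smoothing is confined to [t < c]. *)
Definition smax k c t : R := t + rampk k (c - t).

Lemma smax_id k c t : k * (c - t) <= 1 -> smax k c t = t.
Proof. by move=> h; rewrite /smax rampk_eq0// addr0. Qed.

Lemma smax_cst k c t : k != 0 -> 2 <= k * (c - t) -> smax k c t = c.
Proof. by move=> k0 h; rewrite /smax rampk_id// subrKC. Qed.

Lemma smax_ge k c t : 0 < k -> t <= smax k c t.
Proof. by move=> k0; rewrite /smax lerDl rampk_ge0. Qed.

(** Either the value is [c], or [t > c - 2 / k], which is at least [c / 2] as soon as [4 <= k * c].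
    This bound keeps the logarithm away from 0 uniformly in [k]. *)
Lemma smax_ge_half k c t : 0 < k -> 4 <= k * c -> c / 2 <= smax k c t.
Proof.
move=> k0 kc; have c0 : 0 < c by rewrite -(pmulr_rgt0 _ k0); lra.
have [h|h] := leP 2 (k * (c - t)).
  by rewrite smax_cst ?gt_eqF//; lra.
apply: le_trans (smax_ge c t k0); rewrite -(ler_pM2l k0).
by rewrite mulrBr in h; lra.
Qed.

Lemma smax_gt0 k c t : 0 < k -> 4 <= k * c -> 0 < smax k c t.
Proof.
move=> k0 kc; have c0 : 0 < c by rewrite -(pmulr_rgt0 _ k0); lra.
by apply: lt_le_trans (smax_ge_half t k0 kc); rewrite divr_gt0.
Qed.

Lemma smax_le k c t : 0 < k -> smax k c t <= maxr c t.
Proof.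
move=> k0; rewrite /smax le_max; have [h|h] := leP t c.
  by rewrite -lerBrDl rampk_le ?subr_ge0.
have -> : rampk k (c - t) = 0.
  by apply: rampk_eq0; rewrite (@le_trans _ _ 0)// pmulr_rle0// subr_le0 ltW.
by rewrite addr0 lexx orbT.
Qed.

Lemma Cinf_smax k c : Cinf [set: R] (smax k c).
Proof.
have oT := @openT R.
apply: CinfD => //; first exact: Cinf_id.
apply: (@Cinf_comp1 _ _ _ setT (fun t => c - t)) => //; last exact: Cinf_rampk.
by apply: (@CinfB _ _ _ (cst c)) => //; [exact: Cinf_cst|exact: Cinf_id].
Qed.

Lemma derive_smax k c t : k != 0 -> 'D_1 (smax k c) t = 1 - 'D_1 ramp (k * (c - t)).
Proof.
move=> k0.
have d1 : is_derive t 1 (fun t => c - t) (-1).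
  by apply: (is_derive_eq (is_derive_sub (is_derive_const c t 1) (is_derive_id t 1))); rewrite sub0r.
have dr : is_derive (c - t) 1 (rampk k) ('D_1 ramp (k * (c - t))).
  split; last exact: derive_rampk.
  by apply/diff_derivable; exact: Cinf_differentiable (Cinf_rampk k) _.
have d2 := @is_derive1_comp _ (rampk k) (fun t => c - t) t _ _ dr d1.
have [_ E] := is_derive_add (is_derive_id t 1) d2.
by rewrite mulrN1 in E.
Qed.

Lemma cvg_smax c t (N : nat) : smax (n + N).+1%:R c t @[n --> \oo] --> maxr c t.
Proof.
have [h|h] := leP c t.
  apply: cvg_near_cst; apply: nearW => n; apply: smax_id.
  by rewrite (@le_trans _ _ 0)// pmulr_rle0// subr_le0.
apply: cvg_near_cst; near=> n; apply: smax_cst => //.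
rewrite -ler_pdivrMr ?subr_gt0// (@le_trans _ _ n%:R) ?ler_nat ?leqW ?leq_addr//.
by near: n; exact: nbhs_infty_ger.
Unshelve. all: by end_near. Qed.

(** At [t = c] the slope is 1 for every [k], because [smax k c] is the identity on [t > c - 1 / k];
    hence the non-strict comparison in the limit. *)
Lemma cvg_derive_smax c t (N : nat) :
  'D_1 (smax (n + N).+1%:R c) t @[n --> \oo] --> ((c <= t)%R%:R : R).
Proof.
apply: cvg_near_cst; have [h|h] := leP c t.
  apply: nearW => n; rewrite derive_smax// dramp_eq0 ?subr0//.
  by rewrite (@le_lt_trans _ _ 0)// pmulr_rle0// subr_le0.
near=> n; rewrite derive_smax// dramp_eq1 ?subrr//.
rewrite -ltr_pdivrMr ?subr_gt0// (@lt_le_trans _ _ n%:R) ?ler_nat ?leqW ?leq_addr//.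
by near: n; exact: nbhs_infty_gtr.
Unshelve. all: by end_near. Qed.

Lemma derive_smax_bounded : exists2 C : R, 0 < C &
  forall k c t, k != 0 -> `|'D_1 (smax k c) t| <= C.
Proof.
have [C C0 hC] := @dramp_bounded R; exists (1 + C); first by rewrite addr_gt0.
move=> k c t k0; rewrite derive_smax// (le_trans (ler_normB _ _))// normr1 lerD2l.
exact: hC.
Qed.

End SmoothMax.

(** * Uniform control up to the closed disk *)

Section ClosedDisk.
Context {R : realType}.
Local Notation plane := (measurableTypeR R * measurableTypeR R)%type.
Local Notation mu := (@plane_measure R).
Implicit Types (a z : R * R) (u : R * R -> R).

Lemma sqn_continuous : continuous (@sqn R).
Proof.
by move=> z; apply: cvgD; apply: cvgM; do ?[exact: cvg_fst|exact: cvg_snd].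
Qed.

Lemma compact_closed_disk (rho : R) : rho <= 1 -> compact [set z : R * R | sqn z <= rho].
Proof.
move=> r1; apply: (subclosed_compact _ (@compact_rect R (-1) 1 (-1) 1)).
  by apply: (@preimage_closed _ _ (@sqn R) [set x | x <= rho]); [move=> z _; exact: sqn_continuous|exact: closed_le].
move=> z /= h; have h1 : sqn z <= 1 by exact: le_trans h r1.
split; rewrite /= in_itv /= -ler_norml -(@expr_le1 _ 2)// real_normK ?num_real//.
  by rewrite (le_trans _ h1)// lerDl sqr_ge0.
by rewrite (le_trans _ h1)// lerDr sqr_ge0.
Qed.

(** A function smooth on a neighbourhood of the closed disk is bounded on the disk with all its
    derivatives; smoothness on the open disk alone would not give this. *)
Definition nbhs_disk (U : set (R * R)) : Prop := open U /\ (forall z, sqn z <= 1 -> U z).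

Lemma nbhs_disk_sub U : nbhs_disk U -> disk `<=` U.
Proof. by move=> [_ h] z /disk_sqn /ltW /h. Qed.

Lemma Cinf_mbounded U u : nbhs_disk U -> Cinf U u -> mbounded u.
Proof.
move=> [oU DU] su; split.
  by apply: Cinf_measurable; apply: CinfS su => z /disk_sqn /ltW /DU.
have [C _ hC] := continuous_compact_bounded (compact_closed_disk (lexx (1:R)))
  (fun z (h : sqn z <= 1) => Cinf_continuous su (DU z h)).
by exists C => z /disk_sqn /ltW /hC.
Qed.

Definition mdom a : set (R * R) := [set z | mden a z != 0].

Lemma mdom_nbhs a : disk a -> nbhs_disk (mdom a).
Proof.
move=> /disk_sqn Da; split.
  apply: (@open_comp _ _ (mden a) [set x | x != 0]); last exact: open_neq0.
  by move=> z _; exact: Cinf_continuous (Cinf_mden a) _.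
move=> z z1; rewrite /mdom /= mden_mdist2.
have [m0|m0] := eqVneq (mdist2 a z) 0; last first.
  rewrite gt_eqF// ltr_pwDl//; first by rewrite lt_def m0 mdist2_ge0.
  by rewrite mulr_ge0 ?subr_ge0// ltW.
move: m0 => /eqP; rewrite paddr_eq0 ?sqr_ge0// !sqrf_eq0 !subr_eq0 => /andP[/eqP h1 /eqP h2].
have -> : sqn z = sqn a by rewrite /sqn h1 h2.
by rewrite gt_eqF// ltr_wpDl ?mdist2_ge0// mulr_gt0 ?subr_gt0.
Qed.

Lemma open_mdom a : disk a -> open (mdom a).
Proof. by move=> /mdom_nbhs[]. Qed.

Lemma mdom_mden_gt0 a z : mdom a z -> 0 < mden a z.
Proof. by move=> h; rewrite lt_def h addr_ge0 ?sqr_ge0. Qed.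

Lemma Cinf_mdist2 a : Cinf [set: R * R] (mdist2 a).
Proof.
have oT := @openT (R * R)%type.
have h1 : Cinf [set: R * R] (fun z : R * R => z.1 - a.1).
  by apply: (@CinfB _ _ _ _ (cst a.1)) => //; [exact: Cinf_fst|exact: Cinf_cst].
have h2 : Cinf [set: R * R] (fun z : R * R => z.2 - a.2).
  by apply: (@CinfB _ _ _ _ (cst a.2)) => //; [exact: Cinf_snd|exact: Cinf_cst].
rewrite (_ : mdist2 a = (fun z => (z.1 - a.1) * (z.1 - a.1) + (z.2 - a.2) * (z.2 - a.2))).
  by apply: CinfD => //; apply: CinfM.
by apply/funext => z; rewrite /mdist2 !expr2.
Qed.

(* The squared modulus of the Moebius transformation [moebius a]. *)
Definition mratio a z : R := mdist2 a z / mden a z.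

Lemma Cinf_mratio a : disk a -> Cinf (mdom a) (mratio a).
Proof.
move=> Da; apply: Cinf_div => //; first exact: open_mdom.
  exact: CinfS (Cinf_mdist2 a).
exact: CinfS (Cinf_mden a).
Qed.

Lemma mratio_lt1 a z : disk a -> disk z -> mratio a z < 1.
Proof.
by move=> Da Dz; rewrite /mratio -sqn_moebius//; apply/disk_sqn; exact: moebius_disk.
Qed.

Lemma mden_inv_bounded a : disk a -> exists2 B : R, 0 < B &
  forall z, disk z -> (mden a z)^-1 <= B.
Proof.
move=> Da; have [oU _] := mdom_nbhs Da.
have sI : Cinf (mdom a) (fun z => (mden a z)^-1).
  apply: (@Cinf_comp1 _ _ _ [set x | x != 0]) => //; last exact: Cinf_inv.
  exact: CinfS (Cinf_mden a).
have [_ [C hC]] := Cinf_mbounded (mdom_nbhs Da) sI.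
exists (`|C| + 1); first by rewrite ltr_wpDl.
move=> z Dz; rewrite (le_trans (ler_norm _))// (le_trans (hC z Dz))//.
by rewrite (le_trans (ler_norm _))// lerDl.
Qed.

(* [mratio a] tends to [1] at the unit circle. *)
Lemma mratio_compact a c : disk a -> c < 1 -> exists2 rho : R, rho < 1 &
  forall z, disk z -> mratio a z <= c -> sqn z <= rho.
Proof.
move=> Da c1; have [B B0 hB] := mden_inv_bounded Da.
exists (1 - (1 - c) / B); first by rewrite gtrBl divr_gt0// subr_gt0.
move=> z Dz mc; have m0 := mden_gt0 Da Dz; have n0 := lt0r_neq0 m0.
move: (Da) (Dz) => /disk_sqn a1 /disk_sqn z1.
rewrite lerBrDr -lerBrDl ler_pdivrMr//.
have h : 1 - mratio a z = (1 - sqn a) * (1 - sqn z) * (mden a z)^-1.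
  by rewrite /mratio; apply: (mulIf n0); rewrite mulrBl mul1r !divfK// mden_mdist2; ring.
have : 1 - c <= (1 - sqn a) * (1 - sqn z) * (mden a z)^-1 by rewrite -h lerB.
move=> /le_trans; apply.
rewrite ler_pM ?invr_ge0 ?(ltW m0)//; last exact: hB.
  by rewrite mulr_ge0 ?subr_ge0 ?ltW.
by rewrite ler_piMl ?subr_ge0 ?(ltW z1)// gerBl sqn_ge0.
Qed.

End ClosedDisk.

(** * Truncated Green functions as limits of test functions *)

Section TruncatedGreen.
Context {R : realType}.
Local Notation plane := (measurableTypeR R * measurableTypeR R)%type.
Local Notation mu := (@plane_measure R).
Variables (a : R * R) (c : R).
Hypotheses (Da : disk a) (c0 : 0 < c) (c1 : c < 1).
Implicit Types (z e : R * R) (k : R).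

(* [green0_trunc (sqrt c)] composed with an isometry of the disk that maps [a] to [0]. *)
Definition trunc_green z : R := - ln (maxr c (mratio a z)) / 2.
(* On the circle [mratio a z = c] the value is the limit of ['D_e (smooth_green k) z]. *)
Definition trunc_green_derive e z : R :=
  - ((c <= mratio a z)%R%:R * 'D_e (mratio a) z / maxr c (mratio a z)) / 2.
Definition smooth_green k z : R := - ln (smax k c (mratio a z)) / 2.

Lemma Cinf_smooth_green k : 0 < k -> 4 <= k * c -> Cinf (mdom a) (smooth_green k).
Proof.
move=> k0 kc; have oU := open_mdom Da.
rewrite (_ : smooth_green k = (fun z => (- 2^-1) * (@ln R \o (smax k c \o mratio a)) z)); last first.
  by apply/funext => z; rewrite /smooth_green /= mulNr mulNr mulrC.
apply: CinfZ => //.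
apply: (@Cinf_comp1 _ _ _ [set x | 0 < x]) => //; last exact: Cinf_ln.
  by move=> z _ /=; exact: smax_gt0.
apply: (@Cinf_comp1 _ _ _ setT) => //; [exact: Cinf_mratio|exact: Cinf_smax].
Qed.

Lemma derive_smooth_green k e z : 0 < k -> 4 <= k * c -> mdom a z ->
  'D_e (smooth_green k) z =
  - ('D_1 (smax k c) (mratio a z) * 'D_e (mratio a) z / smax k c (mratio a z)) / 2.
Proof.
move=> k0 kc Uz; have p0 := smax_gt0 (mratio a z) k0 kc.
have dm : differentiable (mratio a) z by exact: Cinf_differentiable (Cinf_mratio Da) Uz.
have ds : differentiable (smax k c) (mratio a z) by exact: Cinf_differentiable (Cinf_smax k c) _.
have dl : differentiable (@ln R) (smax k c (mratio a z)).
  by apply/derivable1_diffP; have [] := is_derive1_ln p0.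
have dsm : differentiable (smax k c \o mratio a) z by exact: differentiable_comp.
have h : is_derive z e (@ln R \o (smax k c \o mratio a))
    ('D_1 (smax k c) (mratio a z) * 'D_e (mratio a) z / smax k c (mratio a z)).
  split; first by apply/diff_derivable; exact: differentiable_comp.
  rewrite derive_comp1// derive_comp1//=.
  by have [_ ->] := is_derive1_ln p0; rewrite [X in X * _]mulrC.
have [_ E] := is_deriveZ (- 2^-1) h.
rewrite (_ : smooth_green k = (- 2^-1) \*: (@ln R \o (smax k c \o mratio a))); last first.
  by apply/funext => y; rewrite /smooth_green /= mulNr /GRing.scale /= mulNr mulrC.
by rewrite E /GRing.scale /= !mulNr mulrC.
Qed.

Lemma cvg_smooth_green (N : nat) z :
  smooth_green (n + N).+1%:R z @[n --> \oo] --> trunc_green z.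
Proof.
apply: cvgM; last exact: cvg_cst.
apply: cvgN; apply: continuous_cvg; last exact: cvg_smax.
by apply: continuous_ln; rewrite lt_max c0.
Qed.

Lemma cvg_derive_smooth_green (N : nat) e z : 4 <= N%:R * c -> disk z ->
  'D_e (smooth_green (n + N).+1%:R) z @[n --> \oo] --> trunc_green_derive e z.
Proof.
move=> Nc Dz; have Uz := nbhs_disk_sub (mdom_nbhs Da) Dz.
have kc n : 4 <= (n + N).+1%:R * c.
  by rewrite (le_trans Nc)// ler_pM2r// ler_nat leqW// leq_addl.
under eq_fun do rewrite derive_smooth_green//.
apply: cvgM; last exact: cvg_cst.
apply: cvgN; apply: cvgM.
  by apply: cvgM; [exact: cvg_derive_smax|exact: cvg_cst].
by apply: cvgV; [rewrite gt_eqF// lt_max c0|exact: cvg_smax].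
Qed.

(** The bound is uniform in [k], which is what dominated convergence needs: [smax] stays above
    [c / 2] and its slope is bounded independently of [k]. *)
Lemma smooth_green_bounds : exists2 C : R, 0 < C &
  forall k z, 0 < k -> 4 <= k * c -> disk z ->
  [/\ 0 <= smooth_green k z, smooth_green k z <= C,
   `|'D_e1 (smooth_green k) z| <= C & `|'D_e2 (smooth_green k) z| <= C].
Proof.
have [C C0 hC] := @derive_smax_bounded R.
have [_ [B1 hB1]] := Cinf_mbounded (mdom_nbhs Da) (Cinf_derive e1 (Cinf_mratio Da)).
have [_ [B2 hB2]] := Cinf_mbounded (mdom_nbhs Da) (Cinf_derive e2 (Cinf_mratio Da)).
have c20 : 0 < c / 2 by rewrite divr_gt0.
pose L := - ln (c / 2) / 2.
have L0 : 0 <= L.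
  have h : c / 2 <= 1 by rewrite ler_pdivrMr// mul1r (le_trans (ltW c1))// ler1n.
  by rewrite /L divr_ge0// oppr_ge0 ln_le0.
pose B := `|B1| + `|B2|; have B0 : 0 <= B by rewrite addr_ge0.
have K0 : 0 <= C * B / (c / 2) by rewrite !mulr_ge0 ?invr_ge0// ltW.
exists (L + C * B / (c / 2) + 1); first by rewrite ltr_wpDl// addr_ge0.
move=> k z k0 kc Dz; have Uz := nbhs_disk_sub (mdom_nbhs Da) Dz.
have s0 := smax_gt0 (mratio a z) k0 kc.
have sh := smax_ge_half (mratio a z) k0 kc.
have s1 : smax k c (mratio a z) <= 1.
  rewrite (le_trans (smax_le _ _ k0))// ge_max (ltW c1) /= ltW//.
  exact: mratio_lt1.
have dB e b : `|'D_e (mratio a) z| <= b -> b <= B ->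
    `|'D_e (smooth_green k) z| <= L + C * B / (c / 2) + 1.
  move=> h1 h2; rewrite derive_smooth_green// normrM normrN normrM normrM !normfV.
  have -> : `|2 : R| = 2 by rewrite ger0_norm.
  rewrite (gtr0_norm s0).
  have q0 : 0 <= `|'D_1 (smax k c) (mratio a z)| * `|'D_e (mratio a) z| / smax k c (mratio a z).
    by rewrite !mulr_ge0// invr_ge0 ltW.
  have q1 : `|'D_1 (smax k c) (mratio a z)| * `|'D_e (mratio a) z| / smax k c (mratio a z)
      <= C * B / (c / 2).
    apply: ler_pM; rewrite ?mulr_ge0 ?invr_ge0 ?(ltW s0)//.
      by apply: ler_pM => //; [apply: hC; rewrite gt_eqF|exact: le_trans h2].
    by rewrite lef_pV2 ?posrE.
  by lra.
split.
- by rewrite /smooth_green divr_ge0// oppr_ge0 ln_le0.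
- have lh : ln (c / 2) <= ln (smax k c (mratio a z)) by rewrite ler_ln ?posrE.
  by rewrite /smooth_green; rewrite /L in L0 *; lra.
- by apply: dB (hB1 z Dz) _; rewrite /B (le_trans (ler_norm _))// lerDl.
- by apply: dB (hB2 z Dz) _; rewrite /B (le_trans (ler_norm _))// lerDr.
Qed.

(** [smooth_green k] is not compactly supported in the disk. Applying [rampk k] to its value removes
    the part below [1 / k], which contains a neighbourhood of the unit circle; outside the disk the
    formula is replaced by 0. *)
Definition cutoff_green k z : R :=
  if `[< disk z >] then rampk k (smooth_green k z) else 0.

Lemma cutoff_greenE k z : disk z -> cutoff_green k z = rampk k (smooth_green k z).
Proof. by rewrite /cutoff_green => Dz; rewrite asboolT. Qed.

Lemma test_cutoff_green k : 0 < k -> 4 <= k * c -> test_function (cutoff_green k).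
Proof.
move=> k0 kc; have oD := @open_disk R.
(* Where [mratio a z] exceeds this threshold, [smooth_green k z <= 1 / k] and [rampk k] vanishes. *)
have q1 : expR (- (k^-1 *+ 2)) < 1.
  by rewrite -expR0 ltr_expR oppr_lt0 mulrn_wgt0// invr_gt0.
have [rho r1 hr] := mratio_compact Da q1.
apply: (Cinf_test (compact_closed_disk (ltW r1))).
- by move=> z /= h; apply/disk_sqn; exact: le_lt_trans r1.
- apply: (Cinf_ext (f := rampk k \o smooth_green k)) => //.
    by move=> z; rewrite inE => Dz; rewrite cutoff_greenE.
  apply: (@Cinf_comp1 _ _ _ setT) => //; last exact: Cinf_rampk.
  apply: CinfS (Cinf_smooth_green k0 kc); exact: nbhs_disk_sub (mdom_nbhs Da).
move=> z /= hz; rewrite /cutoff_green; case: asboolP => // Dz.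
apply: rampk_eq0; rewrite -ler_pdivlMl// mulr1.
have mq : expR (- (k^-1 *+ 2)) < mratio a z.
  by rewrite ltNge; apply/negP => h; apply: hz; exact: hr.
have m0 : 0 < mratio a z by exact: lt_trans (expR_gt0 _) mq.
have lm : - (k^-1 *+ 2) <= ln (smax k c (mratio a z)).
  rewrite -(expRK (- _)) ler_ln ?posrE ?expR_gt0 ?smax_gt0//.
  by rewrite (le_trans (ltW mq))// smax_ge.
by rewrite /smooth_green; lra.
Qed.

Lemma derive_cutoff_green k e z : 0 < k -> 4 <= k * c -> disk z ->
  'D_e (cutoff_green k) z = 'D_1 ramp (k * smooth_green k z) * 'D_e (smooth_green k) z.
Proof.
move=> k0 kc Dz; have oD := @open_disk R.
have Uz := nbhs_disk_sub (mdom_nbhs Da) Dz.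
rewrite (@near_eq_derive _ _ _ _ (rampk k \o smooth_green k)); last first.
  by apply: filterS (open_nbhs_nbhs (conj oD Dz)) => y Dy; rewrite cutoff_greenE.
rewrite derive_comp1.
- by rewrite derive_rampk ?gt_eqF// mulrC.
- exact: Cinf_differentiable (Cinf_smooth_green k0 kc) Uz.
- exact: Cinf_differentiable (Cinf_rampk k) _.
Qed.

Lemma trunc_green_gt0 z : disk z -> 0 < trunc_green z.
Proof.
move=> Dz; rewrite /trunc_green divr_gt0// oppr_gt0 ln_lt0//.
by rewrite lt_max c0 /= gt_max c1 mratio_lt1.
Qed.

Lemma trunc_green_limit :
  test_limit trunc_green (trunc_green_derive e1) (trunc_green_derive e2).
Proof.
have [N Nc] : exists N : nat, 4 <= N%:R * c.
  exists (Num.bound (4 / c)); rewrite -ler_pdivrMr// ltW//.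
  by rewrite archi_boundP// divr_ge0// ltW.
have kc n : 4 <= (n + N).+1%:R * c.
  by rewrite (le_trans Nc)// ler_pM2r// ler_nat leqW// leq_addl.
have [C C0 hC] := smooth_green_bounds.
have [C' C'0 hC'] := @dramp_bounded R.
(* At a fixed point the limit is positive, so the cutoff eventually acts as the identity there, with
   slope 1. *)
have big z : disk z -> \forall n \near \oo, 2 < (n + N).+1%:R * smooth_green (n + N).+1%:R z.
  move=> Dz; have g0 := trunc_green_gt0 Dz.
  have h2 : trunc_green z / 2 < trunc_green z by lra.
  near=> n.
  have h : trunc_green z / 2 < smooth_green (n + N).+1%:R z.
    by near: n; exact: (cvgr_gt _ (@cvg_smooth_green N z) _ h2).
  have h' : 2 / (trunc_green z / 2) < (n + N).+1%:R.
    rewrite (@lt_le_trans _ _ n%:R) ?ler_nat ?leqW ?leq_addr//.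
    by near: n; exact: nbhs_infty_gtr.
  rewrite ltr_pdivrMr in h'; last by rewrite divr_gt0.
  by rewrite (lt_trans h')// ltr_pM2l.
exists (fun n => cutoff_green (n + N).+1%:R), (C + C' * C); split.
- by move=> n; exact: test_cutoff_green.
- move=> n z Dz; have [h1 h2 h3 h4] := hC (n + N).+1%:R z (ltr0Sn _ _) (kc n) Dz.
  have CC : 0 <= C' * C by rewrite mulr_ge0// ltW.
  split.
  + rewrite cutoff_greenE// ger0_norm ?rampk_ge0//.
    by rewrite (le_trans (rampk_le _ _))// (le_trans h2)// lerDl.
  + rewrite derive_cutoff_green// normrM (le_trans (ler_pM _ _ (hC' _) h3))//.
    by rewrite lerDr ltW.
  + rewrite derive_cutoff_green// normrM (le_trans (ler_pM _ _ (hC' _) h4))//.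
    by rewrite lerDr ltW.
- move=> z Dz; split.
  + apply: cvg_trans (@cvg_smooth_green N z); apply: near_eq_cvg.
    near=> n; rewrite cutoff_greenE// rampk_id// ltW//.
    by near: n; exact: big.
  + apply: cvg_trans (@cvg_derive_smooth_green N e1 z Nc Dz); apply: near_eq_cvg.
    near=> n; rewrite derive_cutoff_green// dramp_eq1 ?mul1r//.
    by near: n; exact: big.
  + apply: cvg_trans (@cvg_derive_smooth_green N e2 z Nc Dz); apply: near_eq_cvg.
    near=> n; rewrite derive_cutoff_green// dramp_eq1 ?mul1r//.
    by near: n; exact: big.
Unshelve. all: by end_near. Qed.

End TruncatedGreen.

(** * The Laplacian and Green's identities *)

Section Laplacian.
Context {R : realType}.
Local Notation plane := (measurableTypeR R * measurableTypeR R)%type.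
Local Notation mu := (@plane_measure R).
Implicit Types (a z v e : R * R) (u f g h p q theta : R * R -> R).

Definition laplacian u z : R := 'D_e1 ('D_e1 u) z + 'D_e2 ('D_e2 u) z.

Lemma Cinf_laplacian U u : open U -> Cinf U u -> Cinf U (laplacian u).
Proof.
by move=> oU su; apply: CinfD => //; do 2?apply: Cinf_derive.
Qed.

Lemma eq_on_laplacian U f u : open U -> {in U, f =1 u} -> {in U, laplacian f =1 laplacian u}.
Proof.
move=> oU fu z zU; exact: (f_equal2 +%R
  (eq_on_derive e1 oU (eq_on_derive e1 oU fu) zU)
  (eq_on_derive e2 oU (eq_on_derive e2 oU fu) zU)).
Qed.

Lemma second_derive_cst (c : R) v z : 'D_v ('D_v (cst c)) z = 0.
Proof.
have -> : 'D_v (cst c) = cst 0 :> (R * R -> R) by apply/funext => y; exact: derive_cst.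
exact: derive_cst.
Qed.

Lemma laplacian_cst (c : R) z : laplacian (cst c) z = 0.
Proof. exact: etrans (f_equal2 +%R (second_derive_cst c e1 z) (second_derive_cst c e2 z)) (addr0 _). Qed.

Lemma second_deriveD U f g v z : open U -> Cinf U f -> Cinf U g -> U z ->
  'D_v ('D_v (f \+ g)) z = 'D_v ('D_v f) z + 'D_v ('D_v g) z.
Proof.
move=> oU sf sg Uz.
have D (f' g' : R * R -> R) : Cinf U f' -> Cinf U g' ->
    {in U, 'D_v (f' \+ g') =1 'D_v f' \+ 'D_v g'}.
  move=> sf' sg' y; rewrite inE => Uy; rewrite [LHS]deriveD//.
    by apply/diff_derivable; exact: Cinf_differentiable sf' Uy.
  by apply/diff_derivable; exact: Cinf_differentiable sg' Uy.
have zU : z \in U by rewrite inE.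
exact: etrans (eq_on_derive v oU (D f g sf sg) zU)
  (D _ _ (Cinf_derive v sf) (Cinf_derive v sg) z zU).
Qed.

Lemma laplacianD U f g z : open U -> Cinf U f -> Cinf U g -> U z ->
  laplacian (f \+ g) z = laplacian f z + laplacian g z.
Proof.
move=> oU sf sg Uz; exact: etrans (f_equal2 +%R (second_deriveD e1 oU sf sg Uz)
  (second_deriveD e2 oU sf sg Uz)) (addrACA _ _ _ _).
Qed.

Lemma integral_disk_add u f : mbounded u -> mbounded f ->
  \int[mu]_(z in disk) (u z + f z) = \int[mu]_(z in disk) u z + \int[mu]_(z in disk) f z.
Proof.
move=> bu bf; rewrite RintegralD//; [exact: measurable_disk|exact: mbounded_integrable|exact: mbounded_integrable].
Qed.

Lemma integral_limit_by_parts e (f_ : nat -> R * R -> R) (C : R) f p g h :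
  (forall n, test_function (f_ n)) ->
  (forall n z, disk z -> `|f_ n z| <= C) ->
  (forall n z, disk z -> `|'D_e (f_ n) z| <= C) ->
  (forall z, disk z -> f_ n z @[n --> \oo] --> f z) ->
  (forall z, disk z -> 'D_e (f_ n) z @[n --> \oo] --> p z) ->
  mbounded g -> mbounded h ->
  (forall phi, test_function phi ->
    \int[mu]_(z in disk) ('D_e phi z * g z) = - \int[mu]_(z in disk) (phi z * h z)) ->
  \int[mu]_(z in disk) (p z * g z) = - \int[mu]_(z in disk) (f z * h z).
Proof.
move=> tf fC dC ff fp bg bh gh; have [_ [B1 h1]] := bg; have [_ [B2 h2]] := bh.
have c1 : \int[mu]_(z in disk) ('D_e (f_ n) z * g z) @[n --> \oo] -->
    \int[mu]_(z in disk) (p z * g z).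
  apply: (@Rintegral_disk_cvg _ _ _ (C * B1)) => [n|z Dz|n z Dz].
  - by apply: mboundedM => //; apply: mbounded_test; exact: test_derive.
  - by apply: cvgM; [exact: fp|exact: cvg_cst].
  - by rewrite normrM ler_pM// ?dC ?h1.
have c2 : (- \int[mu]_(z in disk) (f_ n z * h z)) @[n --> \oo] -->
    (- \int[mu]_(z in disk) (f z * h z)).
  apply: cvgN; apply: (@Rintegral_disk_cvg _ _ _ (C * B2)) => [n|z Dz|n z Dz].
  - by apply: mboundedM => //; exact: mbounded_test.
  - by apply: cvgM; [exact: ff|exact: cvg_cst].
  - by rewrite normrM ler_pM// ?fC ?h2.
have E : (fun n => \int[mu]_(z in disk) ('D_e (f_ n) z * g z)) =
    (fun n => - \int[mu]_(z in disk) (f_ n z * h z)).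
  by apply/funext => n; exact: gh.
rewrite E in c1; exact: (cvg_unique (@norm_hausdorff _ _) c1 c2).
Qed.

Lemma test_limit_by_parts f p q (g1 g2 h1 h2 : R * R -> R) : test_limit f p q ->
  mbounded g1 -> mbounded h1 -> mbounded g2 -> mbounded h2 ->
  (forall phi, test_function phi ->
    \int[mu]_(z in disk) ('D_e1 phi z * g1 z) = - \int[mu]_(z in disk) (phi z * h1 z)) ->
  (forall phi, test_function phi ->
    \int[mu]_(z in disk) ('D_e2 phi z * g2 z) = - \int[mu]_(z in disk) (phi z * h2 z)) ->
  \int[mu]_(z in disk) (p z * g1 z + q z * g2 z) =
  - \int[mu]_(z in disk) (f z * (h1 z + h2 z)).
Proof.
move=> lf bg1 bh1 bg2 bh2 p1 p2.
have [bf bp bq] := test_limit_mbounded lf; have [phi [C [tphi bphi cphi]]] := lf.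
have E1 : \int[mu]_(z in disk) (p z * g1 z) = - \int[mu]_(z in disk) (f z * h1 z).
  by apply: (@integral_limit_by_parts e1 phi C) => //;
    [move=> n z /(bphi n)[]|move=> n z /(bphi n)[]|move=> z /cphi[]|move=> z /cphi[]].
have E2 : \int[mu]_(z in disk) (q z * g2 z) = - \int[mu]_(z in disk) (f z * h2 z).
  by apply: (@integral_limit_by_parts e2 phi C) => //;
    [move=> n z /(bphi n)[]|move=> n z /(bphi n)[]|move=> z /cphi[]|move=> z /cphi[]].
rewrite (integral_disk_add (mboundedM bp bg1) (mboundedM bq bg2)) E1 E2 -opprD.
rewrite -(integral_disk_add (mboundedM bf bh1) (mboundedM bf bh2)).
by congr (- _); apply: eq_Rintegral => z _; rewrite mulrDr.
Qed.

Lemma integral_derive_test e u :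
  (forall psi, test_function psi -> \int[mu]_(z in disk) 'D_e psi z = 0) ->
  Cinf disk u -> forall phi, test_function phi ->
  \int[mu]_(z in disk) ('D_e phi z * u z) = - \int[mu]_(z in disk) (phi z * 'D_e u z).
Proof.
move=> int0 su phi tphi; under eq_Rintegral do rewrite mulrC.
rewrite (integral_test_by_parts int0 su tphi).
by congr (- _); apply: eq_Rintegral => z _; rewrite mulrC.
Qed.

(** There is no boundary term because [f] is a limit of test functions; [u] itself need not vanish
    at the unit circle. *)
Lemma weak_gradient_smooth f p q U u : test_limit f p q -> nbhs_disk U -> Cinf U u ->
  \int[mu]_(z in disk) (p z * 'D_e1 u z + q z * 'D_e2 u z) =
  - \int[mu]_(z in disk) (f z * laplacian u z).
Proof.
move=> lf DU su; have UD := nbhs_disk_sub DU.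
have s1 := Cinf_derive e1 su; have s2 := Cinf_derive e2 su.
exact: (test_limit_by_parts lf
  (Cinf_mbounded DU s1) (Cinf_mbounded DU (Cinf_derive e1 s1))
  (Cinf_mbounded DU s2) (Cinf_mbounded DU (Cinf_derive e2 s2))
  (integral_derive_test (@integral_test_derive_e1 R) (CinfS UD s1))
  (integral_derive_test (@integral_test_derive_e2 R) (CinfS UD s2))).
Qed.

Lemma second_derive_symmetric e u theta :
  (forall psi, test_function psi -> \int[mu]_(z in disk) 'D_e psi z = 0) ->
  Cinf disk u -> test_function theta ->
  \int[mu]_(z in disk) (u z * 'D_e ('D_e theta) z) =
  \int[mu]_(z in disk) ('D_e ('D_e u) z * theta z).
Proof.
move=> int0 su tt.
rewrite (integral_test_by_parts int0 su (test_derive e tt)).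
by rewrite (integral_test_by_parts int0 (Cinf_derive e su) tt) opprK.
Qed.

Lemma laplacian_symmetric u theta : Cinf disk u -> test_function theta ->
  \int[mu]_(z in disk) (u z * laplacian theta z) =
  \int[mu]_(z in disk) (laplacian u z * theta z).
Proof.
move=> su tt.
have bt e : mbounded (fun z => u z * 'D_e ('D_e theta) z).
  by apply: mbounded_test; apply: test_mul => //; do 2?apply: test_derive.
have bu e : mbounded (fun z => 'D_e ('D_e u) z * theta z).
  by apply: mbounded_test; apply: test_mul => //; do 2?apply: Cinf_derive.
have L : \int[mu]_(z in disk) (u z * laplacian theta z) =
    \int[mu]_(z in disk) (u z * 'D_e1 ('D_e1 theta) z + u z * 'D_e2 ('D_e2 theta) z).
  by apply: eq_Rintegral => z _; exact: mulrDr.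
have L' : \int[mu]_(z in disk) (laplacian u z * theta z) =
    \int[mu]_(z in disk) ('D_e1 ('D_e1 u) z * theta z + 'D_e2 ('D_e2 u) z * theta z).
  by apply: eq_Rintegral => z _; exact: mulrDl.
have E : \int[mu]_(z in disk) (u z * 'D_e1 ('D_e1 theta) z + u z * 'D_e2 ('D_e2 theta) z) =
    \int[mu]_(z in disk) ('D_e1 ('D_e1 u) z * theta z + 'D_e2 ('D_e2 u) z * theta z).
  exact: etrans (integral_disk_add (bt e1) (bt e2)) (etrans (f_equal2 +%R
    (second_derive_symmetric (@integral_test_derive_e1 R) su tt)
    (second_derive_symmetric (@integral_test_derive_e2 R) su tt))
    (esym (integral_disk_add (bu e1) (bu e2)))).
exact: etrans L (etrans E (esym L')).
Qed.

End Laplacian.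


(** * A logarithmic pole smoothed at a small scale *)

Section RegularizedPole.
Context {R : realType}.
Local Notation plane := (measurableTypeR R * measurableTypeR R)%type.
Local Notation mu := (@plane_measure R).
Local Notation leb := (@lebesgue_measure R).
Implicit Types (a z : R * R) (k s t : R).

(** Constant for [t <= 2] and exactly [- ln t / 2] for [t >= 3], hence smooth on the whole line. *)
Definition flatlog t : R := - ln (smax 1 4 t) / 2.

Lemma smax14_gt0 t : 0 < smax 1 4 t :> R.
Proof. by apply: smax_gt0; rewrite ?mul1r. Qed.

Lemma Cinf_flatlog : Cinf [set: R] flatlog.
Proof.
have oT := @openT R.
rewrite (_ : flatlog = (fun t => (- 2^-1) * (@ln R \o smax 1 4) t)); last first.
  by apply/funext => t; rewrite /flatlog /= !mulNr mulrC.
apply: CinfZ => //; apply: (@Cinf_comp1 _ _ _ [set x | 0 < x]) => //.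
- by move=> x _; exact: smax14_gt0.
- exact: (@Cinf_smax R 1 4).
- exact: Cinf_ln.
Qed.

Lemma flatlogE t : 3 <= t -> flatlog t = - ln t / 2.
Proof. by move=> h; rewrite /flatlog smax_id//; lra. Qed.

Lemma derive_flatlog t : 3 < t -> 'D_1 flatlog t = - (2 * t)^-1.
Proof.
move=> h; have t0 : 0 < t by lra.
rewrite (@near_eq_derive _ _ _ _ ((- 2^-1) \*: @ln R)); last first.
  have : \forall y \near t, 3 < y by exact: lt_nbhsr.
  apply: filterS => y y3.
  by transitivity (- 2^-1 * ln y) => //; rewrite flatlogE ?ltW//; ring.
have [_ E] := is_deriveZ (- 2^-1) (is_derive1_ln t0).
by rewrite E /GRing.scale /= invfM mulNr.
Qed.

(** The planar Laplacian of a radial function, written in the variable [t = |z|^2] and divided by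
    4. *)
Definition flatlog_lap t : R := t * 'D_1 ('D_1 flatlog) t + 'D_1 flatlog t.

Lemma flatlog_lap_eq0 t : 3 < t -> flatlog_lap t = 0.
Proof.
move=> h; have t0 : 0 < t by lra.
have n0 := lt0r_neq0 t0.
rewrite /flatlog_lap derive_flatlog//.
have -> : 'D_1 ('D_1 flatlog) t = (2 * t ^+ 2)^-1.
  rewrite (@near_eq_derive _ _ _ _ ((- 2^-1) \*: @GRing.inv R)); last first.
    have : \forall y \near t, 3 < y by exact: lt_nbhsr.
    apply: filterS => y y3.
    by transitivity (- 2^-1 * y^-1) => //; rewrite derive_flatlog// invfM mulNr.
  have di : is_derive t 1 (@GRing.inv R) (- (t^-1 * t^-1)).
    by rewrite -derive_inv//; apply/derivableP/diff_derivable/differentiable_Rinv.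
  have [_ E] := is_deriveZ (- 2^-1) di.
  by rewrite E /GRing.scale /=; field.
by field.
Qed.

Lemma flatlog_lap_bounded : exists2 C : R, 0 <= C & forall t, 0 <= t -> `|flatlog_lap t| <= C.
Proof.
have s1 := Cinf_derive (1:R) Cinf_flatlog; have s2 := Cinf_derive (1:R) s1.
have cf t : {for t, continuous flatlog_lap}.
  apply: continuousD; last exact: Cinf_continuous s1 _.
  by apply: continuousM; [exact: cvg_id|exact: Cinf_continuous s2 _].
have [C C0 hC] := continuous_compact_bounded (@segment_compact R 0 4) (fun t _ => cf t).
exists C => // t t0; have [h|h] := leP t 4.
  by apply: hC; rewrite /= in_itv /= t0.
by rewrite flatlog_lap_eq0 ?normr0//; lra.
Qed.

Definition pole k a z : R := flatlog (k * mdist2 a z).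

Lemma Cinf_pole k a : Cinf [set: R * R] (pole k a).
Proof.
have oT := @openT (R * R)%type.
apply: (@Cinf_comp1 _ _ _ setT (fun z => k * mdist2 a z)) => //; last exact: Cinf_flatlog.
by apply: CinfZ => //; exact: Cinf_mdist2.
Qed.

Lemma is_derive_mdist2 a z (v : R * R) :
  is_derive z v (mdist2 a) ((v.1 * (z.1 - a.1) + v.2 * (z.2 - a.2)) * 2).
Proof.
have x1 := is_derive_sub (is_derive_fst z v) (is_derive_const a.1 z v).
have x2 := is_derive_sub (is_derive_snd z v) (is_derive_const a.2 z v).
have h := is_derive_add (is_derive_mul x1 x1) (is_derive_mul x2 x2).
rewrite (_ : mdist2 a = (fun z => (z.1 - a.1) * (z.1 - a.1) + (z.2 - a.2) * (z.2 - a.2))).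
  by apply: (is_derive_eq h); ring.
by apply/funext => y; rewrite /mdist2 !expr2.
Qed.

Lemma is_derive_comp_mdist2 (h : R -> R) k a z (v : R * R) : Cinf [set: R] h ->
  is_derive z v (fun y => h (k * mdist2 a y))
   (k * ((v.1 * (z.1 - a.1) + v.2 * (z.2 - a.2)) * 2) * 'D_1 h (k * mdist2 a z)).
Proof.
move=> sh.
have sm : Cinf [set: R * R] (fun y => k * mdist2 a y).
  by apply: CinfZ; [exact: openT|exact: Cinf_mdist2].
have dm : differentiable (fun y => k * mdist2 a y) z by exact: Cinf_differentiable sm _.
have dh : differentiable h (k * mdist2 a z) by exact: Cinf_differentiable sh _.
split; first by apply/diff_derivable; exact: (@differentiable_comp _ _ _ _ (fun y => k * mdist2 a y) h).
rewrite (@derive_comp1 _ _ (fun y => k * mdist2 a y) h)//; congr (_ * _).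
have E := is_derive_mul (is_derive_const k z v) (is_derive_mdist2 a z v).
by have [_ ->] := E; rewrite mulr0 addr0.
Qed.

Lemma derive_pole k a (v z : R * R) : 'D_v (pole k a) z =
  (2 * k) * (v.1 * (z.1 - a.1) + v.2 * (z.2 - a.2)) * 'D_1 flatlog (k * mdist2 a z).
Proof.
have [_ E] := is_derive_comp_mdist2 k a z v Cinf_flatlog.
by rewrite [LHS]E; ring.
Qed.

Lemma second_derive_pole k a (v z : R * R) : 'D_v ('D_v (pole k a)) z =
  (2 * k) * ((v.1 ^+ 2 + v.2 ^+ 2) * 'D_1 flatlog (k * mdist2 a z) +
    (v.1 * (z.1 - a.1) + v.2 * (z.2 - a.2)) ^+ 2 * (2 * k) *
      'D_1 ('D_1 flatlog) (k * mdist2 a z)).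
Proof.
have sf := Cinf_derive (1:R) Cinf_flatlog.
have x1 := is_derive_sub (is_derive_fst z v) (is_derive_const a.1 z v).
have x2 := is_derive_sub (is_derive_snd z v) (is_derive_const a.2 z v).
have d1 := is_derive_mul (is_derive_const (2 * k) z v)
  (is_derive_add (is_derive_mul (is_derive_const v.1 z v) x1)
     (is_derive_mul (is_derive_const v.2 z v) x2)).
have [_ E] := is_derive_mul d1 (is_derive_comp_mdist2 k a z v sf).
apply: etrans (congr1 (fun F : R * R -> R => 'D_v F z) (funext (derive_pole k a v))) _.
by apply: (etrans E); ring.
Qed.

Lemma laplacian_pole k a z : laplacian (pole k a) z = 4 * k * flatlog_lap (k * mdist2 a z).
Proof.
apply: etrans (f_equal2 +%R (second_derive_pole k a e1 z) (second_derive_pole k a e2 z)) _.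
rewrite /flatlog_lap /e1 /e2 /=.
generalize ('D_1 ('D_1 flatlog) (k * mdist2 a z)) ('D_1 flatlog (k * mdist2 a z)) => A B.
by rewrite /mdist2; ring.
Qed.

(** The flux through two opposite sides of a square of half-side [s]: each is seen from the centre
    under the angle pi / 2. *)
Lemma integral_atan_kernel (b s : R) : 0 < s ->
  (\int[leb]_(y in `[(b - s)%R, (b + s)%R]) (- (2 * s) / (s ^+ 2 + (y - b) ^+ 2))%:E = (- pi)%:E)%E.
Proof.
move=> s0; have n0 := lt0r_neq0 s0.
have d0 (y : R) : 0 < s ^+ 2 + (y - b) ^+ 2 by rewrite ltr_pwDl ?exprn_gt0// sqr_ge0.
have ab : b - s < b + s by lra.
apply: (etrans (@FTC_everywhere _ (fun y => -2 * atan ((y - b) / s))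
  (fun y => - (2 * s) / (s ^+ 2 + (y - b) ^+ 2)) _ _ ab _ _)); last first.
- have -> : (b + s - b) / s = 1 by rewrite addrAC subrr add0r mulfV.
  have -> : (b - s - b) / s = -1 by rewrite addrAC subrr add0r mulNr mulfV.
  by rewrite atanN atan1; congr (_%:E); field.
- move=> y _; apply: continuousM; first exact: cvg_cst.
  apply: continuousV; first by rewrite gt_eqF.
  apply: continuousD; first exact: cvg_cst.
  by apply: continuousM; apply: continuousB; do ?[exact: cvg_id|exact: cvg_cst].
- move=> y _.
  have dl : is_derive y 1 (fun y : R => (y - b) / s) s^-1.
    have h := is_derive_mul (is_derive_sub (is_derive_id y 1) (is_derive_const b y 1))
      (is_derive_const s^-1 y 1).
    by apply: (is_derive_eq h); rewrite mulr0 add0r subr0 mulr1.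
  have da := @is_derive1_comp _ (@atan R) (fun y : R => (y - b) / s) y _ _ (is_derive1_atan _) dl.
  have h := is_derive_mul (is_derive_const (-2 : R) y 1) da.
  apply: (is_derive_eq h); have := lt0r_neq0 (d0 y) => nd.
  rewrite mulr0 addr0; field; rewrite n0 /=.
  by rewrite -?expr2 nd.
Qed.

Definition square a s : set plane :=
  (`[a.1 - s, a.1 + s] `*` `[a.2 - s, a.2 + s])%classic.

Lemma mu_square a s : 0 < s -> mu (square a s) = (4 * s ^+ 2)%:E.
Proof.
move=> s0; rewrite [LHS]mu_rect; [congr (_%:E); ring|lra|lra].
Qed.

Lemma measurable_square a s : measurable (square a s).
Proof. exact: measurable_rect. Qed.

(* On the boundary of the square [pole k a] is the exact logarithm, and the flux of
   its gradient through each side is an arctangent integral. *)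
Lemma integral_square_laplacian_pole k a s : 0 < s -> k * s ^+ 2 = 4 ->
  \int[mu]_(z in square a s) laplacian (pole k a) z = - (2 * pi).
Proof.
move=> s0 ks; have k0 : 0 < k.
  by rewrite -(pmulr_lgt0 _ (exprn_gt0 2 s0)) ks.
have sp := Cinf_pole k a; have oT := @openT (R * R)%type.
have s1 := Cinf_derive e1 sp; have s2 := Cinf_derive e2 sp.
have ab1 : a.1 - s < a.1 + s by lra.
have ab2 : a.2 - s < a.2 + s by lra.
have big (x y : R) : s ^+ 2 <= mdist2 a (x, y) -> 'D_1 flatlog (k * mdist2 a (x, y)) =
    - (2 * k * mdist2 a (x, y))^-1.
  move=> h; rewrite derive_flatlog ?mulrA//.
  have := ler_wpM2l (ltW k0) h; rewrite ks; lra.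
have I1 : (\int[mu]_(z in square a s) ('D_e1 ('D_e1 (pole k a)) z)%:E = (- pi)%:E)%E.
  rewrite (integral_rect_derive_e1 ab1 ab2 s1) -(integral_atan_kernel a.2 s0).
  apply: eq_integral => y _; congr (_%:E); rewrite !derive_pole /e1 /= !mul1r !mul0r !addr0.
  have m1 : mdist2 a (a.1 + s, y) = s ^+ 2 + (y - a.2) ^+ 2 by rewrite /mdist2 /=; ring.
  have m2 : mdist2 a (a.1 - s, y) = s ^+ 2 + (y - a.2) ^+ 2 by rewrite /mdist2 /=; ring.
  have n0 : s ^+ 2 + (y - a.2) ^+ 2 != 0 by rewrite gt_eqF// ltr_pwDl ?exprn_gt0// sqr_ge0.
  rewrite !big; last 2 first.
  - by rewrite m2 lerDl sqr_ge0.
  - by rewrite m1 lerDl sqr_ge0.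
  by rewrite m1 m2; field; rewrite n0 gt_eqF.
have I2 : (\int[mu]_(z in square a s) ('D_e2 ('D_e2 (pole k a)) z)%:E = (- pi)%:E)%E.
  rewrite (integral_rect_derive_e2 ab1 ab2 s2) -(integral_atan_kernel a.1 s0).
  apply: eq_integral => x _; congr (_%:E); rewrite !derive_pole /e2 /= !mul1r !mul0r !add0r.
  have m1 : mdist2 a (x, a.2 + s) = s ^+ 2 + (x - a.1) ^+ 2 by rewrite /mdist2 /=; ring.
  have m2 : mdist2 a (x, a.2 - s) = s ^+ 2 + (x - a.1) ^+ 2 by rewrite /mdist2 /=; ring.
  have n0 : s ^+ 2 + (x - a.1) ^+ 2 != 0 by rewrite gt_eqF// ltr_pwDl ?exprn_gt0// sqr_ge0.
  rewrite !big; last 2 first.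
  - by rewrite m2 lerDl sqr_ge0.
  - by rewrite m1 lerDl sqr_ge0.
  by rewrite m1 m2; field; rewrite n0 gt_eqF.
have iD (v : R * R) : mu.-integrable (square a s) (EFin \o 'D_v ('D_v (pole k a))).
  have sv := Cinf_derive v (Cinf_derive v sp).
  have cD z : {for z, continuous ('D_v ('D_v (pole k a)))}.
    exact: (Cinf_continuous (x := z) sv I).
  have [C C0 hC] := continuous_compact_bounded
    (@compact_rect R (a.1 - s) (a.1 + s) (a.2 - s) (a.2 + s)) (fun z _ => cD z).
  apply: (@bounded_integrable _ _ _ _ _ (measurable_square a s) _ _ C) => //.
    by rewrite [X in (X < _)%E](mu_square a s0) ltry.
  apply: measurable_funTS; exact: (continuous_measurable_plane oT (fun z _ => cD z)).
have R1 : \int[mu]_(z in square a s) 'D_e1 ('D_e1 (pole k a)) z = - pi := congr1 fine I1.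
have R2 : \int[mu]_(z in square a s) 'D_e2 ('D_e2 (pole k a)) z = - pi := congr1 fine I2.
apply: etrans (RintegralD (measurable_square a s) (iD e1) (iD e2)) _.
by apply: etrans (f_equal2 +%R R1 R2) _; ring.
Qed.

End RegularizedPole.

(** * The harmonic part of the Green function *)

Section LogDenominator.
Context {R : realType}.
Implicit Types (a z v : R * R) (k : R).

Definition log_mden a z : R := ln (mden a z) / 2.

Lemma Cinf_log_mden a : disk a -> Cinf (mdom a) (log_mden a).
Proof.
move=> Da; have oU := open_mdom Da.
rewrite (_ : log_mden a = (fun z => 2^-1 * (@ln R \o mden a) z)); last first.
  by apply/funext => z; rewrite /log_mden /= mulrC.
apply: CinfZ => //; apply: (@Cinf_comp1 _ _ _ [set x | 0 < x]) => //.
- by move=> z /mdom_mden_gt0.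
- exact: CinfS (Cinf_mden a).
- exact: Cinf_ln.
Qed.

Let num a v z : R := - (a.1 * v.1 + a.2 * v.2) * mden1 a z + (a.2 * v.1 - a.1 * v.2) * mden2 a z.

Lemma derive_log_mden a v z : mdom a z -> 'D_v (log_mden a) z = num a v z / mden a z.
Proof.
move=> Uz; have m0 := mdom_mden_gt0 Uz.
have hm := is_derive_mden a z v.
have dm : differentiable (mden a) z by exact: Cinf_differentiable (Cinf_mden a) _.
have dl : differentiable (@ln R) (mden a z).
  by apply/derivable1_diffP; have [] := is_derive1_ln m0.
have hl : is_derive z v (@ln R \o mden a) (num a v z * 2 / mden a z).
  split; first by apply/diff_derivable; exact: differentiable_comp.
  by rewrite derive_comp1//; have [_ ->] := is_derive1_ln m0; have [_ ->] := hm.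
have [_ E] := is_derive_mul hl (is_derive_const 2^-1 z v).
by apply: (etrans E); rewrite mulr0 add0r /=; field; rewrite gt_eqF.
Qed.

Lemma second_derive_log_mden a v z : disk a -> mdom a z ->
  'D_v ('D_v (log_mden a)) z =
  (((a.1 * v.1 + a.2 * v.2) ^+ 2 + (a.2 * v.1 - a.1 * v.2) ^+ 2) * mden a z
    - 2 * num a v z ^+ 2) / mden a z ^+ 2.
Proof.
move=> Da Uz; have oU := open_mdom Da.
have E : {in mdom a, 'D_v (log_mden a) =1 (fun y => num a v y / mden a y)}.
  by move=> y; rewrite inE => Uy; exact: derive_log_mden.
have zU : z \in mdom a by rewrite inE.
apply: etrans (eq_on_derive v oU E zU) _.
have hn := is_derive_add
  (is_derive_mul (is_derive_const (- (a.1 * v.1 + a.2 * v.2)) z v) (is_derive_mden1 a z v))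
  (is_derive_mul (is_derive_const (a.2 * v.1 - a.1 * v.2) z v) (is_derive_mden2 a z v)).
have [_ h] := is_derive_div Uz hn (is_derive_mden a z v).
by apply: (etrans h); rewrite /num; congr (_ / _); ring.
Qed.

(** [log_mden a] is the logarithm of the modulus of the holomorphic function [1 - conj a * z], which
    has no zero in [mdom a]. *)
Lemma laplacian_log_mden a z : disk a -> mdom a z -> laplacian (log_mden a) z = 0.
Proof.
move=> Da Uz; apply: etrans (f_equal2 +%R (second_derive_log_mden e1 Da Uz)
  (second_derive_log_mden e2 Da Uz)) _.
rewrite -mulrDl /num /e1 /e2 /=; apply/eqP; rewrite mulf_eq0; apply/orP; left; apply/eqP.
rewrite /mden; ring.
Qed.

(* Regularization of the Green function [- ln (mratio a z) / 2] at its pole. *)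
Definition green_reg k a : R * R -> R := pole k a \+ (log_mden a \+ cst (ln k / 2)).

Lemma Cinf_green_reg k a : disk a -> Cinf (mdom a) (green_reg k a).
Proof.
move=> Da; have oU := open_mdom Da.
apply: CinfD => //; first exact: CinfS (Cinf_pole k a).
by apply: CinfD => //; [exact: Cinf_log_mden|exact: Cinf_cst].
Qed.

Lemma laplacian_green_reg k a z : disk a -> mdom a z ->
  laplacian (green_reg k a) z = laplacian (pole k a) z.
Proof.
move=> Da Uz; have oU := open_mdom Da.
have s1 : Cinf (mdom a) (pole k a) by exact: CinfS (Cinf_pole k a).
have s2 := Cinf_log_mden Da.
have s3 : Cinf (mdom a) (cst (ln k / 2)) by exact: Cinf_cst.
apply: etrans (laplacianD oU s1 (CinfD oU s2 s3) Uz) _.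
rewrite (laplacianD oU s2 s3 Uz).
by rewrite (laplacian_log_mden Da Uz) (laplacian_cst (ln k / 2) z) !addr0.
Qed.

(** The constant [ln k / 2] undoes the scaling inside [pole k a], so the agreement with the Green
    function is exact once the pole is left behind. *)
Lemma green_regE k a z : 0 < k -> mdom a z -> 3 <= k * mdist2 a z ->
  green_reg k a z = - ln (mratio a z) / 2.
Proof.
move=> k0 Uz h; have m0 := mdom_mden_gt0 Uz.
have t0 : 0 < mdist2 a z by rewrite -(pmulr_rgt0 _ k0); lra.
rewrite /green_reg /pole /= /cst flatlogE// /log_mden /mratio.
by rewrite lnM ?posrE// ln_div ?posrE//; ring.
Qed.

(** For large [k] the smoothed core of the pole lies inside the hyperbolic disk [mratio a z < c].
    The constant comes from the bound [B] on [1 / mden]. *)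
Lemma mdist2_ge a (c : R) : disk a -> 0 < c -> exists2 K : R, 0 < K &
  forall k z, K <= k -> disk z -> c <= mratio a z -> 4 <= k * mdist2 a z.
Proof.
move=> Da c0; have [B B0 hB] := mden_inv_bounded Da.
exists (4 * B / c); first by rewrite !mulr_gt0 ?invr_gt0.
move=> k z Kk Dz cz; have m0 := mden_gt0 Da Dz.
have h : c / B <= mdist2 a z.
  rewrite -(divfK (lt0r_neq0 m0) (mdist2 a z)); apply: ler_pM => //.
  - exact: ltW.
  - by rewrite invr_ge0 ltW.
  - by rewrite -[leRHS]invrK lef_pV2 ?posrE ?invr_gt0// hB.
have k0 : 0 < k by apply: lt_le_trans Kk; rewrite !mulr_gt0 ?invr_gt0.
apply: le_trans (ler_wpM2l (ltW k0) h).
have cB : 0 < c / B by rewrite divr_gt0.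
rewrite -ler_pdivrMr//; apply: le_trans Kk.
by rewrite invf_div mulrA.
Qed.

End LogDenominator.

(** * Concentration of the Laplacian at the pole *)

Section PoleConcentration.
Context {R : realType}.
Local Notation plane := (measurableTypeR R * measurableTypeR R)%type.
Local Notation mu := (@plane_measure R).
Implicit Types (a z : R * R) (f : R * R -> R) (k s eps : R).

Lemma Rintegral_subset_disk (A : set plane) f : A `<=` disk ->
  (forall z, disk z -> ~ A z -> f z = 0) ->
  \int[mu]_(z in disk) f z = \int[mu]_(z in A) f z.
Proof.
move=> AD f0; rewrite Rintegral_mkcond [RHS]Rintegral_mkcond; apply: eq_Rintegral => z _.
rewrite !patchE; case: ifPn => [|zD].
  by rewrite inE => Dz; case: ifPn => // /negP zA; apply: f0 => // Az; apply: zA; rewrite inE.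
case: ifPn => // ; rewrite inE => /AD Dz; by move/negP: zD; rewrite inE.
Qed.

Lemma Rintegral_le_bound (A : set plane) f (M m : R) : measurable A -> mu A = m%:E ->
  measurable_fun A f -> (forall z, A z -> `|f z| <= M) -> `|\int[mu]_(z in A) f z| <= M * m.
Proof.
move=> mA muA mf fM.
have fin : (mu A < +oo)%E by rewrite muA ltry.
have h := bounded_integrable mA fin mf fM.
have mn : measurable_fun A (fun z => `|f z|) by exact: measurableT_comp.
have hn : mu.-integrable A (EFin \o (fun z => `|f z|)).
  apply: (bounded_integrable mA fin mn) => z Az /=; rewrite normr_id; exact: fM.
have hc : mu.-integrable A (EFin \o (fun _ : plane => M)).
  exact: (bounded_integrable mA fin (measurable_cst M) (fun z _ => lexx `|M|)).
apply: (le_trans (le_normr_Rintegral mA h)).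
apply: (le_trans (le_Rintegral mA hn hc fM)).
by rewrite (Rintegral_cst _ mA) [X in M * fine X](_ : _ = mu A)// muA.
Qed.

(** The Laplacian has total mass [- 2 pi] on a square shrinking to [a]. Its size is at most [4 k C]
    on an area [4 s^2], and [k s^2 = 4], so its L^1 norm stays below [64 C] and the oscillation of
    [f] on the square controls the error. *)
Lemma pole_concentration f a K0 : disk a -> mbounded f -> {for a, continuous f} ->
  forall eps, 0 < eps -> exists k, [/\ 0 < k, K0 <= k &
    `|\int[mu]_(z in disk) (f z * laplacian (pole k a) z) + 2 * pi * f a| <= eps].
Proof.
move=> Da bf cf eps eps0.
have [C C0 hC] := @flatlog_lap_bounded R.
have C1 : 0 < 64 * C + 64 by lra.
(* The admissible oscillation of [f]; the added 64 only keeps the denominator positive when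
   [C = 0]. *)
pose eta := eps / (64 * C + 64).
have eta0 : 0 < eta by rewrite divr_gt0.
have nD : \forall z \near a, disk z by apply: open_nbhs_nbhs; split => //; exact: open_disk.
have nf : \forall z \near a, `|f a - f z| < eta by move/cvgrPdist_lt: cf; exact.
have [r /= r0 hr] := (nbhs_ballP a _).1 (filterI nD nf).
pose K1 := `|K0| + 1; have K10 : 0 < K1 by rewrite ltr_wpDl.
(* [r / 2] keeps the square in the ball of small oscillation, and [1 / K1] makes [4 / s^2] exceed
   [K0]. *)
pose s := minr (r / 2) K1^-1.
have s0 : 0 < s by rewrite lt_min divr_gt0// invr_gt0.
have sr : s < r by rewrite gt_min; apply/orP; left; lra.
have sK : s * K1 <= 1 by rewrite -ler_pdivlMr// mul1r ge_min lexx orbT.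
have K11 : 1 <= K1 by rewrite lerDr.
have s1 : s <= 1 by rewrite (le_trans _ sK)// ler_peMr// ltW.
have ss0 : 0 < s ^+ 2 by rewrite exprn_gt0.
(* On and outside the boundary of the square [k * mdist2 a z >= 4], which is in the range where
   [flatlog] is the exact logarithm. *)
pose k := 4 / s ^+ 2.
have k0 : 0 < k by rewrite divr_gt0.
have ks : k * s ^+ 2 = 4 by rewrite /k divfK ?gt_eqF.
have kK : K0 <= k.
  have : K1 * s ^+ 2 <= 4.
    rewrite expr2 mulrA [K1 * s]mulrC; apply: (@le_trans _ _ 1); last by lra.
    rewrite -(mulr1 1) ler_pM// ?mulr_ge0 ?ltW//.
  rewrite -ler_pdivlMr// => h; apply: le_trans h.
  by rewrite /K1 (le_trans (ler_norm _))// lerDl.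
have sub z : square a s z -> disk z /\ `|f a - f z| < eta.
  move=> [/= h1 h2]; apply: hr.
  move: h1 h2; rewrite !in_itv /= => /andP[h1 h2] /andP[h3 h4].
  by rewrite ball_squareE; split; rewrite /= in_itv /=; apply/andP; split; lra.
have sD : square a s `<=` disk by move=> z /sub[].
have out z : disk z -> ~ square a s z -> laplacian (pole k a) z = 0.
  move=> _ Az; rewrite laplacian_pole flatlog_lap_eq0 ?mulr0//.
  have h : s ^+ 2 <= mdist2 a z.
    rewrite leNgt; apply/negP => hs; apply: Az.
    have q (x y : R) : 0 <= y -> x ^+ 2 + y < s ^+ 2 -> - s <= x <= s.
      move=> y0 h; have : x ^+ 2 < s ^+ 2 by lra.
      rewrite -ler_norml => hx; have s0' := ltW s0.
      by rewrite -(@ler_pXn2r _ 2)// ?nnegrE// real_normK ?num_real// ltW.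
    have /andP[x1 x2] := q _ _ (sqr_ge0 (z.2 - a.2)) hs.
    have hs' : (z.2 - a.2) ^+ 2 + (z.1 - a.1) ^+ 2 < s ^+ 2 by rewrite addrC.
    have /andP[y1 y2] := q _ _ (sqr_ge0 (z.1 - a.1)) hs'.
    by split; rewrite /= in_itv /=; apply/andP; split; lra.
  by have := ler_wpM2l (ltW k0) h; rewrite ks; lra.
have mS := measurable_square a s.
have lapC : Cinf [set: R * R] (laplacian (pole k a)).
  by apply: Cinf_laplacian; [exact: openT|exact: Cinf_pole].
have mL : measurable_fun (square a s) (laplacian (pole k a)).
  by apply: measurable_funTS; apply: (continuous_measurable_plane openT) => z _;
    exact: Cinf_continuous lapC _.
have mf : measurable_fun (square a s) f.
  by case: bf => m _; apply: (measurable_funS measurable_disk sD m).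
exists k; split=> //; rewrite (Rintegral_subset_disk sD); last by move=> z Dz Az; rewrite out// mulr0.
have EL := integral_square_laplacian_pole a s0 ks.
have fin : (mu (square a s) < +oo)%E by rewrite [X in (X < _)%E](mu_square a s0) ltry.
have lB z : `|laplacian (pole k a) z| <= 4 * k * C.
  rewrite laplacian_pole normrM ger0_norm; last by rewrite mulr_ge0// ltW.
  apply: ler_wpM2l; first by rewrite mulr_ge0 ?(ltW k0).
  by apply: hC; rewrite mulr_ge0 ?mdist2_ge0 ?(ltW k0).
have iL : mu.-integrable (square a s) (EFin \o laplacian (pole k a)).
  exact: (bounded_integrable mS fin mL (fun z _ => lB z)).
have ifL : mu.-integrable (square a s) (EFin \o (fun z => f z * laplacian (pole k a) z)).
  have [_ [Bf hf]] := bf.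
  have h z : square a s z -> `|f z * laplacian (pole k a) z| <= Bf * (4 * k * C).
    by move=> /sD Dz; rewrite normrM ler_pM// hf.
  exact: (bounded_integrable mS fin (measurable_funM mf mL) h).
have -> : 2 * pi * f a = - (f a * \int[mu]_(z in square a s) laplacian (pole k a) z).
  by rewrite EL; ring.
rewrite -(RintegralZl _ mS iL).
rewrite -(RintegralB mS ifL); last exact: (integrableZl mS (f a) iL).
have b z : square a s z -> `|f z * laplacian (pole k a) z - f a * laplacian (pole k a) z|
    <= eta * (4 * k * C).
  move=> /sub[_ h]; rewrite -mulrBl normrM ler_pM//.
  by rewrite distrC ltW.
apply: (le_trans (Rintegral_le_bound mS (mu_square a s0) _ b)).
  by apply: measurable_funB; apply: measurable_funM => //; exact: measurable_cst.
have -> : eta * (4 * k * C) * (4 * s ^+ 2) = eta * (64 * C).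
  by transitivity (16 * eta * C * (k * s ^+ 2)); [ring|rewrite ks; ring].
rewrite /eta mulrAC ler_pdivrMr// ler_pM2l//; lra.
Qed.

End PoleConcentration.

(** * The Dirichlet product of two truncated Green functions *)

Section GreenPairing.
Context {R : realType}.
Local Notation plane := (measurableTypeR R * measurableTypeR R)%type.
Local Notation mu := (@plane_measure R).
Variables (a1 a2 : R * R) (c1 c2 : R).
Hypotheses (Da1 : disk a1) (Da2 : disk a2).
Hypotheses (c10 : 0 < c1) (c11 : c1 < 1) (c20 : 0 < c2) (c21 : c2 < 1).
Hypothesis sep : forall z, disk z -> mratio a2 z <= c2 -> c1 <= mratio a1 z.
Implicit Types (z : R * R) (k K : R).

Local Notation f1 := (trunc_green a1 c1).
Let oD := @open_disk R.

Lemma trunc_green_continuous z : disk z -> {for z, continuous f1}.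
Proof.
move=> Dz; have Uz := nbhs_disk_sub (mdom_nbhs Da1) Dz.
have cm : {for z, continuous (mratio a1)} by exact: Cinf_continuous (Cinf_mratio Da1) Uz.
rewrite (_ : trunc_green a1 c1 =
  (fun y => - ln ((c1 + mratio a1 y + `|c1 - mratio a1 y|) / 2) / 2)); last first.
  by apply/funext => y; rewrite /trunc_green maxr_absE.
apply: continuousM; last exact: cvg_cst.
apply: continuousN.
apply: (@continuous_comp _ _ _ (fun y => (c1 + mratio a1 y + `|c1 - mratio a1 y|) / 2) (@ln R)).
  apply: continuousM; last exact: cvg_cst.
  apply: continuousD; first by apply: continuousD; [exact: cvg_cst|exact: cm].
  apply: (@continuous_comp _ _ _ (fun y => c1 - mratio a1 y) (fun x : R => `|x|)).
    by apply: continuousB; [exact: cvg_cst|exact: cm].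
  exact: norm_continuous.
by apply: continuous_ln; rewrite -maxr_absE lt_max c10.
Qed.

Let ler_normDM (x y x' y' b c b' c' : R) : `|x| <= b -> `|y| <= c -> `|x'| <= b' ->
  `|y'| <= c' -> `|x * y + x' * y'| <= b * c + b' * c'.
Proof.
move=> h1 h2 h3 h4; apply: (le_trans (ler_normD _ _)).
by rewrite !normrM lerD// ler_pM.
Qed.

(** Both terms equal the exact Green function with pole [a2] where [mratio a2 z >= c2], so their
    difference has compact support in the disk. *)
Definition green_diff k K z : R :=
  if asbool (disk z) then smooth_green a2 c2 k z - green_reg K a2 z else 0.

Lemma green_diff_eq0 k K z : 0 < k -> 0 < K ->
  (forall y, disk y -> c2 <= mratio a2 y -> 4 <= K * mdist2 a2 y) ->
  disk z -> c2 <= mratio a2 z -> green_diff k K z = 0.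
Proof.
move=> k0 K0 hK Dz h; rewrite /green_diff; case: asboolP => // _.
have Uz := nbhs_disk_sub (mdom_nbhs Da2) Dz.
have h4 := hK z Dz h.
rewrite green_regE//; last by lra.
rewrite /smooth_green smax_id ?subrr//.
by rewrite (@le_trans _ _ 0)// pmulr_rle0// subr_le0.
Qed.

Lemma test_green_diff k K : 0 < k -> 4 <= k * c2 -> 0 < K ->
  (forall y, disk y -> c2 <= mratio a2 y -> 4 <= K * mdist2 a2 y) ->
  test_function (green_diff k K).
Proof.
move=> k0 kc K0 hK; have [rho r1 hr] := mratio_compact Da2 c21.
have DU := nbhs_disk_sub (mdom_nbhs Da2).
apply: (Cinf_test (compact_closed_disk (ltW r1))).
- by move=> z /= h; apply/disk_sqn; exact: le_lt_trans r1.
- apply: (Cinf_ext (f := fun z => smooth_green a2 c2 k z - green_reg K a2 z)) => //.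
    by move=> z; rewrite inE => Dz; rewrite /green_diff asboolT.
  apply: CinfB => //; first exact: CinfS DU (Cinf_smooth_green Da2 k0 kc).
  exact: CinfS DU (Cinf_green_reg K Da2).
move=> z /= hz; have [Dz|nDz] := pselect (disk z); last first.
  by rewrite /green_diff asboolF.
apply: green_diff_eq0 => //; rewrite leNgt; apply/negP => /ltW h.
by apply: hz; exact: hr.
Qed.

(* Where [green_diff k K] is not zero, [f1] is a smooth harmonic function. *)
Lemma integral_green_diff k K : 0 < k -> 4 <= k * c2 -> 0 < K ->
  (forall y, disk y -> c2 <= mratio a2 y -> 4 <= K * mdist2 a2 y) ->
  \int[mu]_(z in disk) (f1 z * laplacian (green_diff k K) z) = 0.
Proof.
move=> k0 kc K0 hK; have tt := test_green_diff k0 kc K0 hK.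
have [K1 K10 hK1] := mdist2_ge Da1 c10.
have DU := nbhs_disk_sub (mdom_nbhs Da1).
have h4 y : disk y -> c1 <= mratio a1 y -> 4 <= K1 * mdist2 a1 y.
  by move=> Dy; exact: hK1.
have sr : Cinf disk (green_reg K1 a1) by exact: CinfS DU (Cinf_green_reg K1 Da1).
(* [f1] is not smooth, so it is exchanged for a function smooth on the whole disk that agrees with
   it where [mratio a2 z <= c2]. The Laplacian can then be moved to it. *)
transitivity (\int[mu]_(z in disk) (green_reg K1 a1 z * laplacian (green_diff k K) z)).
  apply: eq_Rintegral => z; rewrite inE => Dz.
  have [h|h] := leP (mratio a2 z) c2.
    have h1 := sep Dz h; congr (_ * _).
    rewrite green_regE//; [|exact: DU|by have := h4 z Dz h1; lra].
    by rewrite /trunc_green max_r.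
  have Oeq y : disk y -> (0 < mdist2 a2 y - c2 * mden a2 y) = (c2 < mratio a2 y).
    by move=> Dy; rewrite subr_gt0 /mratio ltr_pdivlMr// mden_gt0.
  (* [green_diff] has to vanish near [z], not just at [z], for its Laplacian to vanish there. The
     inequality is cleared of its denominator so that openness follows from continuity of
     polynomials. *)
  pose O : set (R * R) := disk `&` [set y | 0 < mdist2 a2 y - c2 * mden a2 y].
  have oU : open O.
    apply: openI => //; apply: (@open_comp _ _ (fun y => mdist2 a2 y - c2 * mden a2 y) [set x | 0 < x]).
      move=> y _; apply: continuousB; first exact: Cinf_continuous (Cinf_mdist2 a2) _.
      by apply: continuousM; [exact: cvg_cst|exact: Cinf_continuous (Cinf_mden a2) _].
    exact: open_gt.
  have E : {in O, green_diff k K =1 cst 0}.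
    move=> y; rewrite inE => -[Dy /=]; rewrite Oeq// => hy.
    by apply: green_diff_eq0 => //; exact: ltW.
  have zU : z \in O by rewrite inE; split=> //=; rewrite Oeq.
  by rewrite (eq_on_laplacian oU E zU) (laplacian_cst 0 z) !mulr0.
rewrite (laplacian_symmetric sr tt) -[RHS](_ : \int[mu]_(z in disk) (0 : R) = 0); last first.
  by rewrite /Rintegral integral0.
apply: eq_Rintegral => z; rewrite inE => Dz.
have [h|h] := leP c2 (mratio a2 z); first by rewrite (green_diff_eq0 k0 K0 hK Dz h) mulr0.
have h1 := h4 z Dz (sep Dz (ltW h)).
rewrite (laplacian_green_reg K1 Da1 (DU _ Dz)) laplacian_pole flatlog_lap_eq0 ?mulr0 ?mul0r//.
by lra.
Qed.

Lemma integral_laplacian_smooth_green k K : 0 < k -> 4 <= k * c2 -> 0 < K ->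
  (forall y, disk y -> c2 <= mratio a2 y -> 4 <= K * mdist2 a2 y) ->
  \int[mu]_(z in disk) (f1 z * laplacian (smooth_green a2 c2 k) z) =
  \int[mu]_(z in disk) (f1 z * laplacian (pole K a2) z).
Proof.
move=> k0 kc K0 hK; have tt := test_green_diff k0 kc K0 hK.
have DU := nbhs_disk_sub (mdom_nbhs Da2).
have st : Cinf disk (green_diff k K) by apply: CinfS (test_Cinf tt).
have sr : Cinf disk (green_reg K a2) by exact: CinfS DU (Cinf_green_reg K Da2).
have E : {in disk, smooth_green a2 c2 k =1 green_diff k K \+ green_reg K a2}.
  by move=> z; rewrite inE => Dz; rewrite /green_diff /= asboolT// subrK.
have [bf _ _] := test_limit_mbounded (trunc_green_limit Da1 c10 c11).
have bt : mbounded (laplacian (green_diff k K)).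
  split; first by apply: Cinf_measurable; exact: Cinf_laplacian.
  have cl z : {for z, continuous (laplacian (green_diff k K))}.
    have s := Cinf_laplacian (@openT _) (test_Cinf tt).
    exact: (Cinf_continuous (x := z) s I).
  have [C _ hC] := continuous_compact_bounded (compact_closed_disk (lexx (1:R))) (fun z _ => cl z).
  by exists C => z /disk_sqn /ltW /hC.
have bp : mbounded (laplacian (pole K a2)).
  have nT : nbhs_disk [set: R * R] by split => //; exact: openT.
  by apply: (Cinf_mbounded nT); apply: Cinf_laplacian; [exact: openT|exact: Cinf_pole].
have L : \int[mu]_(z in disk) (f1 z * laplacian (smooth_green a2 c2 k) z) =
    \int[mu]_(z in disk) (f1 z * laplacian (green_diff k K) z + f1 z * laplacian (pole K a2) z).
  apply: eq_Rintegral => z; rewrite inE => Dz; have zD : z \in disk by rewrite inE.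
  rewrite -mulrDr; congr (_ * _); apply: etrans (eq_on_laplacian oD E zD) _.
  apply: etrans (laplacianD oD st sr Dz) _; congr (_ + _).
  exact: laplacian_green_reg Da2 (DU _ Dz).
apply: etrans L (etrans (integral_disk_add (mboundedM bf bt) (mboundedM bf bp)) _).
by apply: etrans (congr1 (fun x => x + _) (integral_green_diff k0 kc K0 hK)) (add0r _).
Qed.

(** The two scales are decoupled. With the pole scale [K] fixed, the smoothing of the truncation
    tends to its limit and expresses the integral through [pole K a2], for every [K >= K0]; the left
    side is free of [K], so the one scale supplied by [pole_concentration] for each tolerance
    suffices. *)
Lemma integral_gradient_trunc_green :
  \int[mu]_(z in disk)
    (trunc_green_derive a1 c1 e1 z * trunc_green_derive a2 c2 e1 z +
     trunc_green_derive a1 c1 e2 z * trunc_green_derive a2 c2 e2 z) =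
  2 * pi * (- ln (mratio a1 a2) / 2).
Proof.
have lf := trunc_green_limit Da1 c10 c11; have [bf bp bq] := test_limit_mbounded lf.
have [K0 K00 hK0] := mdist2_ge Da2 c20.
have nU := mdom_nbhs Da2.
set I := (X in X = _).
have key K : K0 <= K -> I = - \int[mu]_(z in disk) (f1 z * laplacian (pole K a2) z).
  move=> K0K; have Kp : 0 < K by exact: lt_le_trans K0K.
  have hK y : disk y -> c2 <= mratio a2 y -> 4 <= K * mdist2 a2 y by exact: hK0.
  have [N Nc] : exists N : nat, 4 <= N%:R * c2.
    exists (Num.bound (4 / c2)); rewrite -ler_pdivrMr// ltW//.
    by rewrite archi_boundP// divr_ge0// ltW.
  have kc n : 4 <= (n + N).+1%:R * c2.
    by rewrite (le_trans Nc)// ler_pM2r// ler_nat leqW// leq_addl.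
  pose g n := smooth_green a2 c2 (n + N).+1%:R.
  have sg n : Cinf (mdom a2) (g n) by exact: Cinf_smooth_green.
  have [C C0 hC] := smooth_green_bounds Da2 c20 c21.
  have [_ [B1 hB1]] := bp; have [_ [B2 hB2]] := bq.
  have cv : \int[mu]_(z in disk) (trunc_green_derive a1 c1 e1 z * 'D_e1 (g n) z +
      trunc_green_derive a1 c1 e2 z * 'D_e2 (g n) z) @[n --> \oo] --> I.
    apply: (@Rintegral_disk_cvg _ _ _ (B1 * C + B2 * C)) => [n|z Dz|n z Dz].
    - exact: (mboundedD (mboundedM bp (Cinf_mbounded nU (Cinf_derive e1 (sg n))))
        (mboundedM bq (Cinf_mbounded nU (Cinf_derive e2 (sg n))))).
    - apply: cvgD.
        by apply: cvgM; [exact: cvg_cst|exact: cvg_derive_smooth_green].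
      by apply: cvgM; [exact: cvg_cst|exact: cvg_derive_smooth_green].
    - have [_ _ h1 h2] := hC _ z (ltr0Sn _ (n + N)) (kc n) Dz.
      exact: ler_normDM (hB1 z Dz) h1 (hB2 z Dz) h2.
  have E : (fun n => \int[mu]_(z in disk) (trunc_green_derive a1 c1 e1 z * 'D_e1 (g n) z +
      trunc_green_derive a1 c1 e2 z * 'D_e2 (g n) z)) =
      (fun=> - \int[mu]_(z in disk) (f1 z * laplacian (pole K a2) z)).
    apply/funext => n.
    have k0 : 0 < (n + N).+1%:R :> R by rewrite ltr0Sn.
    apply: etrans (weak_gradient_smooth lf nU (sg n)) (congr1 -%R _).
    exact: (@integral_laplacian_smooth_green (n + N).+1%:R K k0 (kc n) Kp hK).
  rewrite E in cv; exact: (cvg_unique (@norm_hausdorff _ _) cv (@cvg_cst _ _ _ _ _)).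
(* The centre [a2] belongs to its own disk, so separation puts it outside the truncated region of
   [f1]. *)
have fa : f1 a2 = - ln (mratio a1 a2) / 2.
  rewrite /trunc_green max_r//; apply: sep => //.
  by rewrite /mratio /mdist2 !subrr expr0n /= addr0 mul0r ltW.
rewrite -fa; apply/eqP; rewrite -subr_eq0 -normr_le0; apply/ler_addgt0Pr => eps eps0.
rewrite add0r.
have [K [_ K0K h]] := pole_concentration K0 Da2 bf (trunc_green_continuous Da2) eps0.
apply: le_trans h; rewrite (key K K0K) -normrN.
by rewrite opprD !opprK.
Qed.

End GreenPairing.

(** * Moments of centred Gaussian variables *)

Section GaussianMoments.
Context {R : realType} {d : measure_display} {Omega : measurableType d}.
Variable P : probability Omega R.
Implicit Types (X Y Z : {RV P >-> R}).
Local Open Scope ereal_scope.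

Lemma normal_prob_opp (s : R) (A : set (measurableTypeR R)) : (s != 0)%R -> measurable A ->
  normal_prob 0 s ((-%R : measurableTypeR R -> measurableTypeR R) @^-1` A) = normal_prob 0 s A.
Proof.
move=> s0 mA; rewrite /normal_prob.
transitivity (\int[pushforward (@lebesgue_measure R) (-%R : _ -> measurableTypeR R)]_(x in A)
    (normal_pdf 0 s x)%:E); last first.
  by apply: eq_measure_integral => B mB _; exact: lebesgue_measureN.
rewrite ge0_integral_pushforward//=; last 2 first.
- by apply: measurable_funTS; apply/measurable_EFinP; exact: measurable_normal_pdf.
- by move=> x _; rewrite lee_fin normal_pdf_ge0.
apply: eq_integral => x _; congr (_%:E).
by rewrite normal_pdfE// /normal_fun !subr0 sqrrN.
Qed.

Lemma centred_gaussian_opp X (A : set (measurableTypeR R)) : centred_gaussian X -> measurable A ->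
  distribution P X ((-%R : measurableTypeR R -> measurableTypeR R) @^-1` A) = distribution P X A.
Proof.
move=> [s hs] mA.
have mA' : measurable ((-%R : measurableTypeR R -> measurableTypeR R) @^-1` A).
  by rewrite -[X in measurable X]setTI; exact: oppr_measurable.
rewrite !hs//; case: eqVneq => [_|s0]; last exact: normal_prob_opp.
by rewrite !diracE; congr ((nat_of_bool _)%:R%:E); apply/idP/idP; rewrite !inE /= oppr0.
Qed.

(** The law is invariant under negation, so the mean equals its opposite; integrability makes it
    finite, hence 0. The degenerate law is covered by the same symmetry. *)
Lemma centred_gaussian_expectation X : centred_gaussian X ->
  P.-integrable [set: Omega] (EFin \o X) -> 'E_P[X] = 0.
Proof.
move=> gX iX.
have mO : measurable_fun [set: measurableTypeR R] (-%R : measurableTypeR R -> measurableTypeR R).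
  exact: oppr_measurable.
have mE : measurable_fun [set: measurableTypeR R] (EFin : measurableTypeR R -> \bar R).
  exact/measurable_EFinP.
have E1 : 'E_P[X] = \int[distribution P X]_y y%:E.
  by rewrite integral_distribution// expectation_def.
have iD : (distribution P X).-integrable [set: measurableTypeR R] (EFin : measurableTypeR R -> \bar R).
  by apply: integrable_pushforward => //; exact: measurable_funP.
have iD' : (distribution P X).-integrable [set: measurableTypeR R]
    ((EFin : measurableTypeR R -> \bar R) \o (-%R : measurableTypeR R -> measurableTypeR R)).
  exact: integrableN iD.
have E2 : \int[distribution P X]_y y%:E = - \int[distribution P X]_y y%:E.
  transitivity (\int[pushforward (distribution P X) (-%R : R -> R)]_y y%:E).
    by apply: eq_measure_integral => A mA _; apply/esym; exact: centred_gaussian_opp.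
  rewrite integral_pushforward// -integralN; first by [].
  by apply: fin_num_adde_defl; rewrite fin_numN; exact: integrable_neg_fin_num.
have fE : \int[distribution P X]_y y%:E \is a fin_num by exact: integrable_fin_num.
rewrite E1; move: E2; rewrite -(fineK fE) -EFinN => -[h]; congr (_%:E); lra.
Qed.

Lemma sqr_integrable X (v : R) : 'E_P[X \* X] = v%:E ->
  P.-integrable [set: Omega] (EFin \o (X \* X)%R).
Proof.
move=> EX; apply/integrableP; split.
  by apply/measurable_EFinP; exact: measurable_funM.
rewrite (_ : (\int[P]_x `|(EFin \o (X \* X)%R) x|) = v%:E) ?ltry//.
rewrite -EX unlock; apply: eq_integral => x _ /=.
by rewrite ger0_norm// -expr2 sqr_ge0.
Qed.

Lemma prod_integrable X Y :
  P.-integrable [set: Omega] (EFin \o (X \* X)%R) ->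
  P.-integrable [set: Omega] (EFin \o (Y \* Y)%R) ->
  P.-integrable [set: Omega] (EFin \o (X \* Y)%R).
Proof.
move=> iX iY; apply: (le_integrable measurableT _ _ (integrableD measurableT iX iY)).
  by apply/measurable_EFinP; exact: measurable_funM.
move=> x _ /=; rewrite lee_fin [leRHS]ger0_norm; last first.
  by rewrite addr_ge0// -expr2 sqr_ge0.
rewrite ler_norml; apply/andP.
have h1 := sqr_ge0 (X x + Y x)%R; have h2 := sqr_ge0 (X x - Y x)%R.
have h3 := sqr_ge0 (X x); have h4 := sqr_ge0 (Y x).
by split; nra.
Qed.

Lemma sqr_integrable_integrable X : P.-integrable [set: Omega] (EFin \o (X \* X)%R) ->
  P.-integrable [set: Omega] (EFin \o X).
Proof.
move=> iX.
have i1 : P.-integrable [set: Omega] (EFin \o (cst 1%R : Omega -> R)).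
  by apply: finite_measure_integrable_cst.
apply: (le_integrable measurableT _ _ (integrableD measurableT i1 iX)).
  exact/measurable_EFinP.
move=> x _ /=; rewrite lee_fin [leRHS]ger0_norm; last first.
  by rewrite addr_ge0// -expr2 sqr_ge0.
rewrite ler_norml; apply/andP.
have h1 := sqr_ge0 (X x - 1)%R; have h2 := sqr_ge0 (X x + 1)%R; have h3 := sqr_ge0 (X x).
by split; nra.
Qed.

(** Polarization: the means vanish, so the covariance is the mixed moment, read off from the second
    moment of the sum. [Z] is the field at the sum of the two functions, which is the sum of the
    fields only almost surely. *)
Lemma centred_covariance X Y (a b c : R) : centred_gaussian X -> centred_gaussian Y ->
  'E_P[X \* X] = a%:E -> 'E_P[Y \* Y] = b%:E ->
  forall Z, 'E_P[Z \* Z] = (a + 2 * c + b)%:E ->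
  {ae P, forall x, Z x = (1 * X x + Y x)%R} ->
  covariance P X Y = c%:E.
Proof.
move=> gX gY EX EY Z EZ ZXY.
have iX := sqr_integrable EX; have iY := sqr_integrable EY.
have iXY := prod_integrable iX iY.
have lX := sqr_integrable_integrable iX; have lY := sqr_integrable_integrable iY.
rewrite covarianceE; [|exact/Lfun1_integrable..].
rewrite (centred_gaussian_expectation gX lX) mul0e sube0.
have fXY : 'E_P[X \* Y] \is a fin_num by rewrite unlock; exact: integrable_fin_num.
have E : 'E_P[Z \* Z] = 'E_P[X \* X] + ('E_P[X \* Y] + 'E_P[X \* Y] + 'E_P[Y \* Y]).
  rewrite unlock.
  rewrite (ae_eq_integral (EFin \o (fun x => X x * X x + ((X x * Y x + X x * Y x) + Y x * Y x))%R)) //.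
  - have i1 : P.-integrable [set: Omega] (EFin \o (fun x => X x * Y x + X x * Y x)%R).
      exact: (integrableD measurableT iXY iXY).
    have i2 : P.-integrable [set: Omega] (EFin \o (fun x => X x * Y x + X x * Y x + Y x * Y x)%R).
      exact: (integrableD measurableT i1 iY).
    apply: etrans (integralD_EFin measurableT iX i2) _; congr (_ + _).
    apply: etrans (integralD_EFin measurableT i1 iY) _; congr (_ + _).
    by apply: etrans (integralD_EFin measurableT iXY iXY) _.
  - by apply/measurable_EFinP; exact: measurable_funM.
  - apply/measurable_EFinP; apply: measurable_funD; first exact: measurable_funM.
    apply: measurable_funD; last exact: measurable_funM.
    by apply: measurable_funD; exact: measurable_funM.
  - by apply: filterS ZXY => x h _ /=; rewrite h; congr (_%:E); ring.
move: E; rewrite EX EY EZ -(fineK fXY) -!EFinD => -[h]; congr (_%:E); lra.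
Qed.

End GaussianMoments.

(** * From hyperbolic averages to truncated Green functions *)

Section CovarianceOfAverages.
Context {R : realType}.
Local Notation plane := (measurableTypeR R * measurableTypeR R)%type.
Local Notation mu := (@plane_measure R).
Implicit Types (u v p q : R * R -> R) (a z : R * R).

Lemma test_limit_eq u v p q : {in disk, u =1 v} -> test_limit u p q -> test_limit v p q.
Proof.
move=> uv [f [C [tf bf cf]]]; exists f, C; split=> // z Dz.
have zD : z \in disk by rewrite inE.
by rewrite -uv//; exact: cf.
Qed.

Lemma test_limit_dirichletD u p q v p' q' : test_limit u p q -> test_limit v p' q' ->
  dirichlet (1 \*: u \+ v) (1 \*: u \+ v) = dirichlet u u + 2 * dirichlet u v + dirichlet v v.
Proof.
move=> lu lv.
have lw : test_limit (1 \*: u \+ v) (fun z => p' z + 1 * p z) (fun z => q' z + 1 * q z).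
  apply: test_limit_eq (test_limitD 1 lv lu) => z _.
  by rewrite /= addrC /GRing.scale.
rewrite (test_limit_dirichlet lw lw) (test_limit_dirichlet lu lu).
rewrite (test_limit_dirichlet lu lv) (test_limit_dirichlet lv lv).
have [_ bp bq] := test_limit_mbounded lu; have [_ bp' bq'] := test_limit_mbounded lv.
have b1 := mboundedD (mboundedM bp bp) (mboundedM bq bq).
have b2 := mboundedD (mboundedM bp bp') (mboundedM bq bq').
have b3 := mboundedD (mboundedM bp' bp') (mboundedM bq' bq').
have -> : \int[mu]_(z in disk) ((p' z + 1 * p z) * (p' z + 1 * p z) +
    (q' z + 1 * q z) * (q' z + 1 * q z)) =
  \int[mu]_(z in disk) ((p z * p z + q z * q z) + (((p z * p' z + q z * q' z) +
    (p z * p' z + q z * q' z)) + (p' z * p' z + q' z * q' z))).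
  by apply: eq_Rintegral => z _; ring.
rewrite (integral_disk_add b1 (mboundedD (mboundedD b2 b2) b3)).
rewrite (integral_disk_add (mboundedD b2 b2) b3) (integral_disk_add b2 b2).
by ring.
Qed.

Lemma mratio_cmod a z : disk a -> disk z -> mratio a z = cmod (moebius a z) ^+ 2.
Proof. by move=> Da Dz; rewrite cmod_sqr sqn_moebius. Qed.

Lemma cmod_moebius_itv a z : disk a -> disk z -> -1 < cmod (moebius a z) < 1.
Proof.
by move=> Da Dz; rewrite (lt_le_trans (ltrN10 _) (cmod_ge0 _))//; exact: moebius_disk.
Qed.

Lemma tanh_gt0 (x : R) : 0 < x -> 0 < tanh x.
Proof.
move=> x0; rewrite ltNge; apply/negP => h.
have /andP[h1 _] := tanh_itv x.
have := ler_artanh h1 h ltr01.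
by rewrite tanhK artanh0 leNgt x0.
Qed.

Lemma ln_sqr_half (x : R) : 0 < x -> ln (x ^+ 2) / 2 = ln x.
Proof. by move=> x0; rewrite expr2 lnM ?posrE//; field. Qed.

Lemma green0_trunc_isometry (F : R * R -> R * R) a (rho : R) : poincare_isometry F -> F a = 0 ->
  disk a -> 0 < rho ->
  {in disk, trunc_green a (tanh rho ^+ 2) =1 green0_trunc (tanh rho) \o F}.
Proof.
move=> iF Fa Da rho0 z; rewrite inE => Dz; have r0 := tanh_gt0 rho0.
rewrite /green0_trunc /= (cmod_isometry iF Fa Da Dz) /trunc_green mratio_cmod//.
set t := cmod _; have t0 : 0 <= t by exact: cmod_ge0.
have -> : maxr (tanh rho ^+ 2) (t ^+ 2) = maxr (tanh rho) t ^+ 2.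
  have [h|h] := leP (tanh rho) t.
    by rewrite max_r// ler_pXn2r ?nnegrE// ltW.
  by rewrite max_l// ler_pXn2r ?nnegrE// ltW.
by rewrite mulNr ln_sqr_half// lt_max r0.
Qed.

(** A common point of the open first disk and the closed second one would violate the triangle
    inequality; tangency is allowed because one inequality is strict. *)
Lemma hyp_disks_separated (z1 z2 : R * R) (rho1 rho2 : R) : disk z1 -> disk z2 ->
  0 < rho1 -> 0 < rho2 -> rho1 + rho2 <= hyp_dist z1 z2 ->
  forall z, disk z -> mratio z2 z <= tanh rho2 ^+ 2 -> tanh rho1 ^+ 2 <= mratio z1 z.
Proof.
move=> D1 D2 r10 r20 hd z Dz; rewrite !mratio_cmod// => h2.
have p1 := tanh_gt0 r10; have p2 := tanh_gt0 r20.
rewrite leNgt; apply/negP => h1.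
have l1 : cmod (moebius z1 z) < tanh rho1.
  by rewrite -(@ltr_pXn2r _ 2)// ?nnegrE ?cmod_ge0// ltW.
have l2 : cmod (moebius z2 z) <= tanh rho2.
  by rewrite -(@ler_pXn2r _ 2)// ?nnegrE ?cmod_ge0// ltW.
have /andP[m1 M1] := cmod_moebius_itv D1 Dz; have /andP[m2 M2] := cmod_moebius_itv D2 Dz.
have /andP[_ T1] := tanh_itv rho1; have /andP[_ T2] := tanh_itv rho2.
have a1 := ltr_artanh m1 l1 T1; have a2 := ler_artanh m2 l2 T2.
rewrite !tanhK -!hyp_distE// in a1 a2.
have := hyp_dist_triangle D1 D2 Dz; lra.
Qed.

End CovarianceOfAverages.

Unset Implicit Arguments.

Theorem mainTheorem1 (R : realType) (d : measure_display)
  (Omega : measurableType d) (P : probability Omega R)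
  (W : (R * R -> R) -> {RV P >-> R})
  (hW : gaussian_free_field W)
  (Phi : R * R -> R * R -> R * R)
  (hPhi : forall z : R * R, disk z ->
    poincare_isometry (Phi z) /\ Phi z z = 0)
  (z1 z2 : R * R) (hz1 : disk z1) (hz2 : disk z2)
  (rho1 rho2 : R) (hrho1 : 0 < rho1) (hrho2 : 0 < rho2)
  (hd : rho1 + rho2 <= hyp_dist z1 z2) :
  covariance P (hyp_average Phi W rho1 z1) (hyp_average Phi W rho2 z2)
    = (- ln (tanh (hyp_dist z1 z2)))%:E /\
  - ln (tanh (hyp_dist z1 z2)) = green z1 z2.
Proof.
split; last by [].
have [iso1 Phi1] := hPhi z1 hz1; have [iso2 Phi2] := hPhi z2 hz2.
have sq (rho : R) : 0 < rho -> 0 < tanh rho ^+ 2 /\ tanh rho ^+ 2 < 1.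
  move=> rho0; have t0 := tanh_gt0 rho0; have /andP[_ t1] := tanh_itv rho.
  by rewrite exprn_gt0// exprn_ilt1// ltW.
have [c10 c11] := sq _ hrho1; have [c20 c21] := sq _ hrho2.
have l1 := test_limit_eq (green0_trunc_isometry iso1 Phi1 hz1 hrho1) (trunc_green_limit hz1 c10 c11).
have l2 := test_limit_eq (green0_trunc_isometry iso2 Phi2 hz2 hrho2) (trunc_green_limit hz2 c20 c21).
have sep := hyp_disks_separated hz1 hz2 hrho1 hrho2 hd.
have H1 := test_limit_H01 l1; have H2 := test_limit_H01 l2.
(* Polarization applies the isometry property to the sum, in the form [1 \*: u \+ v] of
   [gff_linear]. *)
have H12 : H01 (1 \*: (green0_trunc (tanh rho1) \o Phi z1) \+ (green0_trunc (tanh rho2) \o Phi z2)).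
  apply: test_limit_H01; apply: test_limit_eq (test_limitD 1 l2 l1) => z _.
  by rewrite /= addrC /GRing.scale.
have m0 := cmod_moebius_itv hz1 hz2.
have dist0 : 0 < hyp_dist z1 z2 by apply: lt_le_trans hd; exact: addr_gt0.
have D12 : dirichlet (green0_trunc (tanh rho1) \o Phi z1) (green0_trunc (tanh rho2) \o Phi z2) =
    - ln (tanh (hyp_dist z1 z2)).
  rewrite (test_limit_dirichlet l1 l2) integral_gradient_trunc_green//.
  have p0 : (2 * pi : R) != 0 by rewrite mulf_neq0// gt_eqF// pi_gt0.
  rewrite mulKf// mulNr mratio_cmod//; congr (- _).
  rewrite -[cmod _](artanhK m0) -hyp_distE// ln_sqr_half//; exact: tanh_gt0.
rewrite -D12; apply: centred_covariance.
- exact: gff_gaussian hW _ H1.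
- exact: gff_gaussian hW _ H2.
- exact: gff_isometry hW _ H1.
- exact: gff_isometry hW _ H2.
- by rewrite -(test_limit_dirichletD l1 l2); exact: (gff_isometry hW H12).
- exact: gff_linear hW 1 _ _ H1 H2.
Qed.
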